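(* Let $k$ be a field of characteristic zero, let $R$ be a Noetherian domain that is a $k$-algebra, and let $B$ be an $\mathbb{A}^2$-form over $R$ (with respect to $k$). Let $D$ be a locally nilpotent $R$-derivation of $B$ and let $A=\operatorname{Ker}(D)$. Then the following are equivalent: (I) $\operatorname{grade}(D(B)B,B)$ is either $2$ or $\infty$. (II) $A$ is isomorphic as an $R$-algebra to $\operatorname{Sym}_R(N)$ for some projective $R$-module $N$ of rank one, and $D_{\mathfrak p}$ is irreducible for each $\mathfrak p\in\operatorname{Spec}(R)$.
   Context: All rings are commutative with unity. Let $k$ be a field with algebraic closure $\bar k$ and $R$ a $k$-algebra. An $R$-algebra $B$ is an $\mathbb{A}^n$-form over $R$ (with respect to $k$) if $B\otimes_k\bar k$ is isomorphic, as an $(R\otimes_k\bar k)$-algebra, to a polynomial ring in $n$ variables over $R\otimes_k\bar k$. $\operatorname{Sym}_R(N)$ is the symmetric algebra of the $R$-module $N$. An $R$-derivation $D:B\to B$ is an $R$-linear map satisfying the Leibniz rule; it is locally nilpotent if for each $b\in B$ there is $n\ge 0$ with $D^n(b)=0$; $\operatorname{Ker}(D)=\{b\in B: D(b)=0\}$. $D(B)B$ is the ideal of $B$ generated by the image of $D$. For $\mathfrak p\in\operatorname{Spec}(R)$, $B_{\mathfrak p}$ is the localization of $B$ at $R\setminus\mathfrak p$, and $D_{\mathfrak p}$ is the extension of $D$ to $B_{\mathfrak p}$. A derivation $D$ of a ring $B$ is reducible if there is a non-unit $b\in B$ with $D(B)\subseteq bB$, and irreducible otherwise. For an ideal $I$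 of a Noetherian ring $S$, $\operatorname{grade}(I,S)$ is the length of a maximal $S$-regular sequence contained in $I$ if $I\ne S$, and is $\infty$ if $I=S$. *)

(* Defs.v *)
From HB Require Import structures.
From mathcomp Require Import all_boot all_order all_algebra.
From mathcomp Require Import generic_quotient ring_quotient.
From mathcomp Require Import boolp.
From mathcomp Require classical_sets.
From mathcomp Require Import finmap monalg.
From mathcomp Require Import ring.

Set Implicit Arguments.
Unset Strict Implicit.
Unset Printing Implicit Defensive.

Import GRing.Theory.
Local Open Scope ring_scope.
Local Open Scope quotient_scope.

Section Ideals.
Variable C : comPzRingType.

Definition is_ideal (I : C -> Prop) : Prop :=
  [/\ I 0, forall x y, I x -> I y -> I (x + y) & forall a x, I x -> I (a * x)].

Definition ideal_gen (G : C -> Prop) : C -> Prop :=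
  fun x => forall I, is_ideal I -> (forall g, G g -> I g) -> I x.

Lemma ideal_gen_ideal G : is_ideal (ideal_gen G).
Proof.
split=> [I [] //|x y hx hy I iI sI|a x hx I iI sI].
  by case: (iI) => _ + _; apply; [apply: hx | apply: hy].
by case: (iI) => _ _; apply; apply: hx.
Qed.

Lemma ideal_gen_sub (G : C -> Prop) g : G g -> ideal_gen G g.
Proof. by move=> Gg I _; apply. Qed.

Definition noetherian : Prop :=
  forall I, is_ideal I ->
  exists s : seq C, forall x, I x <-> ideal_gen (fun y => y \in s) x.

(* Regular sequences on C itself; the last condition is C / (xs) != 0. *)
Definition regular_seq (xs : seq C) : Prop :=
  (forall i, (i < size xs)%N -> forall y,
     ideal_gen (fun z => z \in take i xs) (xs`_i * y) ->
     ideal_gen (fun z => z \in take i xs) y)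
  /\ ~ ideal_gen (fun z => z \in xs) 1.

Definition maximal_regular_seq_in (I : C -> Prop) (xs : seq C) : Prop :=
  [/\ regular_seq xs, forall x, x \in xs -> I x
    & forall y, I y -> ~ regular_seq (rcons xs y)].

(* [grade_is I g] says that the grade of I is g, where [None] stands for oo.
   In a Noetherian ring all maximal regular sequences in a proper ideal have
   the same length, so that g is determined by I. *)
Definition grade_is (I : C -> Prop) (g : option nat) : Prop :=
  match g with
  | None => forall x, I x
  | Some n => (exists x, ~ I x) /\
      exists xs, maximal_regular_seq_in I xs /\ size xs = n
  end.

Definition is_unit (b : C) : Prop := exists c, b * c = 1.

Definition reducible_der (D : C -> C) : Prop :=
  exists b, ~ is_unit b /\ forall x, exists c, D x = b * c.

Definition irreducible_der (D : C -> C) : Prop := ~ reducible_der D.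

End Ideals.

Lemma ideal_gen_closed (C : comNzRingType) (G : C -> Prop) :
  ~ ideal_gen G 1 -> idealr_closed (fun x => `[< ideal_gen G x >]).
Proof.
have [h0 hD hM] := ideal_gen_ideal G; move=> h1; split.
- exact/asboolP.
- by apply/negP => /asboolP.
- move=> a x y /asboolP hx /asboolP hy; apply/asboolP; apply: hD => //.
  exact: hM.
Qed.

Section PolynomialSymbols.

Definition cmonom_eval (I : choiceType) (C : comNzRingType) (h : I -> C)
  (m : {cmonom I}) : C := \prod_(i <- finsupp m) h i ^+ m i.

Variables (I : choiceType) (C : comNzRingType) (h : I -> C).

Lemma cmonom_evalEw (d : {fset I}) (m : {cmonom I}) : (finsupp m `<=` d)%fset ->
  cmonom_eval h m = \prod_(i <- d) h i ^+ m i.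
Proof.
move=> le; rewrite /cmonom_eval (big_fset_incl _ le) //.
by move=> i _; rewrite -cmE_eq0 => /eqP ->.
Qed.

Lemma cmonom_eval_mmorphism : mmorphism (cmonom_eval h).
Proof.
split=> [m1 m2|]; last by rewrite /cmonom_eval mdom1 big_seq_fset0.
have le1 : (finsupp m1 `<=` finsupp (mmul m1 m2))%fset.
  by rewrite mdomD fsubsetUl.
have le2 : (finsupp m2 `<=` finsupp (mmul m1 m2))%fset.
  by rewrite mdomD fsubsetUr.
rewrite (cmonom_evalEw le1) (cmonom_evalEw le2) -big_split /=.
by apply: eq_bigr => i _; rewrite cmM exprD.
Qed.

HB.instance Definition _ :=
  isMultiplicative.Build {cmonom I} C (cmonom_eval h) cmonom_eval_mmorphism.

Lemma cmonom_evalU i : cmonom_eval h (ucm i) = h i.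
Proof. by rewrite /cmonom_eval mdomU big_seq_fset1 cmUU expr1. Qed.

End PolynomialSymbols.

(* {malg A[{cmonom I}]} is the polynomial ring over A in the variables X_i,
   i in I, for an arbitrary (possibly infinite) index type I. *)
Definition mvar (A : comNzRingType) (I : choiceType) (i : I) :
  {malg A[{cmonom I}]} := mkmalgU (ucm i) 1.

Lemma mmap_mvar (A C : comNzRingType) (I : choiceType)
    (f : {rmorphism A -> C}) (h : I -> C) i :
  mmap f (cmonom_eval h) (mvar A i) = h i.
Proof. by rewrite mmapU /= rmorph1 mul1r cmonom_evalU. Qed.

Section SymmetricAlgebra.
Variables (R : comNzRingType) (N : lmodType R).

(* Sym_R(N) = R[X_x, x in N] / (X_(x + y) - X_x - X_y, X_(a x) - a X_x) *)
Inductive sym_rel : {malg R[{cmonom N}]} -> Prop :=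
| SymRelD (x y : N) : sym_rel (mvar R (x + y) - (mvar R x + mvar R y))
| SymRelZ (a : R) (x : N) : sym_rel (mvar R (a *: x) - malgC a * mvar R x).

Definition sym_ideal : {pred {malg R[{cmonom N}]}} :=
  fun x => `[< ideal_gen sym_rel x >].

Lemma sym_ideal_closed : idealr_closed sym_ideal.
Proof.
apply: ideal_gen_closed => /(_ (fun x => mcoeff mone x = 0)) h.
have mvar1 x : mcoeff mone (mvar R x : {malg R[{cmonom N}]}) = 0.
  rewrite mcoeffU1; case: eqP => // e.
  by have := cmUU x; rewrite e cm1.
have auxD (u v w : {malg R[{cmonom N}]}) : mcoeff mone u = 0 ->
    mcoeff mone v = 0 -> mcoeff mone w = 0 -> mcoeff mone (u - (v + w)) = 0.
  by move=> hu hv hw; rewrite mcoeffB mcoeffD hu hv hw addr0 subr0.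
have auxM (u v w : {malg R[{cmonom N}]}) : mcoeff mone u = 0 ->
    mcoeff mone v = 0 -> mcoeff mone (u - w * v) = 0.
  by move=> hu hv; rewrite mcoeffB rmorphM /= hu hv mulr0 subr0.
suff /eqP : mcoeff mone (1 : {malg R[{cmonom N}]}) = 0.
  by rewrite rmorph1 oner_eq0.
apply: h => [|_ [x y|a x]].
- split=> [|x y hx hy|a x hx]; first by rewrite raddf0.
    by rewrite raddfD /= hx hy addr0.
  by rewrite rmorphM /= hx mulr0.
- exact: (auxD _ _ _ (mvar1 (x + y)) (mvar1 x) (mvar1 y)).
- exact: (auxM _ _ _ (mvar1 (a *: x)) (mvar1 x)).
Qed.

HB.instance Definition _ :=
  isIdealr.Build {malg R[{cmonom N}]} sym_ideal sym_ideal_closed.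

Definition Sym := {ideal_quot sym_ideal}.

HB.instance Definition _ := GRing.ComNzRing.on Sym.

Definition sym_in (x : N) : Sym := \pi_Sym (mvar R x).
Definition sym_cst (a : R) : Sym := \pi_Sym (malgC a).

Let piD x y : \pi_Sym (x + y) = \pi_Sym x + \pi_Sym y.
Proof. by rewrite !piE. Qed.
Let piM x y : \pi_Sym (x * y) = \pi_Sym x * \pi_Sym y.
Proof. by rewrite !piE. Qed.

Lemma sym_cstM a b : sym_cst (a * b) = sym_cst a * sym_cst b.
Proof. by rewrite /sym_cst -piM; congr (\pi_Sym _); exact: mpolyCM. Qed.
Lemma sym_cstD a b : sym_cst (a + b) = sym_cst a + sym_cst b.
Proof. by rewrite /sym_cst -piD; congr (\pi_Sym _); exact: raddfD. Qed.
Lemma sym_cst1 : sym_cst 1 = 1.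
Proof. by rewrite /sym_cst mpolyC1E; rewrite !piE. Qed.

Definition sym_scale (a : R) (x : Sym) : Sym := sym_cst a * x.

Lemma sym_scaleA a b x : sym_scale a (sym_scale b x) = sym_scale (a * b) x.
Proof. by rewrite /sym_scale sym_cstM mulrA. Qed.
Lemma sym_scale1 : left_id 1 sym_scale.
Proof. by move=> x; rewrite /sym_scale sym_cst1 mul1r. Qed.
Lemma sym_scaleDr : right_distributive sym_scale +%R.
Proof. by move=> a x y; rewrite /sym_scale mulrDr. Qed.
Lemma sym_scaleDl x : {morph sym_scale^~ x : a b / a + b}.
Proof. by move=> a b; rewrite /sym_scale sym_cstD mulrDl. Qed.
Lemma sym_scaleAl a x y : sym_scale a (x * y) = sym_scale a x * y.
Proof. by rewrite /sym_scale mulrA. Qed.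

HB.instance Definition _ := GRing.Zmodule_isLmodule.Build R Sym
  sym_scaleA sym_scale1 sym_scaleDr sym_scaleDl.
HB.instance Definition _ := GRing.Lmodule_isLalgebra.Build R Sym sym_scaleAl.
HB.instance Definition _ := GRing.Lalgebra_isComAlgebra.Build R Sym.

End SymmetricAlgebra.

(* A nonzero algebra over a field k has a k-linear functional sending 1 to 1. *)
Section UnitFunctional.
Variables (k : fieldType) (S : comNzRingType) (f : {rmorphism k -> S}).

Definition is_subsp (W : S -> Prop) : Prop :=
  [/\ W 0, forall x y, W x -> W y -> W (x + y), forall c x, W x -> W (f c * x)
    & ~ W 1].

Lemma max_subsp : exists W, is_subsp W /\
  forall x, exists c, W (x - f c).
Proof.
pose T := {W : S -> Prop | is_subsp W}.
have sub0 : is_subsp (fun x => x = 0).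
  split=> // [x y -> ->|c x ->|/eqP]; rewrite ?addr0 ?mulr0 //.
  by rewrite oner_eq0.
pose le (U V : T) := `[< forall x, sval U x -> sval V x >].
have [||||W Wmax] := @classical_sets.Zorn T le.
- by move=> U; apply/asboolP.
- by move=> U V W /asboolP UV /asboolP VW; apply/asboolP => x /UV /VW.
- move=> [U hU] [V hV] /asboolP /= UV /asboolP /= VU; apply: eq_exist.
  by apply/funext => x; apply/propext; split=> [/UV|/VU].
- move=> A totA; case: (pselect (exists U, A U)) => [[U0 AU0]|noA]; last first.
    by exists (exist _ _ sub0) => U AU; case: noA; exists U.
  pose V x := exists2 U : T, A U & sval U x.
  suff hV : is_subsp V.
    by exists (exist _ V hV) => U AU; apply/asboolP => x Ux /=; exists U.
  split.
  - by exists U0 => //; case: (svalP U0).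
  - move=> x y [U AU Ux] [U' AU' U'y].
    have [/asboolP leU|/asboolP leU] := totA _ _ AU AU'.
      by exists U' => //; have [_ + _ _] := svalP U'; apply => //; apply: leU.
    by exists U => //; have [_ + _ _] := svalP U; apply => //; apply: leU.
  - by move=> c x [U AU Ux]; exists U => //; case: (svalP U) => _ _ + _; apply.
  - by case=> U _; case: (svalP U).
exists (sval W); split; first exact: svalP.
move=> x; have [W0 WD WZ W1] := svalP W; apply: contrapT => nex.
pose V y := exists c, sval W (y - f c * x).
have hV : is_subsp V.
  split.
  - by exists 0; rewrite rmorph0 mul0r subr0.
  - move=> y z [c Wc] [d Wd]; exists (c + d).
    rewrite rmorphD mulrDl opprD addrACA; exact: WD.
  - move=> a y [c Wc]; exists (a * c); rewrite rmorphM -mulrA -mulrBr.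
    exact: WZ.
  - case=> c Wc; have [c0|c0] := eqVneq c 0.
      by move: Wc; rewrite c0 rmorph0 mul0r subr0.
    apply: nex; exists c^-1.
    suff -> : x - f c^-1 = f (- c^-1) * (1 - f c * x) by apply: WZ.
    rewrite mulrBr mulr1 rmorphN mulNr mulrA -rmorphM mulVf // rmorph1 mul1r.
    by rewrite opprK addrC.
have WV : W = exist _ V hV.
  apply/esym/Wmax/asboolP => y Wy /=; exists 0.
  by rewrite rmorph0 mul0r subr0.
apply: nex; exists 0; rewrite rmorph0 subr0 WV /=; exists 1.
by rewrite rmorph1 mul1r subrr.
Qed.

Lemma unit_functional : exists l : S -> k,
  [/\ forall x y, l (x + y) = l x + l y, forall c x, l (f c * x) = c * l x
    & l 1 = 1].
Proof.
have [W [[W0 WD WZ W1] Wex]] := max_subsp.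
have Wuniq x c d : W (x - f c) -> W (x - f d) -> c = d.
  move=> Wc Wd; apply/eqP; rewrite -subr_eq0; apply/eqP.
  apply: contrapT => /eqP nz; apply: W1.
  have -> : 1 = f (c - d)^-1 * ((x - f d) + f (-1) * (x - f c)).
    rewrite rmorphN rmorph1 mulN1r opprB [x - f d]addrC addrACA addrC.
    have -> : f (c - d)^-1 * (x - x + (- f d + f c)) = f ((c - d)^-1 * (c - d)).
      by rewrite subrr add0r rmorphM rmorphB [- _ + _]addrC.
    by rewrite mulVf // rmorph1.
  by apply: (WZ); apply: WD => //; apply: WZ.
pose l x := projT1 (cid (Wex x)).
have lP x : W (x - f (l x)) := projT2 (cid (Wex x)).
exists l; split=> [x y|c x|].
- apply: (Wuniq (x + y)) => //; rewrite rmorphD opprD addrACA; exact: WD.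
- apply: (Wuniq (f c * x)) => //; rewrite rmorphM -mulrBr; exact: WZ.
- by apply: (Wuniq 1) => //; rewrite rmorph1 subrr.
Qed.

End UnitFunctional.

Section AdditiveOnRing.
Variables (C : comNzRingType) (V : zmodType) (L : {additive C -> V}).

Lemma ideal_of_additive : is_ideal (fun x => forall y, L (y * x) = 0).
Proof.
split=> [y|x z hx hz y|a x hx y]; first by rewrite mulr0 raddf0.
  by rewrite mulrDr raddfD /= hx hz addr0.
by rewrite mulrA.
Qed.

Lemma additive_mulB0 a x y : L (a * x) = L (a * y) -> L (a * (x - y)) = 0.
Proof. by move=> e; rewrite mulrBr raddfB /= e subrr. Qed.

Lemma additive_mulD0 a x y z :
  L (a * x) = L (a * y) + L (a * z) -> L (a * (x - (y + z))) = 0.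
Proof. by move=> e; apply: additive_mulB0; rewrite mulrDr raddfD. Qed.

End AdditiveOnRing.

Section Kernel.
Variables (C U : comNzRingType) (F : {rmorphism C -> U}).

Lemma ker_is_ideal : is_ideal (fun x => F x = 0).
Proof.
split=> [|y z hy hz|a y hy]; first by rewrite rmorph0.
  by rewrite rmorphD hy hz addr0.
by rewrite rmorphM hy mulr0.
Qed.

Lemma rmorph_eq_of_sub x y : F (x - y) = 0 -> F x = F y.
Proof. by rewrite rmorphB => /eqP; rewrite subr_eq0 => /eqP. Qed.

Lemma ker_sub x y : F x = F y -> F (x - y) = 0.
Proof. by rewrite rmorphB => ->; rewrite subrr. Qed.

Lemma ker_subD x y z : F x = F y + F z -> F (x - (y + z)) = 0.
Proof. by move=> e; apply: ker_sub; rewrite rmorphD. Qed.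

Lemma ker_subM x y z : F x = F y * F z -> F (x - y * z) = 0.
Proof. by move=> e; apply: ker_sub; rewrite rmorphM. Qed.

End Kernel.

(* S (x)_k K for k-algebras f : k -> S and g : k -> K, presented as a
   K-algebra: generators X_s (s in S), and the relations making s |-> X_s a
   homomorphism of k-algebras (the relation X_1 = 1 is [TensRelC 1]). *)
Section TensorProduct.
Variables (k : fieldType) (S K : comNzRingType).
Variables (f : {rmorphism k -> S}) (g : {rmorphism k -> K}).

Inductive tens_rel : {malg K[{cmonom S}]} -> Prop :=
| TensRelD (r s : S) : tens_rel (mvar K (r + s) - (mvar K r + mvar K s))
| TensRelM (r s : S) : tens_rel (mvar K (r * s) - mvar K r * mvar K s)
| TensRelC (c : k) : tens_rel (mvar K (f c) - malgC (g c)).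

Definition tens_ideal : {pred {malg K[{cmonom S}]}} :=
  fun x => `[< ideal_gen tens_rel x >].

Lemma tens_ideal_closed : idealr_closed tens_ideal.
Proof.
have [l [lD lZ l1]] := unit_functional f.
pose ev := @cmonom_eval S S id.
pose L : {additive {malg K[{cmonom S}]} -> K} :=
  @mmap {cmonom S} K K idfun (fun m => g (l (ev m))).
have LU c m : L (mkmalgU m c) = c * g (l (ev m)) by exact: mmapU.
have evM m n : ev (mmul m n) = ev m * ev n by exact: mmorphM.
have evU s : ev (ucm s) = s by exact: cmonom_evalU.
have ev1 : ev mone = 1 by exact: mmorph1.
have L1 : L 1 = 1 by rewrite LU ev1 l1 rmorph1 mulr1.
have LX c m s : L (mkmalgU m c * mvar K s) = c * g (l (ev m * s)).
  have -> : mkmalgU m c * mvar K s = mkmalgU (mmul m (ucm s)) (c * 1).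
    exact: fgmulUU.
  by rewrite LU evM evU mulr1.
have LXX c m s t :
    L (mkmalgU m c * (mvar K s * mvar K t)) = c * g (l (ev m * (s * t))).
  have -> : mkmalgU m c * (mvar K s * mvar K t) =
      mkmalgU (mmul m (mmul (ucm s) (ucm t))) (c * (1 * 1)).
    by rewrite -fgmulUU -fgmulUU.
  by rewrite LU !evM !evU !mulr1.
have LC c m d : L (mkmalgU m c * malgC d) = c * d * g (l (ev m)).
  have -> : mkmalgU m c * malgC d = mkmalgU (mmul m mone) (c * d).
    exact: fgmulUU.
  by rewrite LU evM ev1 mulr1.
clearbody L ev.
have red (x : {malg K[{cmonom S}]}) :
    (forall c m, L (mkmalgU m c * x) = 0) -> forall y, L (y * x) = 0.
  by move=> hx y; rewrite (monalgE y) mulr_suml raddf_sum big1.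
apply: ideal_gen_closed => hgen.
have h := hgen _ (ideal_of_additive L).
suff /(_ 1) : forall y, L (y * 1) = 0.
  by rewrite mulr1 L1 => /eqP; rewrite oner_eq0.
apply: h => _ [r s|r s|d]; apply: red => c m.
- apply: additive_mulD0.
  apply: etrans (LX c m (r + s)) (etrans _ (esym (congr2 +%R (LX c m r) (LX c m s)))).
  by rewrite mulrDr lD rmorphD mulrDr.
- by apply: additive_mulB0; apply: etrans (LX c m (r * s)) (esym (LXX c m r s)).
- apply: additive_mulB0; apply: etrans (LX c m (f d)) (etrans _ (esym (LC c m (g d)))).
  by rewrite [ev m * f d]mulrC lZ rmorphM mulrA.
Qed.

HB.instance Definition _ :=
  isIdealr.Build {malg K[{cmonom S}]} tens_ideal tens_ideal_closed.

Definition tens := {ideal_quot tens_ideal}.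

HB.instance Definition _ := GRing.ComNzRing.on tens.

(* s (x) 1 and 1 (x) c *)
Definition tensL (s : S) : tens := \pi_tens (mvar K s).
Definition tensR (c : K) : tens := \pi_tens (malgC c).

Let piD x y : \pi_tens (x + y) = \pi_tens x + \pi_tens y.
Proof. by rewrite !piE. Qed.
Let piM x y : \pi_tens (x * y) = \pi_tens x * \pi_tens y.
Proof. by rewrite !piE. Qed.
Let piR x y : tens_rel (x - y) -> \pi_tens x = \pi_tens y.
Proof.
by move=> h; apply/eqP; rewrite -Quotient.idealrBE; apply/asboolP; exact: ideal_gen_sub.
Qed.

Lemma tensRD : {morph tensR : x y / x + y}.
Proof.
by move=> x y; rewrite /tensR -piD; congr (\pi_tens _); exact: raddfD.
Qed.
Lemma tensRM : {morph tensR : x y / x * y}.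
Proof.
by move=> x y; rewrite /tensR -piM; congr (\pi_tens _); exact: mpolyCM.
Qed.
Lemma tensR1 : tensR 1 = 1.
Proof. by rewrite /tensR mpolyC1E; rewrite !piE. Qed.
Lemma tensLR c : tensL (f c) = tensR (g c).
Proof. by apply: piR; exact: TensRelC. Qed.
Lemma tensLD : {morph tensL : x y / x + y}.
Proof. by move=> x y; rewrite /tensL -piD; apply: piR; exact: TensRelD. Qed.
Lemma tensLM : {morph tensL : x y / x * y}.
Proof. by move=> x y; rewrite /tensL -piM; apply: piR; exact: TensRelM. Qed.
Lemma tensL1 : tensL 1 = 1.
Proof. by rewrite -(rmorph1 f) tensLR rmorph1 tensR1. Qed.

Let addP (U V : zmodType) (h : U -> V) :
  {morph h : x y / x + y} -> zmod_morphism h.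
Proof.
move=> hD x y; apply: (addIr (h y)).
by rewrite -hD !subrK.
Qed.

HB.instance Definition _ :=
  GRing.isZmodMorphism.Build S tens tensL (addP tensLD).
HB.instance Definition _ :=
  GRing.isMonoidMorphism.Build S tens tensL (tensL1, tensLM).
HB.instance Definition _ :=
  GRing.isZmodMorphism.Build K tens tensR (addP tensRD).
HB.instance Definition _ :=
  GRing.isMonoidMorphism.Build K tens tensR (tensR1, tensRM).

Section Lift.
Variables (U : comNzRingType).
Variables (u : {rmorphism S -> U}) (v : {rmorphism K -> U}).
Hypothesis uv : forall c, u (f c) = v (g c).

Definition tens_lift (x : tens) : U := mmap v (cmonom_eval u) (repr x).

Lemma tens_lift_pi x : tens_lift (\pi_tens x) = mmap v (cmonom_eval u) x.
Proof.
pose F : {rmorphism {malg K[{cmonom S}]} -> U} := mmap v (cmonom_eval u).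
have FX s : F (mvar K s) = u s by exact: mmap_mvar.
have FC c : F (malgC c) = v c by exact: mmapC.
suff h y : tens_ideal y -> F y = 0.
  apply: (rmorph_eq_of_sub (F := F)); apply: h.
  by rewrite -[tens_ideal _]/(_ \in tens_ideal) Quotient.idealrBE reprK.
clearbody F; move=> /asboolP h; apply: (h _ (ker_is_ideal F)) => _ [r s|r s|c].
- apply: ker_subD.
  by apply: etrans (FX _) (etrans _ (esym (congr2 +%R (FX r) (FX s)))); exact: rmorphD.
- apply: ker_subM.
  by apply: etrans (FX _) (etrans _ (esym (congr2 *%R (FX r) (FX s)))); exact: rmorphM.
- apply: ker_sub.
  by apply: etrans (FX _) (etrans (uv c) (esym (FC (g c)))).
Qed.

Lemma tens_liftL s : tens_lift (tensL s) = u s.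
Proof. by rewrite tens_lift_pi mmap_mvar. Qed.
Lemma tens_liftR c : tens_lift (tensR c) = v c.
Proof. by rewrite tens_lift_pi mmapC. Qed.

Lemma tens_lift_zmod : zmod_morphism tens_lift.
Proof.
move=> x y; rewrite -[x]reprK -[y]reprK.
have -> : \pi_tens (repr x) - \pi_tens (repr y) = \pi_tens (repr x - repr y).
  by rewrite !piE.
by rewrite !tens_lift_pi raddfB.
Qed.

Lemma tens_lift_monoid : monoid_morphism tens_lift.
Proof.
split=> [|x y]; first by rewrite -tensR1 tens_liftR rmorph1.
by rewrite -[x]reprK -[y]reprK -piM !tens_lift_pi rmorphM.
Qed.

End Lift.
End TensorProduct.

(* h (x) K : R (x)_k K -> S (x)_k K, where S is a k-algebra through h. *)
Section TensorMap.
Variables (k : fieldType) (R S K : comNzRingType).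
Variables (f : {rmorphism k -> R}) (g : {rmorphism k -> K}).
Variable (h : {rmorphism R -> S}).

Definition tens_map : tens f g -> tens (h \o f) g :=
  tens_lift (tensL (h \o f) g \o h) (tensR (h \o f) g).

Let compat c : (tensL (h \o f) g \o h) (f c) = tensR (h \o f) g (g c).
Proof. exact: tensLR. Qed.

Lemma tens_mapL r : tens_map (tensL f g r) = tensL (h \o f) g (h r).
Proof. exact: tens_liftL compat r. Qed.

Lemma tens_mapR c : tens_map (tensR f g c) = tensR (h \o f) g c.
Proof. exact: tens_liftR compat c. Qed.

Lemma tens_map_zmod : zmod_morphism tens_map.
Proof. exact: tens_lift_zmod compat. Qed.

Lemma tens_map_monoid : monoid_morphism tens_map.
Proof. exact: tens_lift_monoid compat. Qed.

End TensorMap.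

(* Imported only here, as it shadows many names of monalg. *)
From mathcomp Require Import mpoly.

Definition is_alg_closure (k K : fieldType) (j : {rmorphism k -> K}) : Prop :=
  GRing.closed_field_axiom K /\ forall x : K, algebraicOver j x.

(* R is a k-algebra through iota, and B through R. The (R (x)_k kbar)-algebra
   structure of B (x)_k kbar is [tens_map (in_alg B)], and phi is required to
   be compatible with it. *)
Definition An_form (k kbar : fieldType) (j : {rmorphism k -> kbar})
    (R : comNzRingType) (iota : {rmorphism k -> R}) (n : nat)
    (B : comAlgType R) : Prop :=
  exists phi : {rmorphism mpoly.mpoly n (tens iota j) ->
                          tens (in_alg B \o iota) j},
    bijective phi /\ forall a, phi (mpoly.mpolyC n a) = tens_map (in_alg B) a.

Record derivation (R : comNzRingType) (B : comAlgType R) := Derivation {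
  der :> {linear B -> B};
  derM : forall a b, der (a * b) = der a * b + a * der b
}.

Section Derivation.
Variables (R : comNzRingType) (B : comAlgType R) (D : derivation B).

Definition locally_nilpotent : Prop :=
  forall b : B, exists n : nat, iter n D b = 0.

Definition der_ideal : B -> Prop := ideal_gen (fun b => exists a, b = D a).

Definition in_ker : {pred B} := fun b => D b == 0.

Lemma der1 : D 1 = 0.
Proof.
have h := derM D 1 1; rewrite mulr1 mulr1 mul1r in h.
by apply: (addrI (D 1)); rewrite addr0 -h.
Qed.

Lemma in_ker_closed : GRing.subsemialg_closed in_ker.
Proof.
split; [|split=> [|x y]|move=> a x|move=> x y]; rewrite !unfold_in /in_ker.
- by rewrite der1.
- by rewrite linear0.
- by move=> /eqP hx /eqP hy; rewrite linearD hx hy addr0.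
- by move=> /eqP hx; rewrite linearZ /= hx scaler0.
- by move=> /eqP hx /eqP hy; rewrite derM hx hy mul0r mulr0 addr0.
Qed.

Record ker_der := KerDer { ker_val :> B; _ : in_ker ker_val }.

HB.instance Definition _ := [isSub for ker_val].
HB.instance Definition _ := [Choice of ker_der by <:].
HB.instance Definition _ :=
  GRing.SubChoice_isSubAlgebra.Build R B in_ker ker_der in_ker_closed.
Lemma ker_der_mulC : commutative (@GRing.mul ker_der).
Proof. by move=> x y; apply: val_inj; rewrite !rmorphM /= mulrC. Qed.
HB.instance Definition _ := GRing.PzRing_hasCommutativeMul.Build ker_der ker_der_mulC.
End Derivation.

Section Localization.
Variables (R : comNzRingType) (p : prime_idealr R).

Record denom := Denom { dval : R; dvalP : dval \notin p }.

HB.instance Definition _ := [isSub for dval].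
HB.instance Definition _ := [Choice of denom by <:].

Lemma denom1_subproof : 1 \notin p.
Proof. by rewrite idealr1. Qed.
Definition denom1 : denom := Denom denom1_subproof.

Lemma denomM_subproof (s t : denom) : dval s * dval t \notin p.
Proof. by rewrite prime_idealrM negb_or (dvalP s) (dvalP t). Qed.
Definition denomM (s t : denom) : denom := Denom (denomM_subproof s t).

Section Module.
Variable M : lmodType R.

Definition loc_rel (x y : M * denom) : bool :=
  `[< exists u : denom,
        dval u *: (dval y.2 *: x.1) = dval u *: (dval x.2 *: y.1) >].

Lemma loc_rel_equiv : equiv_class_of loc_rel.
Proof.
split=> [x|x y|y x z].
- by apply/asboolP; exists denom1.
- by apply/asboolP/asboolP => -[u hu]; exists u.
- move=> /asboolP[u hu] /asboolP[v hv]; apply/asboolP.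
  exists (denomM (denomM u v) y.2) => /=; rewrite !scalerA in hu hv *.
  have -> : dval u * dval v * dval y.2 * dval z.2
    = (dval v * dval z.2) * (dval u * dval y.2) by ring.
  rewrite -scalerA hu scalerA.
  have -> : dval v * dval z.2 * (dval u * dval x.2)
    = (dval u * dval x.2) * (dval v * dval z.2) by ring.
  rewrite -scalerA hv scalerA; congr (_ *: _). ring.
Qed.

Canonical loc_rel_equivrel := EquivRelPack loc_rel_equiv.

Definition loc := {eq_quot loc_rel}.

HB.instance Definition _ := Choice.on loc.
HB.instance Definition _ : EqQuotient (M * denom)%type loc_rel loc :=
  EqQuotient.on loc.

Definition frac (m : M) (s : denom) : loc := \pi_loc (m, s).

Lemma fracP m s n t : frac m s = frac n t <->
  exists u : denom, dval u *: (dval t *: m) = dval u *: (dval s *: n).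
Proof.
split=> [/eqP|h]; last by apply/eqP; rewrite eqmodE; apply/asboolP.
by rewrite eqmodE => /asboolP.
Qed.

Lemma frac_ind (P : loc -> Prop) : (forall m s, P (frac m s)) -> forall x, P x.
Proof.
by move=> h x; rewrite -[x]reprK; case: (repr x) => m s; apply: h.
Qed.

Definition num (x : loc) : M := (repr x).1.
Definition den (x : loc) : denom := (repr x).2.

Lemma frac_num_den x : frac (num x) (den x) = x.
Proof. by rewrite /frac -surjective_pairing reprK. Qed.

Lemma num_denP m s : exists u : denom,
  dval u *: (dval s *: num (frac m s)) = dval u *: (dval (den (frac m s)) *: m).
Proof. by apply/fracP; rewrite frac_num_den. Qed.

Definition loc0 : loc := frac 0 denom1.
Definition loc_opp (x : loc) : loc := frac (- num x) (den x).
Definition loc_add (x y : loc) : loc :=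
  frac (dval (den y) *: num x + dval (den x) *: num y) (denomM (den x) (den y)).

Lemma loc_oppE m s : loc_opp (frac m s) = frac (- m) s.
Proof.
have [u hu] := num_denP m s; apply/fracP; exists u.
by rewrite !scalerN hu.
Qed.

Lemma loc_addE m s n t :
  loc_add (frac m s) (frac n t) = frac (dval t *: m + dval s *: n) (denomM s t).
Proof.
have [u hu] := num_denP m s; have [v hv] := num_denP n t.
apply/fracP; exists (denomM u v); rewrite /= !scalerDr.
set m' := num _ in hu *; set s' := den _ in hu *.
set n' := num _ in hv *; set t' := den _ in hv *.
rewrite !scalerA in hu hv *; congr (_ + _).
  have -> : dval u * dval v * (dval s * dval t) * dval t'
    = (dval v * dval t * dval t') * (dval u * dval s) by ring.
  by rewrite -scalerA hu scalerA; congr (_ *: _); ring.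
have -> : dval u * dval v * (dval s * dval t) * dval s'
  = (dval u * dval s * dval s') * (dval v * dval t) by ring.
by rewrite -scalerA hv scalerA; congr (_ *: _); ring.
Qed.

Lemma loc_addA : associative loc_add.
Proof.
elim/frac_ind => m s; elim/frac_ind => n t; elim/frac_ind => l r.
rewrite !loc_addE; apply/fracP; exists denom1 => /=.
by rewrite !scalerDr !scalerA addrA; congr (_ *: _ + _ *: _ + _ *: _); ring.
Qed.

Lemma loc_addC : commutative loc_add.
Proof.
elim/frac_ind => m s; elim/frac_ind => n t.
rewrite !loc_addE; apply/fracP; exists denom1 => /=.
by rewrite addrC mulrC.
Qed.

Lemma loc_add0 : left_id loc0 loc_add.
Proof.
elim/frac_ind => m s; rewrite loc_addE; apply/fracP; exists denom1 => /=.
by rewrite scaler0 add0r mul1r !scale1r.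
Qed.

Lemma loc_addN : left_inverse loc0 loc_opp loc_add.
Proof.
elim/frac_ind => m s; rewrite loc_oppE loc_addE.
apply/fracP; exists denom1 => /=.
by rewrite scalerN addNr !scaler0.
Qed.

HB.instance Definition _ :=
  GRing.isZmodule.Build loc loc_addA loc_addC loc_add0 loc_addN.

Lemma fracD m s n t :
  frac m s + frac n t = frac (dval t *: m + dval s *: n) (denomM s t).
Proof. exact: loc_addE. Qed.

Lemma fracDs m n s : frac m s + frac n s = frac (m + n) s.
Proof.
rewrite fracD; apply/fracP; exists denom1 => /=.
by rewrite -scalerDr !scalerA mulrA.
Qed.

End Module.

Definition loc_map (M N : lmodType R) (f : {linear M -> N}) (x : loc M) :
  loc N := frac (f (num x)) (den x).

Lemma loc_mapE (M N : lmodType R) (f : {linear M -> N}) m s :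
  loc_map f (frac m s) = frac (f m) s.
Proof.
have [u hu] := num_denP m s; apply/fracP; exists u.
by have := congr1 f hu; rewrite !(@linearZZ R M N f).
Qed.

Section Algebra.
Variable B : comAlgType R.

Definition loc_one : loc B := frac 1 denom1.
Definition loc_mul (x y : loc B) : loc B :=
  frac (num x * num y) (denomM (den x) (den y)).

Lemma loc_mulE (a b : B) s t :
  loc_mul (frac a s) (frac b t) = frac (a * b) (denomM s t).
Proof.
have [u hu] := num_denP a s; have [v hv] := num_denP b t.
apply/fracP; exists (denomM u v) => /=.
set a' := num _ in hu *; set s' := den _ in hu *.
set b' := num _ in hv *; set t' := den _ in hv *.
have E (c d e f : R) (x y : B) :
    (c * d) *: ((e * f) *: (x * y)) = (c *: (e *: x)) * (d *: (f *: y)).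
  by rewrite -!scalerAl -!scalerAr !scalerA; congr (_ *: _); ring.
by rewrite !E hu hv.
Qed.

Lemma loc_mulA : associative loc_mul.
Proof.
elim/frac_ind => a s; elim/frac_ind => b t; elim/frac_ind => c r.
rewrite !loc_mulE; apply/fracP; exists denom1 => /=.
by rewrite !mulrA.
Qed.

Lemma loc_mulC : commutative loc_mul.
Proof.
elim/frac_ind => a s; elim/frac_ind => b t.
rewrite !loc_mulE; apply/fracP; exists denom1 => /=.
by rewrite [a * b]mulrC [dval s * _]mulrC.
Qed.

Lemma loc_mul1 : left_id loc_one loc_mul.
Proof.
elim/frac_ind => a s; rewrite loc_mulE; apply/fracP; exists denom1 => /=.
by rewrite !mul1r.
Qed.

Lemma loc_mulDl : left_distributive loc_mul +%R.
Proof.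
elim/frac_ind => a s; elim/frac_ind => b t; elim/frac_ind => c r.
rewrite (fracD a s b t) !loc_mulE fracD; apply/fracP; exists denom1 => /=.
rewrite mulrDl -!scalerAl !scalerDr !scalerA.
by congr (_ *: _ + _ *: _); ring.
Qed.

HB.instance Definition _ := GRing.Zmodule_isComPzRing.Build (loc B)
  loc_mulA loc_mulC loc_mul1 loc_mulDl.

Lemma fracM (a b : B) s t : frac a s * frac b t = frac (a * b) (denomM s t).
Proof. exact: loc_mulE. Qed.

End Algebra.

(* R itself is the R-module R^o, so that R_p is an instance of [loc] and is
   also, by the module structure below, an R_p-module. *)
Definition loc_ring := loc R^o.
HB.instance Definition _ := GRing.ComPzRing.on loc_ring.

Lemma loc_ringD (a b : R) s t :
  frac (a : R^o) s + frac (b : R^o) t =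
  frac (dval t * a + dval s * b : R^o) (denomM s t) :> loc_ring.
Proof. exact: fracD. Qed.

Lemma loc_ringM (a b : R) s t :
  (frac (a : R^o) s : loc_ring) * frac (b : R^o) t =
  frac ((a * b : R) : R^o) (denomM s t).
Proof. exact: fracM. Qed.

Section LocModule.
Variable M : lmodType R.

Definition loc_scale (a : loc_ring) (x : loc M) : loc M :=
  frac ((num a : R) *: num x) (denomM (den a) (den x)).

Lemma loc_scaleE (a : R) s (m : M) t :
  loc_scale (frac (a : R^o) s) (frac m t) = frac (a *: m) (denomM s t).
Proof.
have [u hu] := num_denP (a : R^o) s; have [v hv] := num_denP m t.
apply/fracP; exists (denomM u v) => /=.
set a' := num _ in hu *; set s' := den _ in hu *.
set m' := num _ in hv *; set t' := den _ in hv *.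
have E (c d e f x : R) (y : M) :
    (c * d) *: ((e * f) *: (x *: y)) = (c * (e * x)) *: (d *: (f *: y)).
  by rewrite !scalerA; congr (_ *: _); ring.
have hu' : dval u * (dval s * a') = dval u * (dval s' * a) := hu.
by rewrite !E hv hu'.
Qed.

Lemma loc_scaleA a b x : loc_scale a (loc_scale b x) = loc_scale (a * b) x.
Proof.
elim/frac_ind: a => a s; elim/frac_ind: b => b t; elim/frac_ind: x => m r.
rewrite loc_ringM (loc_scaleE b t m r) (loc_scaleE a s) (loc_scaleE (a * b)); apply/fracP; exists denom1 => /=.
rewrite !scalerA; congr (_ *: _); ring.
Qed.

Lemma loc_scale1 : left_id 1 loc_scale.
Proof.
elim/frac_ind => m s; rewrite loc_scaleE; apply/fracP; exists denom1 => /=.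
by rewrite !scale1r mul1r.
Qed.

Lemma loc_scaleDr : right_distributive loc_scale +%R.
Proof.
elim/frac_ind => a s; elim/frac_ind => m t; elim/frac_ind => n r.
rewrite (fracD m t n r) !loc_scaleE fracD; apply/fracP; exists denom1 => /=.
rewrite !scalerDr !scalerA.
by congr (_ *: _ + _ *: _); ring.
Qed.

Lemma loc_scaleDl x : {morph loc_scale^~ x : a b / a + b}.
Proof.
elim/frac_ind: x => m r; elim/frac_ind => a s; elim/frac_ind => b t.
rewrite loc_ringD !loc_scaleE fracD; apply/fracP; exists denom1 => /=.
rewrite !scalerDl !scalerDr !scalerA.
by congr (_ *: _ + _ *: _); ring.
Qed.

Lemma loc_scale0 x : loc_scale 0 x = 0.
Proof. by apply: (addrI (loc_scale 0 x)); rewrite -loc_scaleDl !addr0. Qed.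

HB.instance Definition _ := GRing.Nmodule_isLSemiModule.Build loc_ring (loc M)
  loc_scaleA loc_scale0 loc_scale1 loc_scaleDr loc_scaleDl.

End LocModule.

End Localization.

Section LocDerivation.
Variables (R : comNzRingType) (B : comAlgType R) (D : derivation B).
Variable (p : prime_idealr R).

Definition loc_der : loc p B -> loc p B := loc_map (der D).

Lemma loc_derE b s : loc_der (frac b s) = frac (D b) s.
Proof. exact: loc_mapE. Qed.

Lemma loc_derM x y : loc_der (x * y) = loc_der x * y + x * loc_der y.
Proof.
elim/frac_ind: x => a s; elim/frac_ind: y => b t.
rewrite (fracM a b) (loc_derE (a * b)) (loc_derE a s) (loc_derE b t).
rewrite (fracM (D a) b) (fracM a (D b)) fracDs.
by congr frac; apply: derM.
Qed.

End LocDerivation.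
Arguments loc_der {R B} D p x.

Definition projective (R : comNzRingType) (N : lmodType R) : Prop :=
  forall (L M : lmodType R) (g : {linear L -> M}) (f : {linear N -> M}),
    (forall y, exists x, g x = y) ->
    exists h : {linear N -> L}, forall x, g (h x) = f x.

(* The morphisms are linear over R_p ([loc_ring p]). *)
Definition rank_one (R : comNzRingType) (N : lmodType R) : Prop :=
  forall p : prime_idealr R,
  exists h : {linear loc p N -> loc p R^o}, bijective h.

(* Main.v *)
(** Let S = R (x) kbar. After base change, B becomes P = S[X, Y], where S is reduced because
    char k = 0, and D becomes a locally nilpotent S-derivation of P; its divergence vanishes, so
    it is Jac(F, -) for some F, and D(B)P is generated by F_X and F_Y. Comparing the two copies
    of S in R (x) kbar (x) kbar shows that F descends up to affine changes:
    F = sum f_i (x) e_i with f_i in Ker D, f_i = u_i F + v_i, and sum u_i e_i = 1.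

    (I) => (II): if (F_X, F_Y) contains a regular sequence of length 2, every g with
    Jac(F, g) = 0 satisfies dg = h dF, whence the kernel on P is S[F] by induction. After a
    translation v_i = 0; then N = B n SF is invertible with dual basis f_i, and Ker D = Sym N.

    (II) => (I): near a prime p, irreducibility forces dF to be a unit multiple of da over S,
    where a generates Ker D. Generically, a common divisor of a_X and a_Y is killed by the
    derivation, hence is a polynomial in a, hence a constant by degrees. So
    D(B)c <= xB gives x | rc with r <> 0 in R; McCoy's theorem and the local form of F at a
    prime containing a maximal colon ideal remove r. By prime avoidance any x = Db <> 0 extends
    to a regular sequence x, y in D(B)B, which is maximal because an ideal with two generators
    that contains a regular sequence of length 3 is the unit ideal. *)
From HB Require Import structures.
From mathcomp Require Import all_boot all_order all_algebra ring_quotient.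
From mathcomp Require Import generic_quotient fraction separable boolp.
From mathcomp Require classical_sets.
From mathcomp Require Import finmap monalg.
From mathcomp Require Import ring.
Require Import Defs.
Import GRing.Theory.
Set Implicit Arguments.
Unset Strict Implicit.
Unset Printing Implicit Defensive.
Local Open Scope ring_scope.
Local Open Scope quotient_scope.

(** The obstacle is that S is in general neither a domain nor Noetherian: for k = Q and R = kbar it
    is kbar (x) kbar. So degrees, units and gcds are computed over fields obtained by localizing the
    reduced ring S at minimal primes; an equation that holds in such a field holds in S after
    multiplication by an element outside the prime. Where contents would be used over a domain,
    McCoy's theorem stands in. Chain conditions and avoidance arguments are confined to R and B. The
    passage between B and P needs neither a basis of kbar nor a Galois group: a k-linear map kbar ->
    k with 1 |-> 1 gives a B-linear retraction of B -> P, and its twists by elements of kbar give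
    enough coordinates to test ideal membership, so regular sequences go up and ideals come down. F
    descends up to affine changes because D determines F up to a constant, and because an
    automorphism of T[X, Y], over the second base change T, multiplies Jacobian brackets by a unit
    of T[X, Y], which is a constant since T is reduced. *)

Definition reduced_ring (S : comNzRingType) := forall x : S, x * x = 0 -> x = 0.

(** * Minimal primes and McCoy's theorem *)

Section PrimeQuotient.
Variables (S : comNzRingType) (I : prime_idealr S).

Definition prime_quot := {ideal_quot I}.
HB.instance Definition _ := GRing.ComNzRing.on prime_quot.

Definition pq_unit : {pred prime_quot} := fun x => `[< exists y, y * x = 1 >].
(** An integral domain structure comes with a total inverse; it is chosen classically on units and
    is the identity elsewhere. *)
Definition pq_inv (x : prime_quot) : prime_quot :=
  if pselect (exists y, y * x = 1) is left h then projT1 (cid h) else x.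

Lemma pq_mulVx : {in pq_unit, left_inverse 1 pq_inv *%R}.
Proof.
move=> x /asboolP h; rewrite /pq_inv; case: pselect => // h'.
exact: projT2 (cid h').
Qed.
Lemma pq_unitP x y : y * x = 1 -> pq_unit x.
Proof. by move=> e; apply/asboolP; exists y. Qed.
Lemma pq_inv_out : {in [predC pq_unit], pq_inv =1 id}.
Proof.
by move=> x /negP h; rewrite /pq_inv; case: pselect => // h'; case: h; apply/asboolP.
Qed.
HB.instance Definition _ :=
  GRing.ComNzRing_hasMulInverse.Build prime_quot pq_mulVx pq_unitP pq_inv_out.
Lemma pq_integral (x y : prime_quot) : x * y = 0 -> (x == 0) || (y == 0).
Proof. exact: Quotient.rquot_IdomainAxiom. Qed.
HB.instance Definition _ := GRing.ComUnitRing_isIntegral.Build prime_quot pq_integral.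

Definition pq_proj (x : S) : prime_quot := \pi_prime_quot x.
Lemma pq_proj_zmod : zmod_morphism pq_proj.
Proof. by move=> x y; rewrite /pq_proj !piE. Qed.
Lemma pq_proj_monoid : monoid_morphism pq_proj.
Proof. by split=> [|x y]; rewrite /pq_proj !piE. Qed.
HB.instance Definition _ := GRing.isZmodMorphism.Build S prime_quot pq_proj pq_proj_zmod.
HB.instance Definition _ := GRing.isMonoidMorphism.Build S prime_quot pq_proj pq_proj_monoid.

Lemma pq_proj_eq0 x : (pq_proj x == 0) = (x \in I).
Proof.
rewrite -[0](rmorph0 pq_proj) /pq_proj.
by have := Quotient.idealrBE I x 0; rewrite subr0 => ->.
Qed.
Lemma pq_proj_surj y : exists x, y = pq_proj x.
Proof. by exists (repr y); rewrite /pq_proj reprK. Qed.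
End PrimeQuotient.

Lemma fraction_numden (R : idomainType) (w : {fraction R}) :
  exists n d : R, d != 0 /\ w * FracField.tofrac d = FracField.tofrac n.
Proof.
exists \n_(repr w), \d_(repr w); split; first exact: denom_ratioP.
unlock FracField.tofrac; rewrite -{1}[w]reprK -[LHS]FracField.pi_mul.
apply/eqmodP; rewrite /= FracField.equivfE /FracField.mulf.
by rewrite !numden_Ratio ?oner_neq0 ?mulf_neq0 ?denom_ratioP ?oner_eq0 // ?mulr1 ?mul1r mulrC.
Qed.

Section MinimalPrime.
Variables (S : comNzRingType) (U0 : S -> Prop).
Hypothesis redS : reduced_ring S.
Hypothesis U01 : U0 1.
Hypothesis U0M : forall x y, U0 x -> U0 y -> U0 (x * y).
Hypothesis U00 : ~ U0 0.

Lemma reduced_expr (x : S) n : x ^+ n = 0 -> x = 0.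
Proof.
(* Reducedness only removes squares, so the exponent is first raised to a power of two. *)
move=> h; have : x ^+ (2 ^ n) = 0 by rewrite -(subnKC (ltnW (ltn_expl n (isT : 1 < 2)%N))) exprD h mul0r.
elim: {h}n => [|n IH]; first by rewrite expr1.
by rewrite expnS mul2n -addnn exprD => /redS.
Qed.

(* A maximal multiplicative set avoiding 0 is the complement of a minimal prime. *)
Lemma minimal_prime_field : exists (Om : fieldType) (g : {rmorphism S -> Om}),
  [/\ forall u, U0 u -> g u != 0,
      forall t, g t = 0 -> exists e, g e != 0 /\ e * t = 0
    & forall w, exists u s, g u != 0 /\ w * g u = g s].
Proof.
(* Zorn ranges over arbitrary sets [U]. The multiplicative set generated by [U0] and [U] is written
   with finite products, so that 0 in the union of a chain is already reached in one member. *)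
pose M (U : S -> Prop) x := exists u0 l, [/\ U0 u0, forall y, y \in l -> U y
  & x = u0 * \prod_(y <- l) y].
pose P (U : S -> Prop) := ~ M U 0.
have [F subF totF|U [PU maxU]] := @classical_sets.Zorn_bigcup S P.
  case=> u0 [l [hu0 hl e]].
  have : l = [::] \/ exists2 V, F V & forall y, y \in l -> V y.
    elim: l hl {e} => [|a l IH] hl; first by left.
    right; have [V FV Va] : exists2 V, F V & V a.
      by have [|V FV Va] := hl a; [rewrite inE eqxx | exists V].
    have [y yl|->|[W FW Wl]] := IH; first by apply: hl; rewrite inE yl orbT.
      by exists V => // y; rewrite inE => /eqP ->.
    have [VW|WV] := totF _ _ FV FW.
      by exists W => // y; rewrite inE => /orP[/eqP ->|/Wl //]; apply: VW.
    by exists V => // y; rewrite inE => /orP[/eqP -> //|/Wl]; apply: WV.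
  case=> [l0|[V FV Vl]]; first by apply: U00; move: e; rewrite l0 big_nil mulr1 => ->.
  by apply: (subF _ FV); exists u0, l.
have M1 : M U 1 by exists 1, [::]; split=> //; rewrite big_nil mulr1.
have MM x y : M U x -> M U y -> M U (x * y).
  move=> [u [l [hu hl ->]]] [v [m [hv hm ->]]]; exists (u * v), (l ++ m); split.
  - exact: U0M.
  - by move=> z; rewrite mem_cat => /orP[/hl|/hm].
  - by rewrite big_cat /= mulrACA.
have UM x : U x -> M U x.
  move=> Ux; exists 1, [:: x]; split=> [//|y|]; first by rewrite inE => /eqP ->.
  by rewrite big_seq1 mul1r.
have Mext t v l : M U v -> (forall y, y \in l -> U y \/ y = t) ->
    exists n w, M U w /\ v * \prod_(y <- l) y = w * t ^+ n.
  elim: l v => [|a l IH] v Mv hl.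
    by exists 0%N, v; rewrite big_nil expr0.
  have [||n [w [Mw e]]] := IH v; [by []| by move=> y yl; apply: hl; rewrite inE yl orbT|].
  have [Ua|->] := hl a (mem_head _ _).
    exists n, (a * w); split; first by apply: MM => //; apply: UM.
    by rewrite big_cons mulrCA e mulrA.
  by exists n.+1, w; split=> //; rewrite big_cons mulrCA e exprS mulrCA.
have ext t : ~ U t -> M (fun y => U y \/ y = t) 0.
  move=> nUt; apply: contrapT => h; apply: (maxU (fun y => U y \/ y = t)) => //.
  by split=> [y Uy|sub]; [left | apply: nUt; apply: sub; right].
have kill t : ~ U t -> exists2 e, M U e & e * t = 0.
  move=> /ext [u0 [l [hu0 hl e]]].
  have [|//|n [w [Mw ew]]] := Mext t u0 l.
    by exists u0, [::]; split=> //; rewrite big_nil mulr1.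
  (* Here [w * t ^+ n = 0], hence [(w * t) ^+ n.+1 = 0]; reducedness trades the power of [t] for [t]
     itself. *)
  exists w => //; apply: (@reduced_expr _ n.+1).
  by rewrite exprMn exprS exprSr mulrACA -ew -e mul0r.
have MU x : M U x -> U x.
  move=> Mx; apply: contrapT => /kill [e Me e0]; apply: PU.
  by rewrite -e0; apply: MM.
pose I : {pred S} := fun x => ~~ `[< U x >].
have inI x : x \in I <-> ~ U x.
  by rewrite /in_mem /=; split=> [/negP h Ux|h]; [apply: h; apply/asboolP|apply/negP => /asboolP].
have UU x y : U x -> U y -> U (x * y) by move=> /UM Mx /UM My; apply: MU; exact: MM.
have Icl : idealr_closed I.
  split.
  - by apply/inI => U_0; apply: PU; apply: UM.
  - by apply/negP => /inI; apply; apply: MU.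
  - move=> a x y /inI /kill[e /MU Ue e0] /inI/kill[f /MU Uf f0]; apply/inI => Uxy.
    have z : e * f * (a * x + y) = (a * f) * (e * x) + e * (f * y) by ring.
    by apply: PU; have := UM _ (UU _ _ (UU _ _ Ue Uf) Uxy); rewrite z e0 f0 !mulr0 addr0.
have Ipr : prime_idealr_closed I.
  move=> x y /inI nU; have [Ux|/inI ->//] := pselect (U x).
  apply/orP; right; apply/inI => Uy; apply: nU; exact: UU.
pose J : prime_idealr S := HB.pack I (isIdealr.Build S I Icl) (isPrimeIdealrClosed.Build S I Ipr).
pose g : {rmorphism S -> {fraction (prime_quot J)}} :=
  (@FracField.tofrac (prime_quot J)) \o (@pq_proj S J).
have g0 x : g x = 0 <-> ~ U x.
  rewrite -inI; split=> [/eqP|h]; first by rewrite /= tofrac_eq0 pq_proj_eq0.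
  by apply/eqP; rewrite /= tofrac_eq0 pq_proj_eq0.
exists {fraction (prime_quot J)}, g; split.
- move=> u hu; apply/eqP => /g0; apply; apply: MU.
  by exists u, [::]; split=> //; rewrite big_nil mulr1.
- move=> t /g0 /kill [e /MU Ue et]; exists e; split=> //.
  by apply/eqP => /g0; apply.
- move=> w; have [n [d [d0 e]]] := fraction_numden w.
  have [u eu] := pq_proj_surj d; have [s es] := pq_proj_surj n.
  exists u, s; split; first by rewrite /= tofrac_eq0 -eu.
  by rewrite /= -eu -es.
Qed.
End MinimalPrime.

Section Coefficientwise.
Variables (T : comNzRingType) (J : T -> Prop).
Hypothesis idJ : is_ideal J.

Definition coefs_in (p : {poly T}) := forall i, J p`_i.

Lemma ideal0 : J 0. Proof. by case: idJ. Qed.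
Lemma idealD x y : J x -> J y -> J (x + y). Proof. by case: idJ => _ + _; apply. Qed.
Lemma idealM a x : J x -> J (a * x). Proof. by case: idJ => _ _; apply. Qed.
Lemma idealMl a x : J x -> J (x * a). Proof. by rewrite mulrC; exact: idealM. Qed.
Lemma idealN x : J x -> J (- x). Proof. by rewrite -mulN1r; exact: idealM. Qed.
Lemma idealB x y : J x -> J y -> J (x - y).
Proof. by move=> hx /idealN; exact: idealD. Qed.
Lemma ideal_sum (I : Type) (r : seq I) (Q : pred I) (F : I -> T) :
  (forall i, Q i -> J (F i)) -> J (\sum_(i <- r | Q i) F i).
Proof. by move=> h; elim/big_ind: _ => //; [exact: ideal0|exact: idealD]. Qed.

Lemma coefs_in_ideal : is_ideal coefs_in.
Proof.
split=> [i|p q hp hq i|a p hp i]; first by rewrite coef0; apply: ideal0.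
  by rewrite coefD; apply: idealD.
by rewrite coefM; apply: ideal_sum => j _; apply: idealM.
Qed.

(** McCoy's theorem over T/J, by induction on the size of [c]. If its leading coefficient lies in
    [J], truncate it. If every [g]_i *: c[vanishes modulo]J[, the leading coefficient is the
    multiplier. Otherwise take the last]i[with]g[_i *: c] nonzero modulo [J]: it has the same
    property as [c], and the product with [g] shows that its leading coefficient is in [J]. *)
Lemma mccoy (G : {poly T} -> Prop) (c : {poly T}) : ~ coefs_in c ->
  (forall g, G g -> coefs_in (c * g)) ->
  exists s, ~ J s /\ forall g, G g -> coefs_in (s%:P * g).
Proof.
have [n] := ubnP (size c); elim: n c => // n IH c ltc nc hc.
have c0 : c != 0 by apply/eqP => e; apply: nc => i; rewrite e coef0; apply: ideal0.
have szc : size c = (size c).-1.+1 by rewrite prednK // size_poly_gt0.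
pose trunc (e : {poly T}) := e - e`_(size c).-1 *: 'X^((size c).-1).
have trunc_size (e : {poly T}) : (size e <= size c)%N -> (size (trunc e) < n)%N.
  move=> le; apply: leq_ltn_trans (_ : (size c).-1 < n)%N; last by rewrite -ltnS -szc.
  apply/leq_sizeP => i; rewrite coefB coefZ coefXn leq_eqVlt => /orP[/eqP<-|lt].
    by rewrite eqxx mulr1 subrr.
  rewrite gtn_eqF // mulr0 subr0; apply/leq_sizeP: i lt.
  by rewrite -szc.
have truncP (e : {poly T}) : J e`_(size c).-1 -> coefs_in (trunc e) -> coefs_in e.
  move=> Je he i; have := idealD (he i) (idealMl ('X^((size c).-1))`_i Je).
  by rewrite coefB coefZ subrK.
have redu (e : {poly T}) : (size e <= size c)%N -> ~ coefs_in e ->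
    J e`_(size c).-1 -> (forall g, G g -> coefs_in (e * g)) ->
    exists s, ~ J s /\ forall g, G g -> coefs_in (s%:P * g).
  move=> sze ne Je he; apply: (IH (trunc e)); first exact: trunc_size.
    by move=> /(truncP _ Je).
  move=> g Gg i; rewrite mulrBl coefB; apply: idealB; first exact: he.
  by rewrite -scalerAl coefZ; apply: idealMl.
have [Jc|nJc] := pselect (J c`_(size c).-1); first exact: (redu c).
have [all|/existsNP[g /not_implyP[Gg /existsNP[i0 hi0]]]] :=
    pselect (forall g, G g -> forall i, coefs_in (g`_i *: c)).
  exists c`_(size c).-1; split=> // g Gg i.
  by rewrite coefCM mulrC; have := all g Gg i (size c).-1; rewrite coefZ.
have [i /asboolP hi maxi] : exists2 i, `[< ~ coefs_in (g`_i *: c) >] &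
    forall k, `[< ~ coefs_in (g`_k *: c) >] -> (k <= i)%N.
  have ex : exists i, `[< ~ coefs_in (g`_i *: c) >] by exists i0; apply/asboolP.
  have bd k : `[< ~ coefs_in (g`_k *: c) >] -> (k <= size g)%N.
    move=> /asboolP; apply: contra_notT; rewrite -ltnNge => lt.
    by rewrite (nth_default _ (ltnW lt)) scale0r => j; rewrite coef0; apply: ideal0.
  by case: (ex_maxnP ex bd) => i hi maxi; exists i.
have Jk k j : (i < k)%N -> J (g`_k * c`_j).
  move=> lt; rewrite -coefZ.
  suff : coefs_in (g`_k *: c) by apply.
  apply: contrapT => h; have : (k <= i)%N by apply: maxi; apply/asboolP.
  by rewrite leqNgt lt.
apply: (redu (g`_i *: c)) => //.
- exact: size_scale_leq.
- rewrite coefZ; have := hc g Gg (i + (size c).-1)%N.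
  rewrite mulrC coefM.
  have lti : (i < (i + (size c).-1).+1)%N by rewrite ltnS leq_addr.
  rewrite (bigD1 (Ordinal lti)) //= addKn => h.
  rewrite -[_ * _](addrK (\sum_(k < (i + (size c).-1).+1 | k != Ordinal lti)
      g`_k * c`_(i + (size c).-1 - k))).
  apply: idealB => //; apply: ideal_sum => k /eqP nk.
  have [lt|lt|e] := ltngtP k i.
  + rewrite [c`_ _]nth_default ?mulr0; first exact: ideal0.
    move: (nat_of_ord k) lt => j lt.
    apply: (@leq_trans (size c).-1.+1); first by rewrite -szc.
    by rewrite addnC -addnBA ?(ltnW lt) // -addn1 leq_add2l subn_gt0.
  + exact: Jk.
  + by case: nk; apply: val_inj.
- by move=> h Gh k; rewrite -scalerAl coefZ; apply: idealM; apply: hc.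
Qed.

Lemma coefs_in_prime : (forall x y, J (x * y) -> J x \/ J y) ->
  forall p q, coefs_in (p * q) -> coefs_in p \/ coefs_in q.
Proof.
move=> prJ p q h; have [|np] := pselect (coefs_in p); first by left.
right=> i; have [|s [ns hs]] := @mccoy (fun g => g = q) p np; first by move=> g ->.
by have := hs q erefl i; rewrite coefCM => /prJ[].
Qed.
End Coefficientwise.

(** The second round of McCoy is applied to all coefficients of all members of [G] at once; this is
    why [mccoy] is stated for a set of polynomials. *)
Lemma mccoy2 (S : comNzRingType) (J : S -> Prop) (G : {poly {poly S}} -> Prop)
    (c : {poly {poly S}}) : is_ideal J -> ~ coefs_in (coefs_in J) c ->
  (forall g, G g -> coefs_in (coefs_in J) (c * g)) ->
  exists s, ~ J s /\ forall g, G g -> coefs_in (coefs_in J) (s%:P%:P * g).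
Proof.
move=> idJ nc hc; have [s [ns hs]] := mccoy (coefs_in_ideal idJ) nc hc.
have [|t [nt ht]] := @mccoy _ J idJ (fun h => exists g i, G g /\ h = g`_i) s ns.
  by move=> h [g [i [Gg ->]]]; have := hs g Gg i; rewrite coefCM.
by exists t; split=> // g Gg i; rewrite coefCM; apply: ht; exists g, i.
Qed.

(** Let [w] be the determinant that expresses x, y in a, b. By Cramer's rule [w * a] and [w * b],
    hence [w * z], lie in (x, y), so [w] does. Substituting back writes x as x times an element of
    (a, b), and x cancels. *)
Lemma two_generators_grade (C : comNzRingType) (a b x y z : C) :
  (exists c d, x = c * a + d * b) -> (exists c d, y = c * a + d * b) ->
  (exists c d, z = c * a + d * b) ->
  (forall w, x * w = 0 -> w = 0) ->
  (forall w c, y * w = x * c -> exists d, w = x * d) ->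
  (forall w c d, z * w = x * c + y * d -> exists c' d', w = x * c' + y * d') ->
  exists c d, 1 = c * a + d * b.
Proof.
move=> [al [be ex]] [ga [de ey]] [ze [et ez]] regx regy regz.
pose w := de * al - ga * be.
have [|c' [d' ew]] := regz w (ze * de - et * ga) (et * al - ze * be).
  by rewrite ez ex ey /w; ring.
have [|a' ea'] := regy (al - b * d') (ga + b * c').
  have -> : y * (al - b * d') = y * al - b * (x * c' + y * d') + x * (b * c') by ring.
  by rewrite -ew /w {1}ey ex; ring.
have [|b' eb'] := regy (be + a * d') (de - a * c').
  have -> : y * (be + a * d') = y * be + a * (x * c' + y * d') - x * (a * c') by ring.
  by rewrite -ew /w {1}ey ex; ring.
exists a', b'; apply/eqP; rewrite -subr_eq0; apply/eqP/regx.
have e1 : al = x * a' + b * d' by rewrite -ea'; ring.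
have e2 : be = x * b' - a * d' by rewrite -eb'; ring.
rewrite mulrBr mulr1 {1}ex e1 e2; ring.
Qed.

(** * Derivations of S[X, Y] *)

Definition nat_invertible (A : comNzRingType) := forall n, exists c : A, c * n.+1%:R = 1.

Lemma nat_invertible_reg (A : comNzRingType) (x : A) n :
  nat_invertible A -> x *+ n.+1 = 0 -> x = 0.
Proof.
move=> nA e; have [c ec] := nA n.
by rewrite -[x]mul1r -ec -mulrA mulr_natl e mulr0.
Qed.

Lemma nat_invertible_rmorph (A A' : comNzRingType) (g : {rmorphism A -> A'}) :
  nat_invertible A -> nat_invertible A'.
Proof.
by move=> h n; have [c e] := h n; exists (g c); rewrite -(rmorph_nat g) -rmorphM e rmorph1.
Qed.

Lemma deriv_surj (A : comNzRingType) (p : {poly A}) : nat_invertible A ->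
  exists q, q^`() = p.
Proof.
(* At [i = 0] the predecessor produces some constant term, which differentiation discards. *)
move=> nA; exists (\poly_(i < (size p).+1) (projT1 (cid (nA i.-1)) * p`_i.-1)).
apply/polyP => i; rewrite coef_deriv coef_poly ltnS /=.
case: ltnP => [lt|le]; last by rewrite mul0rn nth_default.
case: (cid (nA i)) => c /= e.
by rewrite -mulr_natl mulrA [_ * c]mulrC e mul1r.
Qed.

Lemma deriv_eq0 (A : comNzRingType) (p : {poly A}) : nat_invertible A ->
  p^`() = 0 -> p = (p`_0)%:P.
Proof.
move=> nA e; apply/polyP => -[|i]; rewrite coefC //=.
by apply: (nat_invertible_reg (n := i) nA); rewrite -coef_deriv e coef0.
Qed.

Section Derivations.
Variables (C : comNzRingType) (E : {additive C -> C}).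
Hypothesis EM : forall a b, E (a * b) = E a * b + a * E b.

Lemma additive_der1 : E 1 = 0.
Proof.
have h := EM 1 1; rewrite !mulr1 mul1r in h.
by apply: (addrI (E 1)); rewrite addr0 -h.
Qed.

Lemma iter_der0 n : iter n E 0 = 0.
Proof. by elim: n => // n IH; rewrite iterS IH raddf0. Qed.
Lemma iter_derD n : {morph iter n E : x y / x + y}.
Proof. by elim: n => // n IH x y; rewrite !iterS IH raddfD. Qed.
Lemma iter_der_le m n x : (m <= n)%N -> iter m E x = 0 -> iter n E x = 0.
Proof. by move=> le e; rewrite -(subnK le) iterD e iter_der0. Qed.

(** Only the extreme term of the Leibniz formula survives, with Pascal's rule giving its
    coefficient. Thus E-degrees add up in a domain where integers are invertible. *)
Lemma iter_der_top m n a b : iter m.+1 E a = 0 -> iter n.+1 E b = 0 ->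
  iter (m + n) E (a * b) = (iter m E a * iter n E b) *+ 'C(m + n, m) /\
  iter (m + n).+1 E (a * b) = 0.
Proof.
have [N] := ubnP (m + n)%N; elim: N m n a b => // N IH m n a b lt ha hb.
have step k : iter k.+1 E (a * b) = iter k E (E a * b) + iter k E (a * E b).
  by rewrite iterSr EM iter_derD.
have top0 m' n' a' b' : (m' + n' < N)%N -> iter m'.+1 E a' = 0 ->
    iter n'.+1 E b' = 0 -> iter (m' + n').+1 E (a' * b') = 0.
  by move=> lt' ha' hb'; have [] := IH m' n' a' b' lt' ha' hb'.
case: m => [|m] in lt ha *; case: n => [|n] in lt hb *.
- rewrite addn0 /= bin0 mulr1n; split=> //.
  by rewrite EM; move: ha hb => /= -> ->; rewrite mul0r mulr0 addr0.
- have a0 : E a = 0 by [].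
  have hb' : iter n.+1 E (E b) = 0 by rewrite -iterSr.
  have [e1 e2] := IH 0%N n a (E b) lt ha hb'.
  rewrite !add0n in e1 e2 *; split; rewrite step a0 mul0r iter_der0 add0r // e1.
  by rewrite !bin0 !mulr1n /= -!iterSr.
- have b0 : E b = 0 by [].
  have ha' : iter m.+1 E (E a) = 0 by rewrite -iterSr.
  rewrite addn0 in lt *.
  have [|e1 e2] := IH m 0%N (E a) b _ ha' hb; first by rewrite addn0.
  rewrite !addn0 in e1 e2; split; rewrite step b0 mulr0 iter_der0 addr0 // e1.
  by rewrite !binn !mulr1n /= -!iterSr.
- have ha' : iter m.+1 E (E a) = 0 by rewrite -iterSr.
  have hb' : iter n.+1 E (E b) = 0 by rewrite -iterSr.
  have lt1 : (m + n.+1 < N)%N by rewrite addSn in lt.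
  have lt2 : (m.+1 + n < N)%N by rewrite addSn -addnS.
  have [e1 e2] := IH m n.+1 (E a) b lt1 ha' hb.
  have [e3 e4] := IH m.+1 n a (E b) lt2 ha hb'.
  have eq : (m.+1 + n = m + n.+1)%N by rewrite addSn addnS.
  rewrite addSn; split; rewrite step.
    rewrite e1 -eq e3 -!iterSr -mulrnDr; congr (_ *+ _).
    by rewrite eq binS addnC.
  by rewrite e2 -eq e4 addr0.
Qed.

Definition loc_nilp := forall x, exists n, iter n E x = 0.

Lemma loc_nilp_top x : loc_nilp -> x <> 0 ->
  exists n, iter n E x <> 0 /\ iter n.+1 E x = 0.
Proof.
move=> nil nx; have ex : exists n, iter n E x == 0.
  by have [n e] := nil x; exists n; apply/eqP.
have : exists n, iter n.+1 E x = 0 /\ iter n E x <> 0; last by case=> n []; exists n.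
case: (ex_minnP ex) => -[|n] /eqP e mn; first by case: nx.
exists n; split=> // e'; have := mn n; rewrite ltnn => h.
by have := h (introT eqP e').
Qed.

(* If E is locally nilpotent and (E + d)^n 1 = 0, then d = 0: otherwise the E-degree of
   (E + d)^n 1 is n times that of d. *)
Lemma twisted_nilp (d : C) n : reduced_ring C -> nat_invertible C -> loc_nilp ->
  iter n (fun g => E g + d * g) 1 = 0 -> d = 0.
Proof.
move=> redC nC nil; set T := fun g => _; apply: contraPP => /(loc_nilp_top nil)[e [ne e0]].
(* [c] is a product of binomial coefficients; being a positive integer, it can be cancelled at the
   end. *)
have claim m : exists c, c != 0%N /\ iter (m * e).+1 E (iter m T 1) = 0 /\
   iter (m * e) E (iter m T 1) = iter e E d ^+ m *+ c.
  elim: m => [|m [c [c0 [h1 h2]]]].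
    by exists 1%N; rewrite mul0n /= additive_der1 expr0.
  have [t1 t2] := iter_der_top e0 h1.
  exists (c * 'C(e + m * e, e))%N; split.
    by rewrite muln_eq0 negb_or c0 -lt0n bin_gt0 leq_addr.
  have z k : (m * e <= k)%N -> iter k E (E (iter m T 1)) = 0.
    by move=> le; rewrite -iterSr; apply: iter_der_le h1.
  have eT : iter m.+1 T 1 = E (iter m T 1) + d * iter m T 1 by rewrite iterS.
  rewrite mulSn eT !iter_derD !z ?leqW ?leq_addl // !add0r t2; split=> //.
  by rewrite t1 h2 mulrnAr exprS mulrnA.
have [c [c0 [_ h]]] := claim n; move=> e1; apply: ne.
case: c => // c in c0 h *; apply: (@reduced_expr _ redC _ n).
by apply: (nat_invertible_reg (n := c) nC); rewrite -h e1 iter_der0.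
Qed.
End Derivations.

Section TwoVariables.
Variable S : comNzRingType.
Local Notation P := {poly {poly S}}.
Implicit Types p q : P.

(** The inner variable is X and the outer one is Y, so X-derivatives are taken on coefficients. *)
Definition dX p : P := map_poly (@deriv S) p.
Definition dY p : P := deriv p.
Definition XX : P := 'X%:P.
Definition YY : P := 'X.
Definition cst (s : S) : P := s%:P%:P.

Lemma coef_dX p i : (dX p)`_i = (p`_i)^`().
Proof. exact: coef_map. Qed.

Lemma dX_is_additive : zmod_morphism dX.
Proof. by move=> p q; apply/polyP => i; rewrite coefB !coef_dX coefB derivB. Qed.
HB.instance Definition _ := GRing.isZmodMorphism.Build P P dX dX_is_additive.
Lemma dY_is_additive : zmod_morphism dY.
Proof. by move=> p q; rewrite /dY derivB. Qed.
HB.instance Definition _ := GRing.isZmodMorphism.Build P P dY dY_is_additive.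
Lemma cstB s t : cst (s - t) = cst s - cst t. Proof. by rewrite /cst !polyCB. Qed.
Lemma cstD s t : cst (s + t) = cst s + cst t. Proof. by rewrite /cst !polyCD. Qed.
Lemma cstM s t : cst (s * t) = cst s * cst t. Proof. by rewrite /cst !polyCM. Qed.
Lemma cst_is_additive : zmod_morphism cst.
Proof. by move=> p q; rewrite /cst !rmorphB. Qed.
Lemma cst_is_monoid : monoid_morphism cst.
Proof. by split=> [|p q]; rewrite /cst ?rmorphM ?rmorph1. Qed.
HB.instance Definition _ := GRing.isZmodMorphism.Build S P cst cst_is_additive.
HB.instance Definition _ := GRing.isMonoidMorphism.Build S P cst cst_is_monoid.

Lemma dXM p q : dX (p * q) = dX p * q + p * dX q.
Proof.
apply/polyP => i; rewrite coefD coef_dX !coefM raddf_sum -big_split /=.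
by apply: eq_bigr => j _; rewrite derivM !coef_dX.
Qed.
Lemma dYM p q : dY (p * q) = dY p * q + p * dY q. Proof. exact: derivM. Qed.
Lemma dX_polyC a : dX a%:P = (a^`())%:P.
Proof. by apply/polyP => -[|i]; rewrite coef_dX !coefC //= deriv0. Qed.
Lemma dX_cst s : dX (cst s) = 0. Proof. by rewrite dX_polyC derivC. Qed.
Lemma dY_cst s : dY (cst s) = 0. Proof. exact: derivC. Qed.
Lemma dX_XX : dX XX = 1. Proof. by rewrite dX_polyC derivX. Qed.
Lemma dY_XX : dY XX = 0. Proof. exact: derivC. Qed.
Lemma dY_YY : dY YY = 1. Proof. exact: derivX. Qed.
Lemma dX_YY : dX YY = 0.
Proof.
by apply/polyP => i; rewrite coef_dX coefX coef0; case: (i == 1)%N; rewrite ?derivC.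
Qed.
Lemma dXdY p : dX (dY p) = dY (dX p).
Proof. by apply/polyP => i; rewrite coef_dX !coef_deriv coef_dX derivMn. Qed.

Lemma poly2_ind (Q : P -> Prop) : (forall p q, Q p -> Q q -> Q (p + q)) ->
  (forall p, Q p -> Q (p * XX)) -> (forall p, Q p -> Q (p * YY)) ->
  (forall s, Q (cst s)) -> forall p, Q p.
Proof.
move=> QD QX QY Qc; elim/poly_ind => [|p a Qp]; first by rewrite -(rmorph0 cst).
apply: (QD); first exact: QY.
elim/poly_ind: a => [|a s Qa]; first by rewrite -[0%:P](rmorph0 cst).
by rewrite rmorphD rmorphM; apply: QD; [apply: QX | apply: Qc].
Qed.

Lemma poly2_rmorph_ext (Q : comNzRingType) (g h : {rmorphism P -> Q}) :
  (forall s, g (cst s) = h (cst s)) -> g XX = h XX -> g YY = h YY -> g =1 h.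
Proof.
move=> ec eX eY; elim/poly2_ind => [p q ep eq|p ep|p ep|//].
- by rewrite !rmorphD ep eq.
- by rewrite !rmorphM ep eX.
- by rewrite !rmorphM ep eY.
Qed.

(** A derivation along [g] that kills constants is determined by its values at X and Y. With [g] the
    identity this expands a derivation of P; with [g] a substitution it is the usual chain rule. *)
Lemma chain_rule (Q : comNzRingType) (g : {rmorphism P -> Q}) (d : {additive P -> Q}) :
  (forall p q, d (p * q) = d p * g q + g p * d q) -> (forall s, d (cst s) = 0) ->
  forall p, d p = g (dX p) * d XX + g (dY p) * d YY.
Proof.
move=> dM dc; elim/poly2_ind => [p q ep eq|p ep|p ep|s].
- by rewrite !raddfD /= ep eq; ring.
- by rewrite dM ep dXM dYM dX_XX dY_XX mulr0 mulr1 addr0 !rmorphD !rmorphM /=; ring.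
- by rewrite dM ep dXM dYM dX_YY dY_YY mulr0 mulr1 addr0 !rmorphD !rmorphM /=; ring.
- by rewrite dc dX_cst dY_cst !rmorph0 !mul0r addr0.
Qed.

Definition Jac p q := dX p * dY q - dY p * dX q.

Lemma JacM p q r : Jac p (q * r) = Jac p q * r + q * Jac p r.
Proof. rewrite /Jac dXM dYM; ring. Qed.
Lemma Jac_is_additive p : zmod_morphism (Jac p).
Proof. by move=> q r; rewrite /Jac !raddfB /=; ring. Qed.
HB.instance Definition _ p := GRing.isZmodMorphism.Build P P (Jac p) (Jac_is_additive p).
Lemma JacBl p q r : Jac (p - q) r = Jac p r - Jac q r.
Proof. rewrite /Jac !raddfB /=; ring. Qed.
Lemma Jac_cstMl s p q : Jac (cst s * p) q = cst s * Jac p q.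
Proof. rewrite /Jac dXM dYM dX_cst dY_cst; ring. Qed.
Lemma Jac_cstl s q : Jac (cst s) q = 0.
Proof. by rewrite /Jac dX_cst dY_cst; ring. Qed.
Lemma Jac_cstr s q : Jac q (cst s) = 0.
Proof. by rewrite /Jac dX_cst dY_cst; ring. Qed.
Lemma Jac_XX p : Jac p XX = - dY p.
Proof. by rewrite /Jac dX_XX dY_XX; ring. Qed.
Lemma Jac_YY p : Jac p YY = dX p.
Proof. by rewrite /Jac dX_YY dY_YY; ring. Qed.
Lemma Jacxx p : Jac p p = 0. Proof. rewrite /Jac; ring. Qed.

Lemma natinv_poly : nat_invertible S -> nat_invertible {poly S}.
Proof. exact: (nat_invertible_rmorph (@polyC S)). Qed.

Lemma poly2_closed_const p : nat_invertible S -> dX p = 0 -> dY p = 0 ->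
  p = cst p`_0`_0.
Proof.
move=> nS eX eY; rewrite {1}(deriv_eq0 (natinv_poly nS) eY); congr (_%:P).
by apply: (deriv_eq0 nS); rewrite -coef_dX eX coef0.
Qed.

Lemma poly2_potential p q : nat_invertible S -> dX p = dY q ->
  exists F, dX F = q /\ dY F = p.
Proof.
move=> nS e; have [G eG] := deriv_surj p (natinv_poly nS).
have /(deriv_eq0 (natinv_poly nS)) : dY (dX G - q) = 0.
  by rewrite raddfB /= -dXdY [dY G]eG e subrr.
set c := _`_0 => ec; have [h eh] := deriv_surj c nS.
exists (G - h%:P); rewrite !raddfB /= dX_polyC eh -ec /dY derivC subr0 eG.
by split=> //; rewrite opprB addrC subrK.
Qed.

Section Divergence.
Variable E : {additive P -> P}.
Hypothesis EM : forall a b, E (a * b) = E a * b + a * E b.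
Hypothesis Ec : forall s, E (cst s) = 0.
Hypothesis Enil : loc_nilp E.
Hypothesis redP : reduced_ring P.
Hypothesis nS : nat_invertible S.

Lemma der_expand p : E p = dX p * E XX + dY p * E YY.
Proof. exact: (chain_rule (g := idfun)). Qed.

Let div := dX (E XX) + dY (E YY).

(** With E seen as a vector field, both sides are the Lie derivative of the 2-form du dv, written as
    a multiple of dX dY. *)
Lemma Lie_Jac u v : E (Jac u v) + div * Jac u v = Jac (E u) v + Jac u (E v).
Proof.
rewrite (der_expand (Jac u v)) (der_expand u) (der_expand v) /div /Jac.
rewrite !raddfB !raddfD /= !dXM !dYM !dXdY; ring.
Qed.

(* div + E is the Lie derivative on volume forms: by Lie_Jac it acts nilpotently on Jacobians,
   in particular on 1 = Jac XX YY. *)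
Lemma divergence0 : dX (E XX) + dY (E YY) = 0.
Proof.
pose T g := E g + div * g.
have nP : nat_invertible P := nat_invertible_rmorph cst nS.
have TD x y : T (x + y) = T x + T y by rewrite /T raddfD mulrDr /= addrACA.
have T0 : T 0 = 0 by rewrite /T raddf0 mulr0 addr0.
have iT0 n : iter n T 0 = 0 by elim: n => //= n ->.
have iTD n x y : iter n T (x + y) = iter n T x + iter n T y.
  by elim: n => //= n ->.
(* [T] obeys the Leibniz rule on Jacobians, so its N-th iterate at [Jac u v] is a combination of the
   [Jac (E^i u) (E^(N-i) v)]; one of the two arguments is zero once [N] reaches [a + b]. *)
have kill N a b u v : (a + b <= N)%N -> iter a E u = 0 -> iter b E v = 0 ->
    iter N T (Jac u v) = 0.
  elim: N a b u v => [|N IH] a b u v le hu hv.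
    move: le hu; rewrite leqn0 addn_eq0 => /andP[/eqP-> _] /= ->.
    by rewrite -(rmorph0 cst) Jac_cstl.
  rewrite iterSr /T Lie_Jac -/T iTD.
  case: a hu le => [/= -> _|a]; first by rewrite raddf0 -(rmorph0 cst) !Jac_cstl !iT0 addr0.
  case: b hv => [/= -> _ _|b]; first by rewrite raddf0 !raddf0 !iT0 addr0.
  rewrite !iterSr addnS addSn ltnS => hv hu le.
  rewrite (IH a b.+1) ?iterSr ?addnS ?add0r //.
  by rewrite (IH a.+1 b) ?iterSr // addSn.
have [a ha] := Enil XX; have [b hb] := Enil YY.
have := kill _ _ _ _ _ (leqnn _) ha hb.
rewrite Jac_YY dX_XX; exact: (twisted_nilp EM redP nP Enil).
Qed.

Lemma der_is_Jac : exists F, forall p, E p = Jac F p.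
Proof.
have [|F [eX eY]] := @poly2_potential (- E XX) (E YY) nS.
  by rewrite raddfN /=; apply/eqP; rewrite eq_sym -addr_eq0 addrC divergence0.
exists F => p; rewrite (der_expand p) /Jac eX eY; ring.
Qed.
End Divergence.
End TwoVariables.
Arguments XX {S}.
Arguments YY {S}.
Arguments cst {S}.

(** * Common divisors in K[X][Y] for a field K *)

Section BivariateGcd.
Variable Om : fieldType.
Local Notation P := {poly {poly Om}}.

Lemma prime_divisor (r : {poly Om}) : (1 < size r)%N -> exists q : {poly Om},
  [/\ (1 < size q)%N, q %| r & forall a b, q %| a * b -> q %| a \/ q %| b].
Proof.
move=> sr; pose Q n := `[< exists q : {poly Om}, [/\ (1 < size q)%N, q %| r & size q = n] >].
have exQ : exists n, Q n by exists (size r); apply/asboolP; exists r.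
case: (ex_minnP exQ) => n /asboolP[q [sq qr eq]] mn; exists q; split=> // a b qab.
have [/eqP s1|s1] := boolP (size (gcdp q a) == 1%N).
  by right; rewrite -(@Gauss_dvdpr _ b a q) // /coprimep s1.
left; have g0 : gcdp q a != 0 by rewrite gcdp_eq0 negb_and -size_poly_gt0 (ltnW sq).
have sg : (1 < size (gcdp q a))%N.
  by rewrite ltn_neqAle eq_sym s1 size_poly_gt0.
have le : (n <= size (gcdp q a))%N.
  apply: mn; apply/asboolP; exists (gcdp q a); split=> //.
  exact: dvdp_trans (dvdp_gcdl _ _) qr.
have /eqp_dvdl <- : gcdp q a %= q.
  have gq := dvdp_gcdl q a.
  rewrite -(dvdp_size_eqp gq) eqn_leq; apply/andP; split; last by rewrite eq.
  by apply: dvdp_leq => //; rewrite -size_poly_gt0 (ltnW sq).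
exact: dvdp_gcdr.
Qed.

Definition pdvd (q : {poly Om}) (p : P) := exists p', p = q%:P * p'.

Lemma pdvd_coefs q p : pdvd q p <-> coefs_in (fun s => q %| s) p.
Proof.
split=> [[p' ->] i|h]; first by rewrite coefCM dvdp_mulr.
exists (\poly_(i < size p) (p`_i %/ q)); apply/polyP => i; rewrite coefCM coef_poly.
by case: ltnP => le; [rewrite mulrC divpK //; exact: h | rewrite mulr0 nth_default].
Qed.

Lemma pdvd_prime q : (forall a b, q %| a * b -> q %| a \/ q %| b) ->
  forall p1 p2, pdvd q (p1 * p2) -> pdvd q p1 \/ pdvd q p2.
Proof.
move=> qpr p1 p2 /pdvd_coefs h.
have idJ : is_ideal (fun s => q %| s).
  by split=> [|x y|a x]; [exact: dvdp0 | exact: dvdp_add | exact: dvdp_mull].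
by have [/pdvd_coefs|/pdvd_coefs] := coefs_in_prime idJ qpr h; [left|right].
Qed.

Variables (u v : P).
Hypothesis cop : forall h u' v', u = h * u' -> v = h * v' -> exists c, h = c%:P%:P.

(** The denominator [r] is removed one prime [q] of Om[X] at a time. If [q] divides [e], it cancels.
    If it divides [x], it divides [c * u] and [c * v], hence [c] by coprimality, and cancels from
    [c] and [x]. The second case leaves [r] alone, which is why the measure also contains
    [lead_coef x]. *)
Lemma cop_lcm (r : {poly Om}) (c x a b e : P) : r != 0 -> c * u = x * a -> c * v = x * b ->
  r%:P * c = x * e -> exists d, c = x * d.
Proof.
have [n] := ubnP (size r + size (lead_coef x))%N.
elim: n r c x a b e => // n IH r c x a b e; rewrite ltnS => le r0 eu ev er.
have [x0|x0] := eqVneq x 0.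
  exists 0; move: er; rewrite x0 !mul0r => /eqP; rewrite mulf_eq0 polyC_eq0 (negPf r0) /=.
  by move/eqP.
have [s1|s1] := leqP (size r) 1.
  have /size_poly1P[z z0 ez] : size r == 1%N by rewrite eqn_leq s1 size_poly_gt0.
  exists (z^-1%:P%:P * e); rewrite mulrCA -er ez mulrA -!rmorphM mulVf //.
  by rewrite mul1r.
have [q [sq /dvdpP[r' er'] qpr]] := prime_divisor s1.
have q0 : q != 0 by rewrite -size_poly_gt0 ltnW.
have r'0 : r' != 0 by apply: contraNneq r0 => z; rewrite er' z mul0r.
have szr : (size r' < size r)%N.
  rewrite er' size_mul // -(prednK (ltnW sq)) addnS /= -[X in (X < _)%N]addn0 ltn_add2l.
  by rewrite -ltnS prednK // ltnW.
have qP0 : q%:P != 0 :> P by rewrite polyC_eq0.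
have : pdvd q (x * e) by exists (r'%:P * c); rewrite -er er' rmorphM; ring.
case/(pdvd_prime qpr) => [[x' ex]|[e' ee]]; last first.
  apply: (IH r' c x a b e') => //; first by apply: leq_trans le; rewrite ltn_add2r.
  by apply: (mulfI qP0); rewrite mulrA -rmorphM [q * _]mulrC -er' er ee mulrCA.
have qcu : pdvd q c.
  apply: contrapT => nqc.
  have /(pdvd_prime qpr)[//|[u' eu']] : pdvd q (c * u) by exists (x' * a); rewrite eu ex mulrA.
  have /(pdvd_prime qpr)[//|[v' ev']] : pdvd q (c * v) by exists (x' * b); rewrite ev ex mulrA.
  have [z /polyC_inj ez] := cop eu' ev'.
  by move: sq; rewrite ez size_polyC; case: (z != 0).
have [c' ec] := qcu.
have x'0 : x' != 0 by apply: contraNneq x0 => z; rewrite ex z mulr0.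
have [||||d ed] := IH r c' x' a b e _ r0.
- apply: leq_trans le; rewrite ltn_add2l ex lead_coefM lead_coefC size_mul ?lead_coef_eq0 //.
  rewrite -(prednK (ltnW sq)) addSn /= -[X in (X < _)%N]add0n ltn_add2r.
  by rewrite -ltnS prednK // ltnW.
- by apply: (mulfI qP0); rewrite !mulrA -ec -ex.
- by apply: (mulfI qP0); rewrite !mulrA -ec -ex.
- by apply: (mulfI qP0); rewrite mulrCA -ec er ex mulrA.
by exists d; rewrite ec ex ed mulrA.
Qed.

(** Gauss's lemma: a common factor over Om(X) of positive degree in Y would, once the primes of [m]
    and [n] are divided out, be a nonconstant common factor in Om[X][Y]. *)
Lemma common_factor (m n : {poly Om}) (g u1 v1 : P) : m != 0 -> n != 0 -> (1 < size g)%N ->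
  m%:P * u = g * u1 -> n%:P * v = g * v1 -> False.
Proof.
have [N] := ubnP (size m + size n)%N.
elim: N m n g u1 v1 => // N IH m n g u1 v1; rewrite ltnS => le m0 n0 sg eu ev.
have shrink (w : {poly Om}) : w != 0 -> (1 < size w)%N -> exists q w',
    [/\ w = w' * q, w' != 0, (size w' < size w)%N, q != 0
      & forall p1 p2, pdvd q (p1 * p2) -> pdvd q p1 \/ pdvd q p2].
  move=> w0 s1; have [q [sq /dvdpP[r' er'] qpr]] := prime_divisor s1.
  have q0 : q != 0 by rewrite -size_poly_gt0 ltnW.
  have r'0 : r' != 0 by apply: contraNneq w0 => z; rewrite er' z mul0r.
  exists q, r'; split=> //; last exact: pdvd_prime.
  rewrite er' size_mul // -(prednK (ltnW sq)) addnS /= -[X in (X < _)%N]addn0 ltn_add2l.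
  by rewrite -ltnS prednK // ltnW.
have gfac (q : {poly Om}) (g' : P) : q != 0 -> g = q%:P * g' -> size g' = size g.
  by move=> q0 ->; rewrite size_Cmul.
have [sm|sm] := leqP (size m) 1; last first.
  have [q [m' [em m'0 lt q0 qpr]]] := shrink m m0 sm.
  have qP0 : q%:P != 0 :> P by rewrite polyC_eq0.
  have : pdvd q (g * u1) by exists (m'%:P * u); rewrite -eu em rmorphM; ring.
  case/qpr => [[g' eg]|[u' eu']].
    apply: (IH m' n g' u1 (q%:P * v1)) => //.
    - by apply: leq_trans le; rewrite ltn_add2r.
    - by rewrite (gfac q).
    - by apply: (mulfI qP0); rewrite !mulrA -eg -eu em rmorphM; ring.
    - by rewrite ev eg; ring.
  apply: (IH m' n g u' v1) => //; first by apply: leq_trans le; rewrite ltn_add2r.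
  apply: (mulfI qP0); have -> : q%:P * (g * u') = g * u1 by rewrite eu'; ring.
  by rewrite -eu em rmorphM; ring.
have [sn|sn] := leqP (size n) 1; last first.
  have [q [n' [en n'0 lt q0 qpr]]] := shrink n n0 sn.
  have qP0 : q%:P != 0 :> P by rewrite polyC_eq0.
  have : pdvd q (g * v1) by exists (n'%:P * v); rewrite -ev en rmorphM; ring.
  case/qpr => [[g' eg]|[v' ev']].
    apply: (IH m n' g' (q%:P * u1) v1) => //.
    - by apply: leq_trans le; rewrite ltn_add2l.
    - by rewrite (gfac q).
    - by rewrite eu eg; ring.
    - by apply: (mulfI qP0); rewrite !mulrA -eg -ev en rmorphM; ring.
  apply: (IH m n' g u1 v') => //; first by apply: leq_trans le; rewrite ltn_add2l.
  apply: (mulfI qP0); have -> : q%:P * (g * v') = g * v1 by rewrite ev'; ring.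
  by rewrite -ev en rmorphM; ring.
have unitC (w : {poly Om}) : w != 0 -> (size w <= 1)%N -> exists z, z%:P * w = 1.
  move=> w0 sw; have /size_poly1P[z z0 ->] : size w == 1%N.
    by rewrite eqn_leq sw size_poly_gt0.
  by exists z^-1; rewrite -rmorphM mulVf.
have [z ez] := unitC m m0 sm; have [y ey] := unitC n n0 sn.
have [||c ec] := @cop g (z%:P%:P * u1) (y%:P%:P * v1).
- by rewrite mulrCA -eu mulrA -rmorphM ez mul1r.
- by rewrite mulrCA -ev mulrA -rmorphM ey mul1r.
by move: sg; rewrite ec ltnNge size_polyC_leq1.
Qed.

(** The gcd over Om(X) is trivial, so Bezout writes a nonzero element of Om[X] as a combination of
    [u] and [v]. Its product with [c] is divisible by [x], and [cop_lcm] removes it. *)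
Lemma coprime_regular (c x a b : P) : c * u = x * a -> c * v = x * b -> exists d, c = x * d.
Proof.
move=> eu ev; have [w /eqpP[[c1 c2] /andP[/= c10 c20] e]] := Bezoutp u v.
have g0 : gcdp u v != 0.
  rewrite gcdp_eq0; apply/negP => /andP[/eqP u0 /eqP v0].
  have [||z ez] := @cop 'X 0 0; rewrite ?u0 ?v0 ?mulr0 //.
  by have := size_polyX {poly Om}; rewrite ez size_polyC; case: (_ != 0).
have [s1|s1] := leqP (size (gcdp u v)) 1.
  have /size_poly1P[g gn0 eg] : size (gcdp u v) == 1%N.
    by rewrite eqn_leq s1 size_poly_gt0.
  apply: (@cop_lcm (c2 * g) c x a b (c1%:P * (w.1 * a + w.2 * b))) => //.
    by rewrite mulf_neq0.
  rewrite polyCM -eg mul_polyC -e -mul_polyC.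
  have -> : c1%:P * (w.1 * u + w.2 * v) * c = c1%:P * (w.1 * (c * u) + w.2 * (c * v)) by ring.
  by rewrite eu ev; ring.
have /Pdiv.Idomain.dvdpP[[m u1] /= m0 em] := dvdp_gcdl u v.
have /Pdiv.Idomain.dvdpP[[n v1] /= n0 en] := dvdp_gcdr u v.
by case: (@common_factor m n (gcdp u v) u1 v1); rewrite // mul_polyC ?em ?en mulrC.
Qed.
End BivariateGcd.

(** * Tensor products over a field: additive maps and coordinates *)

Lemma malg_gen_ind (K : comNzRingType) (I : choiceType)
    (Q : {malg K[{cmonom I}]} -> Prop) :
  (forall x y, Q x -> Q y -> Q (x + y)) -> (forall x y, Q x -> Q y -> Q (x * y)) ->
  (forall c, Q (malgC c)) -> (forall i, Q (mvar K i)) -> forall x, Q x.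
Proof.
move=> QD QM QC QV x.
have Qm (m : {cmonom I}) : Q (mkmalgU m 1).
  have [n] := ubnP (mdeg m); elim: n m => // n IH m; rewrite ltnS => le.
  have [/eqP|m0] := eqVneq (mdeg m) 0%N; first by rewrite mdeg_eq0 => /eqP->; exact: QC.
  have [i im] : exists i, i \in finsupp m.
    case: (fset_0Vmem (finsupp m)) => [e|[i im]]; last by exists i.
    by move: m0; rewrite mdegE e big_seq_fset0.
  have em : m = mmul (ucm i) (divcm m (ucm i)).
    apply/eqP/cmP => j; rewrite cmM divcmE ucmE subnKC //.
    by case: eqP => // <-; rewrite lt0n cmE_neq0.
  have -> : mkmalgU m 1 = mvar K i * mkmalgU (divcm m (ucm i)) 1 :> {malg K[{cmonom I}]}.
    rewrite {1}em; have -> : (1 : K) = 1 * 1 by rewrite mulr1.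
    by rewrite -[RHS]/(fgmul _ _) fgmulUU !mulr1.
  apply: QM => //; apply: IH; apply: leq_trans le.
  by rewrite [in X in (_ < X)%N]em mdegM mdegU.
rewrite (monalgE x); elim/big_ind: _ => [|//|m _]; first by have := QC 0; rewrite raddf0.
have -> : mkmalgU m (mcoeff m x) = malgC (mcoeff m x) * mkmalgU m 1.
  by rewrite -[RHS]/(fgmul _ _) fgmulUU mulr1 mul1m.
exact: QM.
Qed.

Section TensTools.
Variables (k : fieldType) (S K : comNzRingType).
Variables (f : {rmorphism k -> S}) (g : {rmorphism k -> K}).
Local Notation T := (tens f g).
Local Notation tL := (tensL f g).
Local Notation tR := (tensR f g).

Lemma tens_sum (x : T) : exists l : seq (S * K), x = \sum_(z <- l) tL z.1 * tR z.2.
Proof.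
have pD (u v : {malg K[{cmonom S}]}) : \pi_T (u + v) = \pi_T u + \pi_T v by rewrite !piE.
have pM (u v : {malg K[{cmonom S}]}) : \pi_T (u * v) = \pi_T u * \pi_T v by rewrite !piE.
rewrite -[x]reprK; move: (repr x) => {x}; elim/malg_gen_ind => [u v|u v|c|s].
- by move=> [l el] [m em]; exists (l ++ m); rewrite pD el em big_cat.
- move=> [l el] [m em]; exists [seq (x.1 * y.1, x.2 * y.2) | x <- l, y <- m].
  rewrite pM el em big_allpairs_dep big_distrlr; apply: eq_bigr => x _.
  by apply: eq_bigr => y _; rewrite !rmorphM mulrACA.
- by exists [:: (1, c)]; rewrite big_seq1 tensL1 mul1r.
- by exists [:: (s, 1)]; rewrite big_seq1 tensR1 mulr1.
Qed.

Lemma tens_ind (Q : T -> Prop) : Q 0 -> (forall x y, Q x -> Q y -> Q (x + y)) ->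
  (forall s a, Q (tL s * tR a)) -> forall x, Q x.
Proof.
by move=> Q0 QD QM x; have [l ->] := tens_sum x; elim/big_ind: _ => // z _; apply: QM.
Qed.

(** The presentation of [tens] by ring relations directly yields only ring maps. An additive map is
    defined on the polynomial algebra by first evaluating monomials in S; it vanishes on all
    multiples of the relations, hence on the ideal. *)
Lemma tens_bilinear (U : comNzRingType) (hL : {additive S -> U}) (hR : {additive K -> U}) :
  (forall c s a, hR (g c * a) * hL s = hR a * hL (f c * s)) ->
  exists G : {additive T -> U}, forall s a, G (tL s * tR a) = hR a * hL s.
Proof.
move=> bal.
pose ev := @cmonom_eval S S id.
pose L : {additive {malg K[{cmonom S}]} -> U} :=
  @mmap {cmonom S} K U hR (fun m => hL (ev m)).
have LU c m : L (mkmalgU m c) = hR c * hL (ev m) by exact: mmapU.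
have evM m n : ev (mmul m n) = ev m * ev n by exact: mmorphM.
have evU s : ev (ucm s) = s by exact: cmonom_evalU.
have ev1 : ev mone = 1 by exact: mmorph1.
have LX c m s : L (mkmalgU m c * mvar K s) = hR c * hL (ev m * s).
  have -> : mkmalgU m c * mvar K s = mkmalgU (mmul m (ucm s)) (c * 1) by exact: fgmulUU.
  by rewrite LU evM evU mulr1.
have LXX c m s t :
    L (mkmalgU m c * (mvar K s * mvar K t)) = hR c * hL (ev m * (s * t)).
  have -> : mkmalgU m c * (mvar K s * mvar K t) =
      mkmalgU (mmul m (mmul (ucm s) (ucm t))) (c * (1 * 1)).
    by rewrite -fgmulUU -fgmulUU.
  by rewrite LU !evM !evU !mulr1.
have LC c m d : L (mkmalgU m c * malgC d) = hR (c * d) * hL (ev m).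
  have -> : mkmalgU m c * malgC d = mkmalgU (mmul m mone) (c * d) by exact: fgmulUU.
  by rewrite LU evM ev1 mulr1.
have Lgen s a : L (malgC a * mvar K s) = hR a * hL s.
  by rewrite -[malgC a]/(mkmalgU mone a) LX ev1 mul1r.
clearbody L ev.
have red (x : {malg K[{cmonom S}]}) :
    (forall c m, L (mkmalgU m c * x) = 0) -> forall y, L (y * x) = 0.
  by move=> hx y; rewrite (monalgE y) mulr_suml raddf_sum big1.
have kill x : tens_ideal f g x -> L x = 0.
  move=> /asboolP h; rewrite -[x]mul1r.
  apply: (h _ (ideal_of_additive L)) => _ [r s|r s|d]; apply: red => c m.
  - apply: additive_mulD0.
    apply: etrans (LX c m (r + s)) (etrans _ (esym (congr2 +%R (LX c m r) (LX c m s)))).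
    by rewrite mulrDr raddfD mulrDr.
  - by apply: additive_mulB0; apply: etrans (LX c m (r * s)) (esym (LXX c m r s)).
  - apply: additive_mulB0; apply: etrans (LX c m (f d)) (etrans _ (esym (LC c m (g d)))).
    by rewrite [ev m * f d]mulrC -bal mulrC [c * _]mulrC mulrC.
pose G (x : T) := L (repr x).
have Gpi x : G (\pi_T x) = L x.
  apply/eqP; rewrite -subr_eq0 -raddfB; apply/eqP; apply: kill.
  by rewrite -[tens_ideal _ _ _]/(_ \in tens_ideal f g) Quotient.idealrBE reprK.
have Gz : zmod_morphism G.
  move=> x y; rewrite -[x]reprK -[y]reprK.
  have -> : \pi_T (repr x) - \pi_T (repr y) = \pi_T (repr x - repr y) by rewrite !piE.
  by rewrite !Gpi raddfB.
pose Ga : {additive T -> U} := HB.pack G (GRing.isZmodMorphism.Build T U G Gz).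
exists Ga => s a; rewrite -Lgen -[Ga _]/(G _) -Gpi; congr (G _).
by rewrite mulrC /tensL /tensR !piE.
Qed.
End TensTools.

Section DualFamilies.
Variables (k K : fieldType) (g : {rmorphism k -> K}) (l : {additive K -> k}).
Hypothesis lZ : forall c x, l (g c * x) = c * l x.
Hypothesis l1 : l 1 = 1.

(** Coefficients are read off by functionals of the form [l (a * _)], because these are the ones
    that extend to a tensor product through its retraction. *)
Definition expands (e : seq (K * K)) (c : K) := c = \sum_(y <- e) g (l (y.1 * c)) * y.2.

(* Gram-Schmidt for the pairing (x, y) |-> l (x * y). *)
Lemma dual_family (cs : seq K) : exists e, forall c, c \in cs -> expands e c.
Proof.
suff [n [ga [ep [orth h]]]] : exists n (ga ep : nat -> K),
    (forall a b, (a < n)%N -> (b < n)%N -> l (ga a * ep b) = (a == b)%:R) /\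
    forall c, c \in cs -> c = \sum_(0 <= a < n) g (l (ga a * c)) * ep a.
  exists [seq (ga a, ep a) | a <- index_iota 0 n] => c /h e.
  by rewrite /expands big_map.
elim: cs => [|c cs [n [ga [ep [orth IH]]]]]; first by exists 0%N, (fun=> 0), (fun=> 0).
pose c' := c - \sum_(0 <= a < n) g (l (ga a * c)) * ep a.
have [c0|c0] := eqVneq c' 0.
  exists n, ga, ep; split=> // d; rewrite inE => /orP[/eqP->|/IH //].
  by apply/eqP; rewrite -subr_eq0 -/c' c0.
have lsum b (F : nat -> k) : (b < n)%N ->
    l (ga b * \sum_(0 <= a < n) g (F a) * ep a) = F b.
  move=> ltb; rewrite mulr_sumr raddf_sum big_mkord (bigD1 (Ordinal ltb)) //= big1.
    by rewrite mulrCA lZ orth // eqxx mulr1 addr0.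
  move=> a /eqP na; rewrite mulrCA lZ orth //; case: eqP => [e|_]; last by rewrite mulr0.
  by case: na; apply: val_inj.
have lc' b : (b < n)%N -> l (ga b * c') = 0.
  by move=> ltb; rewrite mulrBr raddfB /= lsum // subrr.
(* [c'^-1] pairs to 1 with [c'] because [l 1 = 1]; the sum makes it orthogonal to the earlier
   [ep a]. *)
pose gn := c'^-1 - \sum_(0 <= a < n) g (l (c'^-1 * ep a)) * ga a.
have gnE x : l (gn * x) = l (c'^-1 * x) -
    \sum_(0 <= a < n) l (c'^-1 * ep a) * l (ga a * x).
  rewrite mulrBl raddfB /= mulr_suml raddf_sum; congr (_ - _).
  by apply: eq_bigr => a _; rewrite -mulrA lZ.
have gnep b : (b < n)%N -> l (gn * ep b) = 0.
  move=> ltb; rewrite gnE big_mkord (bigD1 (Ordinal ltb)) //= orth // eqxx mulr1 big1 ?addr0 ?subrr //.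
  move=> a /eqP na; rewrite orth //; case: eqP => [e|_]; last by rewrite mulr0.
  by case: na; apply: val_inj.
have gnc' : l (gn * c') = 1.
  by rewrite gnE mulVf // l1 big_nat big1 ?subr0 // => a /= lta; rewrite lc' ?mulr0.
exists n.+1, (fun a => if a == n then gn else ga a), (fun a => if a == n then c' else ep a).
split=> [a b|d].
  rewrite !ltnS (leq_eqVlt a) (leq_eqVlt b); case: (eqVneq a n) => [->|na] /=; case: (eqVneq b n) => [->|nb] //=.
  - by move=> _ /gnep ->.
  - by move=> lta _; rewrite lc' // (negPf na).
  - exact: orth.
have old x : \sum_(0 <= a < n) g (l ((if a == n then gn else ga a) * x)) *
    (if a == n then c' else ep a) = \sum_(0 <= a < n) g (l (ga a * x)) * ep a.
  by rewrite !big_nat; apply: eq_bigr => a /= lta; rewrite ltn_eqF.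
rewrite big_nat_recr //= eqxx old inE => /orP[/eqP->|/IH ed].
  have ec : c = c' + \sum_(0 <= a < n) g (l (ga a * c)) * ep a by rewrite subrK.
  have -> : l (gn * c) = 1; last by rewrite rmorph1 mul1r addrC.
  rewrite {1}ec mulrDr raddfD /= gnc' mulr_sumr raddf_sum big_nat big1 ?addr0 //.
  by move=> a /= lta; rewrite mulrCA lZ gnep // mulr0.
rewrite -ed [l (gn * d)](_ : _ = 0) ?rmorph0 ?mul0r ?addr0 //.
rewrite {1}ed mulr_sumr raddf_sum big_nat big1 // => a /= lta.
by rewrite mulrCA lZ gnep // mulr0.
Qed.

Section Coordinates.
Variables (C : comNzRingType) (f : {rmorphism k -> C}).
Local Notation T := (tens f g).

(** [p] is id (x) l. Writing x as a sum of pure tensors, [cs] collects the second factors: whatever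
    family expands these recovers x, so a single family can serve finitely many elements. *)
Lemma tens_retraction : exists p : {additive T -> C},
  [/\ forall s x, p (tensL f g s * x) = s * p x, forall a, p (tensR f g a) = f (l a)
    & forall x, exists cs : seq K, forall e, (forall c, c \in cs -> expands e c) ->
        x = \sum_(y <- e) tensL f g (p (tensR f g y.1 * x)) * tensR f g y.2].
Proof.
have [|p pE] := @tens_bilinear k C K f g C idfun (f \o l).
  by move=> c s a /=; rewrite lZ rmorphM mulrA [f c * _]mulrC.
have LM s t a : tensL f g s * (tensL f g t * tensR f g a) = tensL f g (s * t) * tensR f g a.
  exact: etrans (mulrA _ _ _) (congr1 ( *%R^~ _) (esym (tensLM _ _ _ _))).
have RM s b a : tensR f g b * (tensL f g s * tensR f g a) = tensL f g s * tensR f g (b * a).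
  exact: etrans (mulrCA _ _ _) (congr1 ( *%R _) (esym (tensRM _ _ _ _))).
have LR s c b : tensL f g s * (tensR f g (g c * b)) = tensL f g (f c * s) * tensR f g b.
  apply: etrans (congr1 ( *%R _) (tensRM _ _ _ _)) _.
  apply: etrans (congr1 (fun z => _ * (z * _)) (esym (tensLR _ _ _))) _.
  exact: etrans (mulrCA _ _ _) (LM _ _ _).
have pM s x : p (tensL f g s * x) = s * p x.
  elim/tens_ind: x => [|x y ex ey|t a]; first by rewrite mulr0 raddf0 mulr0.
    by rewrite mulrDr !raddfD mulrDr /= ex ey.
  apply: etrans (congr1 p (LM _ _ _)) _; apply: etrans (pE _ _) _.
  by apply: etrans (mulrCA _ _ _) (congr1 ( *%R s) (esym (pE _ _))).
exists p; split=> // [a|x].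
  have e : tensR f g a = tensL f g 1 * tensR f g a by rewrite tensL1 mul1r.
  by rewrite {1}e; apply: etrans (pE _ _) _; rewrite mulr1.
have [z ez] := tens_sum x; exists [seq y.2 | y <- z] => e he.
have px a : p (tensR f g a * x) = \sum_(y <- z) f (l (a * y.2)) * y.1.
  rewrite ez mulr_sumr raddf_sum; apply: eq_bigr => y _.
  by apply: etrans (congr1 p (RM _ _ _)) _; apply: etrans (pE _ _) _.
under eq_bigr => y _ do rewrite px raddf_sum mulr_suml.
rewrite exchange_big {1}ez !big_seq; apply: eq_bigr => y yz.
apply: etrans (congr1 (fun z => tensL f g y.1 * tensR f g z) (he y.2 (map_f _ yz))) _.
apply: etrans (congr1 ( *%R _) (raddf_sum (tensR f g) _ _ _)) _.
apply: etrans (mulr_sumr _ _ _ _) _; apply: eq_bigr => w _.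
exact: (LR y.1 (l (w.1 * y.2)) w.2).
Qed.
End Coordinates.
End DualFamilies.

(** * Reducedness under algebraic extension of scalars in characteristic zero *)

Lemma separable_dvd_sqr (E : fieldType) (m p : {poly E}) :
  separable_poly m -> m %| p * p -> m %| p.
Proof.
move=> sepm mpp; have m0 : m != 0 by apply: separable_poly_neq0.
set d := gcdp m p.
have d0 : d != 0 by rewrite gcdp_eq0 negb_and m0.
have em : m %/ d * d = m by rewrite divpK // dvdp_gcdl.
have ep : p %/ d * d = p by rewrite divpK // dvdp_gcdr.
have cop : coprimep (m %/ d) (p %/ d) by apply: coprimep_div_gcd; rewrite m0.
(* [m %/ d] is prime to [p %/ d], so it divides [d]; then its square divides [m], and separability
   makes it constant. *)
have : m %/ d %| p %/ d * (p %/ d * d).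
  by rewrite -(@dvdp_mul2r _ d) // em ep mulrAC ep.
rewrite !Gauss_dvdpr // => /dvdpP[q ed].
have [sq _] := elimT separable_polyP sepm.
have e2 : m = m %/ d * (q * (m %/ d)) by rewrite -ed em.
have : coprimep (m %/ d) (m %/ d) by apply: sq; rewrite [X in _ %| X]e2 mulrCA dvdp_mull.
rewrite coprimepp => /size_poly1P[c c0 ec].
by rewrite -em ec mul_polyC dvdpZl // dvdp_gcdr.
Qed.

Section PrimitiveElement.
Variables (k K : fieldType) (j : {rmorphism k -> K}).
Hypothesis char0 : [pchar k] =i pred0.
Hypothesis algK : forall x : K, algebraicOver j x.

Lemma primitive_element_seq (cs : seq K) : exists th, forall c, c \in cs ->
  exists p : {poly k}, c = (map_poly j p).[th].
Proof.
elim: cs => [|c cs [th h]]; first by exists 0.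
have [p p0 rp] := algK c; have [q q0 rq] := algK th.
have [n [[p1 e1] [q1 e2]]] := pchar0_PET p0 rp q0 rq char0.
exists (th *+ n - c) => d; rewrite inE => /orP[/eqP->|/h[r ->]]; first by exists p1.
exists (r \Po q1); rewrite map_comp_poly horner_comp; congr horner.
by rewrite e2.
Qed.

Lemma minimal_polynomial (th : K) : exists m : {poly k},
  [/\ m \is monic, separable_poly m, root (map_poly j m) th
    & forall p, root (map_poly j p) th -> (size p < size m)%N -> p = 0].
Proof.
have [p0 p00 rp0] := algK th.
pose Q n := `[< exists p : {poly k}, [/\ p != 0, root (map_poly j p) th & size p = n] >].
have exQ : exists n, Q n by exists (size p0); apply/asboolP; exists p0.
case: (ex_minnP exQ) => n /asboolP[m0 [m00 rm0 em0]] mn.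
have lc0 : lead_coef m0 != 0 by rewrite lead_coef_eq0.
pose m := (lead_coef m0)^-1 *: m0.
have szm : size m = n by rewrite size_scale ?invr_eq0.
have rm : root (map_poly j m) th.
  by rewrite map_polyZ rootZ // fmorph_eq0 invr_eq0.
have monm : m \is monic by rewrite monicE lead_coefZ mulVf.
have minm p : root (map_poly j p) th -> (size p < size m)%N -> p = 0.
  move=> rp; rewrite szm => lt; apply: contraTeq lt => p00'.
  by rewrite -leqNgt; apply: mn; apply/asboolP; exists p.
exists m; split=> //.
have m_neq0 : m != 0 by apply: monic_neq0.
have sz1 : (1 < size m)%N.
  rewrite ltnNge; apply/negP => /size1_polyC e; move: rm m_neq0.
  by rewrite e map_polyC rootC polyC_eq0 fmorph_eq0 => ->.
rewrite unlock /= /coprimep.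
set g := gcdp _ _; have gm : g %| m := dvdp_gcdl _ _; have gm' : g %| m^`() := dvdp_gcdr _ _.
have m'0 : m^`() != 0.
  apply/eqP => e; have := congr1 (fun q : {poly k} => q`_(size m).-2) e.
  rewrite coef_deriv coef0 -[in (size m).-2.+1](prednK (_ : 0 < (size m).-1)%N) //=; last first.
    by rewrite -ltnS prednK // ltnW.
  rewrite prednK; last by rewrite -ltnS prednK // ltnW.
  move/eqP; rewrite -/(lead_coef m) (monicP monm) -mulr_natr mul1r.
  by rewrite (pcharf0P _).1 //; case: (size m) sz1 => [|[|]].
have g0 : g != 0 by rewrite gcdp_eq0 negb_and m_neq0.
have ltg : (size g < size m)%N.
  by apply: leq_ltn_trans (dvdp_leq m'0 gm') _; exact: lt_size_deriv.
have [q eq] := dvdpP _ _ gm.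
have q0 : q != 0 by apply: contraNneq m_neq0 => z; rewrite eq z mul0r.
move: rm; rewrite eq rmorphM rootM => /orP[rq|rg]; last first.
  by move: g0; rewrite (minm g) ?eqxx.
have : (size m <= size q)%N by rewrite leqNgt; apply/negP => /(minm q rq) z; rewrite z eqxx in q0.
rewrite eq size_mul // -ltnS prednK; last first.
  by rewrite addn_gt0 size_poly_gt0 q0.
rewrite -addn1 leq_add2l => le; rewrite eqn_leq size_poly_gt0 g0 andbT.
by rewrite -ltnS.
Qed.
End PrimitiveElement.

Section ReducedBaseChange.
Variables (k K : fieldType) (j : {rmorphism k -> K}) (l : {additive K -> k}).
Hypothesis char0 : [pchar k] =i pred0.
Hypothesis algK : forall x : K, algebraicOver j x.
Hypothesis lZ : forall c x, l (j c * x) = c * l x.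
Hypothesis l1 : l 1 = 1.
Variables (C T : comNzRingType) (f : {rmorphism k -> C}).
Variables (L : {rmorphism C -> T}) (Q : {rmorphism K -> T}) (p : {additive T -> C}).
Hypothesis LQ : forall c, L (f c) = Q (j c).
Hypothesis gen : forall x, exists s : seq (C * K), x = \sum_(z <- s) L z.1 * Q z.2.
Hypothesis pL : forall s x, p (L s * x) = s * p x.
Hypothesis pQ : forall a, p (Q a) = f (l a).
Hypothesis redC : reduced_ring C.

Let ev th (P : {poly C}) := (map_poly L P).[Q th].

(** Low powers of [th] are free over k, as certified by a right inverse [N] of their coordinate
    matrix [M]; this is an identity over k and survives the passage to C. *)
Lemma power_basis_free th (m : {poly k}) (P : {poly C}) :
  (forall q, root (map_poly j q) th -> (size q < size m)%N -> q = 0) ->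
  (size P < size m)%N -> ev th P = 0 -> P = 0.
Proof.
move=> minm ltP e; set d := (size m).-1.
have szm : size m = d.+1 by rewrite prednK //; apply: leq_ltn_trans ltP.
have [es hes] := dual_family lZ l1 [seq th ^+ i | i <- iota 0 d].
pose ga i := (nth (0, 0) es i).1; pose ep i := (nth (0, 0) es i).2.
pose M : 'M[k]_(d, size es) := \matrix_(i, a) l (ga a * th ^+ i).
have thE (i : 'I_d) : th ^+ i = \sum_(a < size es) j (M i a) * ep a.
  have he : expands j l es (th ^+ i).
    by apply: hes; apply/mapP; exists (i : nat) => //; rewrite mem_iota /= add0n ltn_ord.
  apply: etrans he _; rewrite (big_nth (0, 0)) big_mkord.
  by apply: eq_bigr => a _; rewrite mxE.
have /row_freeP[N MN] : row_free M.
  apply: inj_row_free => v vM.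
  pose q : {poly k} := \poly_(i < d) (if insub i is Some i' then v 0 i' else 0).
  have qE (i : 'I_d) : q`_i = v 0 i by rewrite coef_poly ltn_ord valK.
  have q0 : q = 0.
    apply: minm; last by rewrite szm ltnS size_poly.
    have szq : (size (map_poly j q) <= d)%N.
      by rewrite size_map_poly size_poly.
    rewrite /root (horner_coef_wide _ szq).
    under eq_bigr => i _ do rewrite coef_map thE mulr_sumr qE.
    rewrite exchange_big big1 // => a _.
    transitivity (j ((v *m M) 0 a) * ep a); last by rewrite vM mxE rmorph0 mul0r.
    rewrite mxE rmorph_sum mulr_suml; apply: eq_bigr => i _.
    by rewrite rmorphM mulrA.
  by apply/rowP => i; rewrite -qE q0 coef0 mxE.
have coordE a : p (Q a * ev th P) = \sum_(i < d) P`_i * f (l (a * th ^+ i)).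
  have szq : (size (map_poly L P) <= d)%N.
    by apply: leq_trans (size_poly _ _) _; rewrite -ltnS -szm.
  rewrite /ev (horner_coef_wide _ szq) mulr_sumr raddf_sum; apply: eq_bigr => i _.
  by rewrite coef_map /= mulrCA pL -rmorphXn -rmorphM pQ.
have z a : \sum_(i < d) P`_i * f (l (a * th ^+ i)) = 0.
  by rewrite -coordE e mulr0 raddf0.
apply/polyP => i; rewrite coef0; have [lti|le] := ltnP i d; last first.
  by rewrite nth_default //; apply: leq_trans le; rewrite -ltnS -szm.
transitivity (\sum_(i' < d) P`_i' * f ((M *m N) i' (Ordinal lti))).
  rewrite MN (bigD1 (Ordinal lti)) //= mxE eqxx rmorph1 mulr1 big1 ?addr0 //.
  by move=> i' /negPf ne; rewrite mxE ne rmorph0 mulr0.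
under eq_bigr => i' _ do rewrite mxE rmorph_sum mulr_sumr.
rewrite exchange_big big1 // => a _.
transitivity (0 * f (N a (Ordinal lti))); last by rewrite mul0r.
rewrite -[X in _ = X * _](z (ga a)) mulr_suml.
by apply: eq_bigr => i' _; rewrite rmorphM mulrA mxE.
Qed.

(* An element x involves finitely many elements of K, hence is P(th) for one th with separable
   minimal polynomial m and deg P < deg m; then m divides P ^ 2, and so divides P, over the residue
   fields of the minimal primes of C. *)
Lemma reduced_base_change : reduced_ring T.
Proof.
move=> x xx; have [s es] := gen x.
have [th hth] := primitive_element_seq char0 algK [seq z.2 | z <- s].
have [m [monm sepm rm minm]] := minimal_polynomial char0 algK th.
have evD P1 P2 : ev th (P1 + P2) = ev th P1 + ev th P2 by rewrite /ev rmorphD hornerD.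
have evM P1 P2 : ev th (P1 * P2) = ev th P1 * ev th P2 by rewrite /ev rmorphM hornerM.
have ev_k q : ev th (map_poly f q) = Q (map_poly j q).[th].
  rewrite /ev -map_poly_comp (eq_map_poly (_ : _ =1 Q \o j)) // map_poly_comp.
  exact: horner_map.
have [P0 eP0] : exists P0, x = ev th P0.
  rewrite es; elim: (s) hth => [|z s' IH] hth.
    by exists 0; rewrite big_nil /ev rmorph0 horner0.
  have [|P1 e1] := IH; first by move=> c cs; apply: hth; rewrite inE cs orbT.
  have [q eq] := hth z.2 (mem_head _ _).
  exists ((z.1)%:P * map_poly f q + P1); rewrite big_cons evD evM ev_k -eq e1.
  by rewrite {2}/ev map_polyC hornerC.
pose mf := map_poly f m; have monmf : mf \is monic by apply: monic_map.
have szmf : size mf = size m by rewrite size_map_poly_id0 // (monicP monm) rmorph1 oner_neq0.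
have evmf : ev th mf = 0 by rewrite ev_k (rootP rm) rmorph0.
pose P := Pdiv.Ring.rmodp P0 mf.
have ltP : (size P < size m)%N by rewrite -szmf Pdiv.Ring.ltn_rmodp monic_neq0.
have ePx : x = ev th P.
  by rewrite eP0 {1}(Pdiv.RingMonic.rdivp_eq monmf P0) evD evM evmf mulr0 add0r.
have [q eq] : exists q, P * P = q * mf.
  exists (Pdiv.Ring.rdivp (P * P) mf); rewrite {1}(Pdiv.RingMonic.rdivp_eq monmf (P * P)).
  rewrite [X in _ + X](@power_basis_free th m) ?addr0 //.
    by rewrite -szmf Pdiv.Ring.ltn_rmodp monic_neq0.
  have : ev th (P * P) = 0 by rewrite evM -ePx xx.
  by rewrite {1}(Pdiv.RingMonic.rdivp_eq monmf (P * P)) evD evM evmf mulr0 add0r.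
suff -> : x = 0 by [].
rewrite ePx; suff -> : P = 0 by rewrite /ev rmorph0 horner0.
apply/polyP => i; rewrite coef0; apply: contrapT => nPi.
have [|||Om [g [g1 _ _]]] := @minimal_prime_field C (fun u => exists n, u = P`_i ^+ n) redC.
- by exists 0%N.
- by move=> _ _ [n1 ->] [n2 ->]; exists (n1 + n2)%N; rewrite exprD.
- by case=> n /esym/(reduced_expr redC).
have gPi : g P`_i != 0 by apply: g1; exists 1%N.
have sepg : separable_poly (map_poly (g \o f) m) by rewrite separable_map.
have : map_poly (g \o f) m %| map_poly g P.
  apply: separable_dvd_sqr sepg _; rewrite -rmorphM eq rmorphM /=.
  by rewrite map_poly_comp dvdp_mull.
have gP0 : map_poly g P != 0.
  by apply/eqP => /(congr1 (fun q : {poly Om} => q`_i)) /eqP; rewrite coef_map coef0 (negPf gPi).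
move/(dvdp_leq gP0); rewrite size_map_poly leqNgt => /negP; apply.
by apply: leq_ltn_trans ltP; exact: size_poly.
Qed.
End ReducedBaseChange.

(** * Noetherian rings *)

Definition principal (C : comNzRingType) (x : C) := fun y => exists d, y = x * d.

Lemma principal_ideal (C : comNzRingType) (x : C) : is_ideal (principal x).
Proof.
split=> [|_ _ [d ->] [e ->]|a _ [d ->]]; first by exists 0; rewrite mulr0.
  by exists (d + e); rewrite mulrDr.
by exists (a * d); rewrite mulrCA.
Qed.

Section IdealGen.
Variable C : comNzRingType.

Fixpoint lincomb (s : seq C) (x : C) : Prop :=
  if s is a :: s' then exists c y, x = c * a + y /\ lincomb s' y else x = 0.

Lemma lincomb_ideal s : is_ideal (lincomb s).
Proof.
elim: s => [|a s [h0 hD hM]] /=.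
  by split=> [//|x y -> ->|b x ->]; rewrite ?addr0 ?mulr0.
split.
- by exists 0, 0; rewrite mul0r addr0.
- move=> _ _ [c [x [-> hx]]] [d [y [-> hy]]]; exists (c + d), (x + y).
  by split; [ring | apply: hD].
- by move=> b _ [c [x [-> hx]]]; exists (b * c), (b * x); split; [ring | apply: hM].
Qed.

Lemma ideal_gen_min (G I : C -> Prop) x : is_ideal I -> (forall g, G g -> I g) ->
  ideal_gen G x -> I x.
Proof. by move=> hI hG; apply. Qed.

Lemma ideal_gen_seq s x : ideal_gen (fun y => y \in s) x <-> lincomb s x.
Proof.
split.
  apply: ideal_gen_min; first exact: lincomb_ideal.
  elim: s => // a s IH g /=; rewrite inE => /orP[/eqP->|/IH h].
    by exists 1, 0; rewrite mul1r addr0; split=> //; case: (lincomb_ideal s).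
  by exists 0, g; rewrite mul0r add0r.
elim: s x => [|a s IH] x /=.
  by move=> ->; exact: ideal0 (ideal_gen_ideal _).
move=> [c [y [-> hy]]]; have idG := ideal_gen_ideal (fun y => y \in a :: s).
apply: (idealD idG).
  by apply: (idealM idG); apply: ideal_gen_sub; rewrite mem_head.
apply: ideal_gen_min (IH _ hy); first exact: ideal_gen_ideal.
by move=> g gs; apply: ideal_gen_sub; rewrite inE gs orbT.
Qed.

Lemma ideal_gen0 (x : C) : ideal_gen (fun y : C => y \in [::]) x <-> x = 0.
Proof. exact: ideal_gen_seq. Qed.

Lemma ideal_gen1 (a x : C) : ideal_gen (fun y => y \in [:: a]) x <-> principal a x.
Proof.
rewrite ideal_gen_seq /=; split=> [[c [_ [-> ->]]]|[d ->]].
  by exists c; rewrite addr0 mulrC.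
by exists d, 0; rewrite addr0 mulrC.
Qed.

Lemma ideal_gen2 (a b x : C) : ideal_gen (fun y => y \in [:: a; b]) x <->
  exists c d, x = a * c + b * d.
Proof.
rewrite ideal_gen_seq /=; split=> [[c [_ [-> [d [_ [-> ->]]]]]]|[c [d ->]]].
  by exists c, d; ring.
by exists c, (b * d); split; [ring | exists d, 0; split=> //; ring].
Qed.

Lemma ideal_gen_finite (G : C -> Prop) x : ideal_gen G x ->
  exists l : seq C, (forall c, c \in l -> G c) /\ ideal_gen (fun y => y \in l) x.
Proof.
apply: (ideal_gen_min (I := fun x => exists l : seq C,
  (forall c, c \in l -> G c) /\ ideal_gen (fun y => y \in l) x)) => [|g Gg]; last first.
  exists [:: g]; split=> [c|]; first by rewrite inE => /eqP->.
  by apply: ideal_gen_sub; rewrite inE.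
have mono (l m : seq C) y : (forall c : C, c \in l -> c \in m) ->
    ideal_gen (fun y => y \in l) y -> ideal_gen (fun y => y \in m) y.
  move=> h; apply: ideal_gen_min => [|g gl]; first exact: ideal_gen_ideal.
  by apply: ideal_gen_sub; apply: h.
split.
- by exists [::]; split=> //; apply/ideal_gen0.
- move=> u v [l [hl hu]] [m [hm hv]]; exists (l ++ m); split.
    by move=> c; rewrite mem_cat => /orP[/hl|/hm].
  apply: (idealD (ideal_gen_ideal _)); [apply: mono hu | apply: mono hv] => c;
    by rewrite mem_cat => ->; rewrite ?orbT.
- by move=> a u [l [hl hu]]; exists l; split=> //; apply: (idealM (ideal_gen_ideal _)).
Qed.
End IdealGen.

Lemma noetherian_surj (C C' : comNzRingType) (F : {rmorphism C -> C'}) :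
  (forall y, exists x, F x = y) -> noetherian C -> noetherian C'.
Proof.
move=> surF nC I idI.
have idF : is_ideal (fun x => I (F x)).
  split=> [|x y hx hy|a x hx]; first by rewrite rmorph0; exact: (ideal0 idI).
    by rewrite rmorphD; exact: (idealD idI).
  by rewrite rmorphM; exact: (idealM idI).
have [s hs] := nC _ idF; exists [seq F x | x <- s] => y; split; last first.
  apply: ideal_gen_min => // _ /mapP[x xs ->]; apply/hs.
  exact: ideal_gen_sub.
have [x <-] := surF y => /hs.
apply: (ideal_gen_min (I := fun x => ideal_gen (fun y => y \in [seq F x | x <- s]) (F x))).
  have idG := ideal_gen_ideal (fun y => y \in [seq F x | x <- s]).
  split=> [|u v hu hv|a u hu]; first by rewrite rmorph0; exact: (ideal0 idG).
    by rewrite rmorphD; exact: (idealD idG).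
  by rewrite rmorphM; exact: (idealM idG).
by move=> g gs; apply: ideal_gen_sub; apply: map_f.
Qed.

Section Hilbert.
Variable A : comNzRingType.
Hypothesis nA : noetherian A.

Theorem hilbert_basis : noetherian {poly A}.
Proof.
move=> I idI.
(* Coefficients in degree n of the members of [I] of degree at most n; allowing lower degrees makes
   each [L n] an ideal and the family increasing. *)
pose L n c := exists p : {poly A}, [/\ I p, (size p <= n.+1)%N & p`_n = c].
have idL n : is_ideal (L n).
  split.
  - by exists 0; rewrite size_poly0 coef0; split=> //; exact: (ideal0 idI).
  - move=> _ _ [p [Ip sp <-]] [q [Iq sq <-]]; exists (p + q); split; last by rewrite coefD.
      exact: (idealD idI).
    by apply: leq_trans (size_polyD _ _) _; rewrite geq_max sp sq.
  - move=> a _ [p [Ip sp <-]]; exists (a%:P * p); split; last by rewrite coefCM.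
      exact: (idealM idI).
    by rewrite mul_polyC; apply: leq_trans (size_scale_leq _ _) sp.
have Lle m n c : (m <= n)%N -> L m c -> L n c.
  move=> le [p [Ip sp <-]]; exists ('X^(n - m) * p); split.
  - exact: (idealM idI).
  - apply: leq_trans (size_polyMleq _ _) _; rewrite size_polyXn addSn /=.
    by apply: leq_trans (leq_add (leqnn _) sp) _; rewrite addnS subnK.
  - by rewrite mulrC coefMXn ltnNge leq_subr subKn.
have lift n : exists G : seq {poly A}, (forall q, q \in G -> I q) /\
    forall c, L n c -> exists q, [/\ ideal_gen (fun y => y \in G) q, (size q <= n.+1)%N & q`_n = c].
  have [s hs] := nA (idL n).
  have [G [GI hG]] : exists G : seq {poly A}, (forall q, q \in G -> I q) /\
      forall a, a \in s -> exists q, [/\ q \in G, (size q <= n.+1)%N & q`_n = a].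
    have : forall a, a \in s -> L n a by move=> a sa; apply/hs; apply: ideal_gen_sub.
    elim: (s) => [|a s' IH] h; first by exists [::].
    have [|G [GI hG]] := IH; first by move=> b bs; apply: h; rewrite inE bs orbT.
    have [p [Ip sp ep]] := h a (mem_head _ _); exists (p :: G); split.
      by move=> q; rewrite inE => /orP[/eqP->|/GI].
    move=> b; rewrite inE => /orP[/eqP->|/hG[q [qG sq eq]]].
      by exists p; rewrite mem_head.
    by exists q; rewrite inE qG orbT.
  exists G; split=> // c /hs.
  have idG := ideal_gen_ideal (fun y => y \in G).
  apply: (ideal_gen_min (I := fun c => exists q,
    [/\ ideal_gen (fun y => y \in G) q, (size q <= n.+1)%N & q`_n = c])) => [|a /hG[q [qG sq eq]]]; last first.
    by exists q; split=> //; apply: ideal_gen_sub.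
  split.
  - by exists 0; rewrite size_poly0 coef0; split=> //; exact: (ideal0 idG).
  - move=> _ _ [p [Ip sp <-]] [q [Iq sq <-]]; exists (p + q); split; last by rewrite coefD.
      exact: (idealD idG).
    by apply: leq_trans (size_polyD _ _) _; rewrite geq_max sp sq.
  - move=> a _ [p [Ip sp <-]]; exists (a%:P * p); split; last by rewrite coefCM.
      exact: (idealM idG).
    by rewrite mul_polyC; apply: leq_trans (size_scale_leq _ _) sp.
have [N hN] : exists N, forall n c, L n c -> L N c.
  have idU : is_ideal (fun c => exists n, L n c).
    split.
    - by exists 0%N; exact: (ideal0 (idL 0%N)).
    - move=> x y [m hm] [n hn]; exists (m + n)%N; apply: (idealD (idL _)).
        by apply: Lle hm; rewrite leq_addr.
      by apply: Lle hn; rewrite leq_addl.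
    - by move=> a x [n hn]; exists n; apply: (idealM (idL _)).
  have [s hs] := nA idU.
  have [N hN] : exists N, forall a, a \in s -> L N a.
    have : forall a, a \in s -> exists n, L n a.
      by move=> a sa; apply/hs; apply: ideal_gen_sub.
    elim: (s) => [|a s' IH] h; first by exists 0%N.
    have [|N hN] := IH; first by move=> b bs; apply: h; rewrite inE bs orbT.
    have [n hn] := h a (mem_head _ _); exists (n + N)%N => b.
    rewrite inE => /orP[/eqP->|/hN]; first by apply: Lle hn; rewrite leq_addr.
    by apply: Lle; rewrite leq_addl.
  exists N => n c Lc; have /hs : exists n, L n c by exists n.
  by apply: ideal_gen_min.
pose G n := projT1 (cid (lift n)).
have GI n q : q \in G n -> I q by have [h _] := projT2 (cid (lift n)); exact: h.
have GL n c : L n c -> exists q, [/\ ideal_gen (fun y => y \in G n) q, (size q <= n.+1)%N & q`_n = c].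
  by have [_ h] := projT2 (cid (lift n)); exact: h.
pose H := flatten [seq G n | n <- iota 0 N.+1].
have GH n q : (n <= N)%N -> ideal_gen (fun y => y \in G n) q -> ideal_gen (fun y => y \in H) q.
  move=> le; apply: ideal_gen_min => [|g gG]; first exact: ideal_gen_ideal.
  apply: ideal_gen_sub; apply/flattenP; exists (G n) => //; apply: map_f.
  by rewrite mem_iota add0n ltnS.
have HI q : ideal_gen (fun y => y \in H) q -> I q.
  apply: ideal_gen_min => // g /flattenP[_ /mapP[n _ ->]]; exact: GI.
exists H => x; split; last exact: HI.
have [n] := ubnP (size x); elim: n x => [//|n IH] x; rewrite ltnS => sx Ix.
have idH := ideal_gen_ideal (fun y => y \in H).
case: n => [|n] in IH sx *.
  by move: sx; rewrite leqn0 size_poly_eq0 => /eqP->; exact: (ideal0 idH).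
have [q [Hq sq eq]] : exists q, [/\ ideal_gen (fun y => y \in H) q, (size q <= n.+1)%N & q`_n = x`_n].
  have Lx : L n x`_n by exists x.
  have [le|lt] := leqP n N.
    by have [q [hq sq eq]] := GL _ _ Lx; exists q; split=> //; apply: GH hq.
  have [q [hq sq eq]] := GL _ _ (hN _ _ Lx); exists ('X^(n - N) * q); split.
  - by apply: (idealM idH); apply: GH hq.
  - apply: leq_trans (size_polyMleq _ _) _; rewrite size_polyXn addSn /=.
    by apply: leq_trans (leq_add (leqnn _) sq) _; rewrite addnS subnK // ltnW.
  - by rewrite mulrC coefMXn ltnNge leq_subr subKn // ltnW.
rewrite -(subrK q x); apply: (idealD idH) => //; apply: IH; last first.
  by apply: (idealB idI) => //; apply: HI.
rewrite ltnS; apply/leq_sizeP => i; rewrite leq_eqVlt => /orP[/eqP <-|lt].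
  by rewrite coefB eq subrr.
by rewrite coefB !nth_default ?subrr //; [apply: leq_trans sq _ | apply: leq_trans sx _].
Qed.
End Hilbert.

Section Annihilators.
Variable C : comNzRingType.
Hypothesis nC : noetherian C.
Variable x : C.

Definition colon (c a : C) := principal x (a * c).

Lemma colon_ideal c : is_ideal (colon c).
Proof.
rewrite /colon; have idP := principal_ideal x; split.
- by rewrite mul0r; exact: (ideal0 idP).
- by move=> a b ha hb; rewrite mulrDl; exact: (idealD idP).
- by move=> a b hb; rewrite -mulrA; exact: (idealM idP).
Qed.

(** The ideals [colon c] for these [c] are the maximal annihilators of nonzero elements of C/(x).
    They are prime, and in a Noetherian ring they cover the zero divisors modulo x. *)
Definition max_colon c := ~ principal x c /\
  forall c', ~ principal x c' -> (forall a, colon c a -> colon c' a) ->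
  forall a, colon c' a -> colon c a.

Lemma max_colon_exists c0 : ~ principal x c0 ->
  exists c, max_colon c /\ forall a, colon c0 a -> colon c a.
Proof.
move=> n0; apply: contrapT => nex.
have next c : exists c', ~ principal x c -> (forall a, colon c0 a -> colon c a) ->
    [/\ ~ principal x c', forall a, colon c a -> colon c' a
      & exists a, colon c' a /\ ~ colon c a].
  case: (pselect (~ principal x c /\ forall a, colon c0 a -> colon c a)); last first.
    by move=> h; exists 0 => h1 h2; case: h.
  case=> nc hc; apply: contrapT => nn; apply: nex; exists c; split=> //; split=> // c' nc' le a ha.
  by apply: contrapT => na; apply: nn; exists c' => _ _; split=> //; exists a.
pose nx c := projT1 (cid (next c)).
pose u n := iter n nx c0.
have uP n : ~ principal x (u n) /\ forall a, colon c0 a -> colon (u n) a.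
  elim: n => //= n [h1 h2]; have [k1 k2 _] := projT2 (cid (next (u n))) h1 h2.
  by split=> // a /h2/k2.
have uS n a : colon (u n) a -> colon (u n.+1) a.
  by have [h1 h2] := uP n; have [_ k2 _] := projT2 (cid (next (u n))) h1 h2; exact: k2.
have uN n : exists a, colon (u n.+1) a /\ ~ colon (u n) a.
  by have [h1 h2] := uP n; have [_ _ k3] := projT2 (cid (next (u n))) h1 h2; exact: k3.
have ule m n a : (m <= n)%N -> colon (u m) a -> colon (u n) a.
  by move=> /subnK <-; elim: (n - m)%N => // d IH h; rewrite addSn; apply: uS; apply: IH.
have idU : is_ideal (fun a => exists n, colon (u n) a).
  split.
  - by exists 0%N; exact: (ideal0 (colon_ideal _)).
  - move=> a b [m hm] [n hn]; exists (m + n)%N; apply: (idealD (colon_ideal _)).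
      by apply: ule hm; rewrite leq_addr.
    by apply: ule hn; rewrite leq_addl.
  - by move=> a b [n hn]; exists n; apply: (idealM (colon_ideal _)).
have [s hs] := nC idU.
have [N hN] : exists N, forall a, a \in s -> colon (u N) a.
  have : forall a, a \in s -> exists n, colon (u n) a.
    by move=> a sa; apply/hs; apply: ideal_gen_sub.
  elim: (s) => [|a s' IH] h; first by exists 0%N.
  have [|N hN] := IH; first by move=> b bs; apply: h; rewrite inE bs orbT.
  have [n hn] := h a (mem_head _ _); exists (n + N)%N => b.
  rewrite inE => /orP[/eqP->|/hN]; first by apply: ule hn; rewrite leq_addr.
  by apply: ule; rewrite leq_addl.
have [a [ha na]] := uN N; apply: na.
have /hs : exists n, colon (u n) a by exists N.+1.
by apply: ideal_gen_min => //; exact: colon_ideal.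
Qed.

Lemma max_colon_prime c a b : max_colon c -> colon c (a * b) -> colon c a \/ colon c b.
Proof.
move=> [nc mx] hab; have [|na] := pselect (colon c a); first by left.
right; apply: (mx (a * c)) => //; last by rewrite /colon mulrA [b * a]mulrC.
by move=> d; rewrite /colon mulrCA; apply: (idealM (principal_ideal x)).
Qed.

Lemma max_colon1 c : max_colon c -> ~ colon c 1.
Proof. by move=> [nc _]; rewrite /colon mul1r. Qed.

(** Finitely many such elements [s] generate the ideal generated by all. What annihilates [s] modulo
    x also annihilates [c], so the prime [colon c] contains the intersection of the [colon d], hence
    one of them, and maximality of that one reverses the inclusion. *)
Lemma finite_max_colon : exists s : seq C, (forall c, c \in s -> max_colon c) /\
  forall c, max_colon c -> exists2 d, d \in s & forall a, colon c a -> colon d a.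
Proof.
have [s0 hs0] := nC (ideal_gen_ideal max_colon).
have [s [hs1 hs2]] : exists s : seq C, (forall c, c \in s -> max_colon c) /\
    forall c, ideal_gen max_colon c -> ideal_gen (fun y => y \in s) c.
  have : forall c, c \in s0 -> ideal_gen max_colon c.
    by move=> c cs; apply/hs0; apply: ideal_gen_sub.
  move=> h; suff [s [hs1 hs2]] : exists s : seq C, (forall c, c \in s -> max_colon c) /\
    forall c, c \in s0 -> ideal_gen (fun y => y \in s) c.
    exists s; split=> // c /hs0; apply: ideal_gen_min => //; exact: ideal_gen_ideal.
  elim: (s0) h => [|c s' IH] h; first by exists [::].
  have [|s [h1 h2]] := IH; first by move=> b bs; apply: h; rewrite inE bs orbT.
  have [l [l1 l2]] := ideal_gen_finite (h c (mem_head _ _)).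
  exists (l ++ s); split=> [b|b]; first by rewrite mem_cat => /orP[/l1|/h1].
  rewrite inE => /orP[/eqP->|/h2].
    apply: ideal_gen_min l2 => [|g gl]; first exact: ideal_gen_ideal.
    by apply: ideal_gen_sub; rewrite mem_cat gl.
  apply: ideal_gen_min => [|g gl]; first exact: ideal_gen_ideal.
  by apply: ideal_gen_sub; rewrite mem_cat gl orbT.
exists s; split=> // c mc.
suff [d ds hd] : exists2 d, d \in s & forall a, colon d a -> colon c a.
  by exists d => //; case: (hs1 d ds) => nd mx; apply: mx => //; case: mc.
apply: contrapT => nex.
have [b [bs nb]] : exists b, (forall d, d \in s -> colon d b) /\ ~ colon c b.
  have : forall d, d \in s -> exists a, colon d a /\ ~ colon c a.
    move=> d ds; apply: contrapT => na; apply: nex; exists d => // a ha.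
    by apply: contrapT => nca; apply: na; exists a.
  elim: (s) => [|d s' IH] h; first by exists 1; split=> //; exact: max_colon1.
  have [|b [hb nb]] := IH; first by move=> b bs; apply: h; rewrite inE bs orbT.
  have [a [ha na]] := h d (mem_head _ _); exists (a * b); split; last first.
    by case/(max_colon_prime mc).
  move=> e; rewrite inE => /orP[/eqP->|/hb]; last exact: (idealM (colon_ideal _)).
  by rewrite mulrC; apply: (idealM (colon_ideal _)).
apply: nb; have := hs2 c (ideal_gen_sub mc).
have idb : is_ideal (colon b) := colon_ideal b.
rewrite /colon mulrC -/(colon b c).
by apply: ideal_gen_min => // d /bs; rewrite /colon mulrC.
Qed.

(** Avoidance without primality: if [z + y *+ n] lay in [J u] for two values of n, so would a
    positive multiple of y, hence y. Each ideal that omits y thus rules out at most one n. *)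
Lemma avoid_ideals (T : eqType) (J : T -> C -> Prop) (I : C -> Prop) (s : seq T) :
  nat_invertible C -> (forall t, is_ideal (J t)) -> is_ideal I ->
  (forall t, t \in s -> exists z, I z /\ ~ J t z) ->
  exists y, I y /\ forall t, t \in s -> ~ J t y.
Proof.
move=> ninv idJ idI; elim: s => [|t s IH] h.
  by exists 0; split=> //; exact: (ideal0 idI).
have [|y [Iy hy]] := IH; first by move=> b bs; apply: h; rewrite inE bs orbT.
have [z [Iz nz]] := h t (mem_head _ _).
have [Jy|nJy] := pselect (J t y); last first.
  by exists y; split=> // u; rewrite inE => /orP[/eqP->|/hy].
have ev u : ~ J u y -> exists M, forall n, (M <= n)%N -> ~ J u (z + y *+ n).
  move=> nu; have [[n0 hn0]|no] := pselect (exists n, J u (z + y *+ n)); last first.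
    by exists 0%N => n _ hn; apply: no; exists n.
  exists n0.+1 => n lt hn; apply: nu.
  have := idealB (idJ u) hn hn0.
  rewrite opprD addrACA subrr add0r -mulrnBr 1?ltnW //.
  have [d ->] : exists d, (n - n0)%N = d.+1 by exists (n - n0).-1; rewrite prednK // subn_gt0.
  by have [c ec] := ninv d; move=> /(idealM (idJ u) c); rewrite -mulr_natl mulrA ec mul1r.
have [M hM] : exists M, forall u, u \in s -> ~ J u (z + y *+ M).
  suff [M hM] : exists M, forall n, (M <= n)%N -> forall u, u \in s -> ~ J u (z + y *+ n).
    by exists M => u us; apply: hM.
  elim: (s) hy => [|u s' IHs] hy; first by exists 0%N.
  have [|M hM] := IHs; first by move=> b bs; apply: hy; rewrite inE bs orbT.
  have [M' hM'] := ev u (hy u (mem_head _ _)).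
  exists (M + M')%N => n le v; rewrite inE => /orP[/eqP->|vs].
    by apply: hM'; apply: leq_trans le; rewrite leq_addl.
  by apply: hM => //; apply: leq_trans le; rewrite leq_addr.
have JMn u w n : J u w -> J u (w *+ n).
  by rewrite -mulr_natl; exact: (idealM (idJ u)).
exists (z + y *+ M); split.
  by apply: (idealD idI) => //; rewrite -mulr_natl; apply: (idealM idI).
move=> u; rewrite inE => /orP[/eqP->|us]; last exact: hM.
by move=> /(idealB (idJ t)) /(_ (JMn t y M Jy)); rewrite addrK.
Qed.

(** Zero divisors modulo x fill finitely many ideals [colon c], and the hypothesis says that [I] is
    contained in none of them. *)
Lemma regular_mod_exists (I : C -> Prop) : nat_invertible C -> is_ideal I ->
  (forall c, (forall z, I z -> principal x (z * c)) -> principal x c) ->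
  exists y, I y /\ forall c, principal x (y * c) -> principal x c.
Proof.
move=> ninv idI hI; have [s [hs1 hs2]] := finite_max_colon.
have [|y [Iy hy]] := avoid_ideals ninv colon_ideal idI (s := s).
  move=> c /hs1 [nc _]; apply: contrapT => nex; apply: nc; apply: hI => z Iz.
  by apply: contrapT => nz; apply: nex; exists z.
exists y; split=> // c hc; apply: contrapT => nc.
have [d [md hd]] := max_colon_exists nc; have [e es he] := hs2 d md.
by apply: (hy e es); apply: he; apply: hd.
Qed.
End Annihilators.

(** * Coefficient change, substitution and units of bivariate polynomials *)

Section PolyMaps.
Variables (S T : comNzRingType) (g : {rmorphism S -> T}).

Definition pm (q : {poly {poly S}}) : {poly {poly T}} := map_poly (map_poly g) q.
Lemma pm_zmod : zmod_morphism pm. Proof. by move=> x y; rewrite /pm rmorphB. Qed.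
Lemma pm_monoid : monoid_morphism pm.
Proof. by split=> [|x y]; rewrite /pm ?rmorph1 ?rmorphM. Qed.
HB.instance Definition _ :=
  GRing.isZmodMorphism.Build {poly {poly S}} {poly {poly T}} pm pm_zmod.
HB.instance Definition _ :=
  GRing.isMonoidMorphism.Build {poly {poly S}} {poly {poly T}} pm pm_monoid.
Lemma pm_cst s : pm (cst s) = cst (g s). Proof. by rewrite /pm /cst /= map_polyC /= map_polyC. Qed.
Lemma pm_XX : pm XX = XX. Proof. by rewrite /pm /XX /= map_polyC /= map_polyX. Qed.
Lemma pm_YY : pm YY = YY. Proof. by rewrite /pm /YY /= map_polyX. Qed.
Lemma coef2_pm q i j : (pm q)`_i`_j = g q`_i`_j.
Proof. by rewrite /pm /= coef_map /= coef_map. Qed.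
Lemma pm_dX q : pm (dX q) = dX (pm q).
Proof. by apply/polyP => i; rewrite coef_dX /pm /= !coef_map /= deriv_map. Qed.
Lemma pm_dY q : pm (dY q) = dY (pm q).
Proof. by rewrite /pm /dY /= deriv_map. Qed.
Lemma pm_Jac p q : pm (Jac p q) = Jac (pm p) (pm q).
Proof. by rewrite /Jac rmorphB !rmorphM /= !pm_dX !pm_dY. Qed.

Variables (Q : comNzRingType) (h : {rmorphism S -> Q}) (a b : Q).
Let ev2m : {rmorphism {poly {poly S}} -> Q} :=
  horner_eval b \o map_poly (horner_eval a \o map_poly h).
Definition ev2 q := ev2m q.
Lemma ev2_zmod : zmod_morphism ev2. Proof. by move=> x y; rewrite /ev2 rmorphB. Qed.
Lemma ev2_monoid : monoid_morphism ev2.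
Proof. by split=> [|x y]; rewrite /ev2 ?rmorph1 ?rmorphM. Qed.
HB.instance Definition _ := GRing.isZmodMorphism.Build {poly {poly S}} Q ev2 ev2_zmod.
HB.instance Definition _ := GRing.isMonoidMorphism.Build {poly {poly S}} Q ev2 ev2_monoid.
Lemma ev2_cst s : ev2 (cst s) = h s.
Proof. by rewrite /ev2 /ev2m /cst /= map_polyC /= /horner_eval hornerC map_polyC hornerC. Qed.
Lemma ev2_XX : ev2 XX = a.
Proof. by rewrite /ev2 /ev2m /XX /= map_polyC /= /horner_eval hornerC map_polyX hornerX. Qed.
Lemma ev2_YY : ev2 YY = b.
Proof. by rewrite /ev2 /ev2m /YY /= map_polyX /horner_eval hornerX. Qed.
End PolyMaps.
Arguments pm {S T} g q : simpl never.
Arguments ev2 {S Q} h a b q : simpl never.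

Lemma poly2_eval (T : comNzRingType) (a b : {poly {poly T}}) :
  exists g : {rmorphism {poly {poly T}} -> {poly {poly T}}},
  [/\ forall t, g (cst t) = cst t, g XX = a & g YY = b].
Proof.
by exists (ev2 (@cst T) a b); split=> [t||]; [exact: ev2_cst|exact: ev2_XX|exact: ev2_YY].
Qed.

Lemma Jac_subst (T : comNzRingType) (g : {rmorphism {poly {poly T}} -> {poly {poly T}}}) :
  (forall t, g (cst t) = cst t) -> forall a b,
  Jac (g a) (g b) = g (Jac a b) * Jac (g XX) (g YY).
Proof.
move=> gc a b.
have XE q : dX (g q) = g (dX q) * dX (g XX) + g (dY q) * dX (g YY).
  apply: (@chain_rule T _ g (@dX T \o g)) => [p r|s] /=; first by rewrite rmorphM dXM.
  by rewrite gc dX_cst.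
have YE q : dY (g q) = g (dX q) * dY (g XX) + g (dY q) * dY (g YY).
  apply: (@chain_rule T _ g (@dY T \o g)) => [p r|s] /=; first by rewrite rmorphM dYM.
  by rewrite gc dY_cst.
have -> : g (Jac a b) = g (dX a) * g (dY b) - g (dY a) * g (dX b).
  exact: etrans (rmorphB g _ _) (congr2 (fun x y => x - y) (rmorphM g _ _) (rmorphM g _ _)).
rewrite /Jac (XE a) (XE b) (YE a) (YE b).
move: (g (dX a)) (g (dX b)) (g (dY a)) (g (dY b)) (dX (g XX)) (dX (g YY)) (dY (g XX)) (dY (g YY)).
move=> *; ring.
Qed.

Lemma cst_inj (S : comNzRingType) : injective (@cst S).
Proof. by move=> s t /polyC_inj/polyC_inj. Qed.

Lemma reduced_poly (S : comNzRingType) : reduced_ring S -> reduced_ring {poly S}.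
Proof.
move=> redS p pp; apply/polyP => i; rewrite coef0; apply: contrapT => npi.
have [|||Om [g [g1 _ _]]] := @minimal_prime_field S (fun u => exists n, u = p`_i ^+ n) redS.
- by exists 0%N.
- by move=> _ _ [n1 ->] [n2 ->]; exists (n1 + n2)%N; rewrite exprD.
- by case=> n /esym/(reduced_expr redS).
have gpi : g p`_i != 0 by apply: g1; exists 1%N.
have /eqP : map_poly g p * map_poly g p = 0 by rewrite -rmorphM pp rmorph0.
rewrite mulf_eq0 orbb => /eqP /(congr1 (fun q : {poly Om} => q`_i)) /eqP.
by rewrite coef_map coef0 (negPf gpi).
Qed.

(** A nonzero coefficient in positive degree would survive in some field, over which units of the
    polynomial ring are constants. *)
Lemma reduced_poly_unit (S : comNzRingType) (p q : {poly S}) : reduced_ring S ->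
  p * q = 1 -> p = (p`_0)%:P.
Proof.
move=> redS pq; apply/polyP => -[|i]; rewrite coefC //=; apply: contrapT => npi.
have [|||Om [g [g1 _ _]]] := @minimal_prime_field S (fun u => exists n, u = p`_i.+1 ^+ n) redS.
- by exists 0%N.
- by move=> _ _ [n1 ->] [n2 ->]; exists (n1 + n2)%N; rewrite exprD.
- by case=> n /esym/(reduced_expr redS).
have gpi : g p`_i.+1 != 0 by apply: g1; exists 1%N.
have e : map_poly g p * map_poly g q = 1 by rewrite -rmorphM pq rmorph1.
have /size_poly1P[c _ ec] : size (map_poly g p) == 1%N.
  have : map_poly g p \is a GRing.unit by apply/unitrP; exists (map_poly g q); rewrite mulrC e.
  by rewrite poly_unitE => /andP[].
by move: gpi; rewrite -coef_map ec coefC eqxx.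
Qed.

Lemma reduced_poly2_unit (S : comNzRingType) (p q : {poly {poly S}}) : reduced_ring S ->
  p * q = 1 -> exists s, p = cst s.
Proof.
move=> redS pq; have e := reduced_poly_unit (reduced_poly redS) pq.
have e2 : p`_0 * q`_0 = 1.
  by have := congr1 (fun r : {poly {poly S}} => r`_0) pq; rewrite coef0M coefC.
by exists p`_0`_0; rewrite {1}e {1}(reduced_poly_unit redS e2).
Qed.

(** * Invertible modules and symmetric algebras *)

Lemma inj_surj_bijective (T U : Type) (f : T -> U) :
  injective f -> (forall y, exists x, f x = y) -> bijective f.
Proof.
move=> injf surjf; pose g y := projT1 (cid (surjf y)).
have fg : cancel g f by move=> y; exact: projT2 (cid (surjf y)).
by exists g => // x; apply: injf; rewrite fg.
Qed.

Section Submodule.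
Variables (R : comNzRingType) (V : lmodType R) (M : {pred V}).

(** The closure proof is carried as a phantom argument, so that the module structure can be attached
    to a set whose closure is only a hypothesis. *)
Definition submodule_pred of GRing.submod_closed M : {pred V} := M.

Variable clM : GRing.submod_closed M.

Record submodule := Submodule { submodule_val :> V; _ : submodule_val \in submodule_pred clM }.
HB.instance Definition _ := [isSub for submodule_val].
HB.instance Definition _ := [Choice of submodule by <:].
HB.instance Definition _ :=
  GRing.SubChoice_isSubLmodule.Build R V (submodule_pred clM) submodule clM.
End Submodule.

Lemma loc_map_linear (R : comNzRingType) (p : prime_idealr R) (M N : lmodType R)
    (f : {linear M -> N}) :
  exists h : {linear loc p M -> loc p N}, forall x, h x = loc_map f x.
Proof.
pose h := loc_map (p := p) f.
have hE m s : h (frac m s) = frac (f m) s by exact: loc_mapE.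
have hD : {morph h : x y / x + y}.
  elim/frac_ind => m r; elim/frac_ind => m' r'.
  by rewrite fracD !hE fracD linearD !linearZ.
have hzm : zmod_morphism h.
  by move=> x y; apply: (addIr (h y)); rewrite -hD !subrK.
have hZ : scalable h.
  elim/(@frac_ind _ p) => a s; elim/frac_ind => m r.
  rewrite -[frac a s *: _]/(loc_scale _ _) loc_scaleE !hE.
  by rewrite -[frac a s *: _]/(loc_scale _ _) loc_scaleE linearZ.
pose hL : {linear loc p M -> loc p N} := HB.pack h
  (GRing.isZmodMorphism.Build (loc p M) (loc p N) h hzm)
  (GRing.isScalable.Build _ _ _ _ h hZ).
by exists hL.
Qed.

Section DualBasis.
Variables (R : idomainType) (N : lmodType R) (n : nat) (e : 'I_n -> N).
Variable th : 'I_n -> {linear N -> R^o}.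
Hypothesis dual : forall x, x = \sum_i (th i x : R) *: e i.

Lemma dual_basis_projective : projective N.
Proof.
move=> L M g f surj.
pose y i := projT1 (cid (surj (f (e i)))).
have yE i : g (y i) = f (e i) := projT2 (cid (surj (f (e i)))).
pose h x := \sum_i (th i x : R) *: y i.
have hl : linear h.
  move=> a u w; rewrite /h scaler_sumr -big_split; apply: eq_bigr => i _ /=.
  by rewrite linearP scalerDl scalerA.
pose hL : {linear N -> L} := HB.pack h (GRing.isLinear.Build _ _ _ _ h hl).
exists hL => x; rewrite {2}(dual x) /= /h !linear_sum; apply: eq_bigr => i _.
by rewrite !(linearZZ g) !(linearZZ f) yE.
Qed.

Hypothesis prop : forall i x y, (th i x : R) *: y = (th i y : R) *: x.
Hypothesis th1 : \sum_i (th i (e i) : R) = 1.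

(** The [th i (e i)] sum to 1, so one of them lies outside p; after localization that [th i] is
    bijective, with inverse r |-> (r / th_i(e_i)) e_i. *)
Lemma dual_basis_rank_one : rank_one N.
Proof.
move=> p.
have [i hi] : exists i, (th i (e i) : R) \notin p.
  apply: contrapT => nex; have := idealr1 p; rewrite -th1 rpred_sum // => i _.
  by apply: contrapT => /negP h; apply: nex; exists i.
pose t := Denom hi.
have [h hE] := loc_map_linear p (th i).
exists h; apply: inj_surj_bijective.
  move=> x y; rewrite !hE; elim/frac_ind: x => x r; elim/frac_ind: y => y s.
  rewrite !loc_mapE => /fracP[u hu]; apply/fracP; exists (denomM u t).
  have key : th i (dval u *: (dval s *: x)) = th i (dval u *: (dval r *: y)).
    by rewrite !linearZ.
  have tors w z : th i w = th i z -> (th i (e i) : R) *: w = (th i (e i) : R) *: z.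
    by move=> E; rewrite (prop i (e i) w) (prop i (e i) z) E.
  by rewrite /= mulrC -!scalerA; exact: tors.
elim/frac_ind => r s; exists (frac ((r : R) *: e i) (denomM t s)).
rewrite hE loc_mapE; apply/fracP; exists (denom1 p).
have E : th i ((r : R) *: e i) = (r : R) * th i (e i) :> R := linearZZ (th i) _ _.
by rewrite E /GRing.scale /= !mul1r; ring.
Qed.
End DualBasis.

Section SymTools.
Variables (R : comNzRingType) (N : lmodType R).

Lemma sym_ind (Q : Sym N -> Prop) :
  (forall x y, Q x -> Q y -> Q (x + y)) -> (forall x y, Q x -> Q y -> Q (x * y)) ->
  (forall a, Q (sym_cst N a)) -> (forall x, Q (sym_in x)) -> forall x, Q x.
Proof.
move=> QD QM QC QX x; rewrite -[x]reprK; move: (repr x) => {x}.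
elim/malg_gen_ind => [x y hx hy|x y hx hy|a|x]; last 2 first.
- exact: QC.
- exact: QX.
- have -> : \pi_(Sym N) (x + y) = \pi_(Sym N) x + \pi_(Sym N) y by rewrite !piE.
  exact: QD.
- have -> : \pi_(Sym N) (x * y) = \pi_(Sym N) x * \pi_(Sym N) y by rewrite !piE.
  exact: QM.
Qed.

Lemma sym_inD (x y : N) : sym_in (x + y) = sym_in x + sym_in y.
Proof.
have -> : sym_in x + sym_in y = \pi_(Sym N) (mvar R x + mvar R y) by rewrite /sym_in !piE.
apply/eqP; rewrite -Quotient.idealrBE; apply/asboolP.
exact: ideal_gen_sub (SymRelD _ _).
Qed.

Lemma sym_inZ (a : R) (x : N) : sym_in (a *: x) = sym_cst N a * sym_in x.
Proof.
have -> : sym_cst N a * sym_in x = \pi_(Sym N) (malgC a * mvar R x).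
  by rewrite /sym_in /sym_cst !piE.
apply/eqP; rewrite -Quotient.idealrBE; apply/asboolP.
exact: ideal_gen_sub (SymRelZ _ _).
Qed.

Lemma sym_lift (A : comAlgType R) (h : {linear N -> A}) :
  exists g : {lrmorphism Sym N -> A}, forall x, g (sym_in x) = h x.
Proof.
pose F : {rmorphism {malg R[{cmonom N}]} -> A} := mmap (in_alg A) (cmonom_eval h).
have FX x : F (mvar R x) = h x by exact: mmap_mvar.
have FC a : F (malgC a) = a%:A by exact: mmapC.
have kill y : sym_ideal y -> F y = 0.
  clearbody F; move=> /asboolP H; apply: (H _ (ker_is_ideal F)) => _ [x z|a x].
  - apply: ker_subD.
    apply: etrans (FX _) (etrans _ (esym (congr2 +%R (FX x) (FX z)))).
    exact: linearD.
  - apply: ker_subM.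
    apply: etrans (FX _) (etrans _ (esym (congr2 *%R (FC a) (FX x)))).
    by rewrite linearZ /= -scalerAl mul1r.
pose G (x : Sym N) := F (repr x).
have Gpi x : G (\pi_(Sym N) x) = F x.
  apply: (rmorph_eq_of_sub (F := F)); apply: kill.
  by rewrite -[sym_ideal _]/(_ \in sym_ideal (N:=N)) Quotient.idealrBE reprK.
have Gz : zmod_morphism G.
  move=> x y; rewrite -[x]reprK -[y]reprK.
  have -> : \pi_(Sym N) (repr x) - \pi_(Sym N) (repr y) = \pi_(Sym N) (repr x - repr y).
    by rewrite !piE.
  by rewrite !Gpi rmorphB.
have Gm : monoid_morphism G.
  split=> [|x y].
    have -> : 1 = \pi_(Sym N) 1 by rewrite !piE.
    by rewrite Gpi rmorph1.
  rewrite -[x]reprK -[y]reprK.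
  have -> : \pi_(Sym N) (repr x) * \pi_(Sym N) (repr y) = \pi_(Sym N) (repr x * repr y).
    by rewrite !piE.
  by rewrite !Gpi rmorphM.
have Gs : scalable G.
  move=> a x; have -> : a *: x = sym_cst N a * x by [].
  rewrite Gm.2; have -> : G (sym_cst N a) = a%:A by rewrite -FC -Gpi.
  by rewrite -scalerAl mul1r.
pose g : {lrmorphism Sym N -> A} := HB.pack G (GRing.isZmodMorphism.Build (Sym N) A G Gz)
  (GRing.isMonoidMorphism.Build (Sym N) A G Gm) (GRing.isScalable.Build _ _ _ _ G Gs).
exists g => x; rewrite -FX -Gpi; exact: erefl.
Qed.
End SymTools.

Lemma lrmorphism_inv (R : comNzRingType) (A C : comAlgType R) (g : {lrmorphism A -> C}) :
  bijective g -> exists f : {lrmorphism C -> A}, bijective f.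
Proof.
case=> f gK fK.
have fz : zmod_morphism f by move=> x y; apply: (can_inj gK); rewrite rmorphB /= !fK.
have fm : monoid_morphism f.
  by split=> [|x y]; apply: (can_inj gK); rewrite ?rmorph1 ?rmorphM /= !fK.
have fs : scalable f by move=> a x; apply: (can_inj gK); rewrite linearZ /= !fK.
pose fL : {lrmorphism C -> A} := HB.pack f (GRing.isZmodMorphism.Build C A f fz)
  (GRing.isMonoidMorphism.Build C A f fm) (GRing.isScalable.Build _ _ _ _ f fs).
by exists fL; exists g.
Qed.

Lemma radical_one (A : comNzRingType) (J : A -> Prop) n (u : 'I_n -> A) : is_ideal J ->
  (forall i, exists m, J (u i ^+ m)) -> \sum_i u i = 1 -> J 1.
Proof.
move=> idJ hu e.
have radD x y : (exists m, J (x ^+ m)) -> (exists m, J (y ^+ m)) -> exists m, J ((x + y) ^+ m).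
  move=> [a ha] [b hb]; exists (a + b)%N; rewrite exprDn; apply: ideal_sum => // i _.
  rewrite -mulr_natl; apply: (idealM idJ).
  have [le|lt] := leqP b i.
    by rewrite -(subnK le) exprD mulrA; apply: (idealM idJ).
  have le : (a <= a + b - i)%N by rewrite -addnBA ?leq_addr // ltnW.
  by rewrite -(subnK le) exprD -mulrA [x ^+ a * _]mulrC mulrA; apply: (idealM idJ).
have [m] : exists m, J ((\sum_i u i) ^+ m).
  elim/big_ind: _ => //; exists 1%N; rewrite expr1; exact: (ideal0 idJ).
by rewrite e expr1n.
Qed.

Section SymIso.
Variables (R : comNzRingType) (N : lmodType R) (C A : comAlgType R).
Variables (s : {linear N -> C}) (h : {linear N -> A}) (g : {lrmorphism C -> A}).
Hypothesis gE : forall x, g (s x) = h x.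
Variables (n : nat) (e : 'I_n -> N) (th : 'I_n -> {linear N -> R^o}).
Hypothesis prop : forall i x, (th i x : R) *: e i = (th i (e i) : R) *: x.
Hypothesis th1 : \sum_i (th i (e i) : R) = 1.
Hypothesis trans : forall i (Q : {poly R}), horner_alg (h (e i)) Q = 0 ->
  Q = 0 \/ (th i (e i) : R) = 0.
Hypothesis genC : forall (Q : C -> Prop), (forall x y, Q x -> Q y -> Q (x + y)) ->
  (forall x y, Q x -> Q y -> Q (x * y)) -> (forall a, Q a%:A) -> (forall x, Q (s x)) ->
  forall x, Q x.
Hypothesis genA : forall (Q : A -> Prop), (forall x y, Q x -> Q y -> Q (x + y)) ->
  (forall x y, Q x -> Q y -> Q (x * y)) -> (forall a, Q a%:A) -> (forall x, Q (h x)) ->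
  forall x, Q x.

(** Meant for C = Sym N. Where [th i (e i)] is inverted, [e i] generates N, so a power of it moves z
    into the polynomials in [s (e i)], and on these [trans] controls the kernel of [g]. The
    [th i (e i)] sum to 1, so the local statements force z = 0. *)
Lemma generated_bijective : bijective g.
Proof.
apply: inj_surj_bijective; last first.
  elim/genA => [x y [x' <-] [y' <-]|x y [x' <-] [y' <-]|a|x].
  - by exists (x' + y'); rewrite rmorphD.
  - by exists (x' * y'); rewrite rmorphM.
  - by exists a%:A; rewrite linearZ /= rmorph1.
  - by exists (s x).
have local i z : exists m (Q : {poly R}), (th i (e i) : R) ^+ m *: z = horner_alg (s (e i)) Q.
  set u : R := th i (e i); elim/genC: z => [x y|x y|a|x].
  - move=> [m [Q eQ]] [m' [Q' eQ']]; exists (m + m')%N, (u ^+ m' *: Q + u ^+ m *: Q').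
    rewrite rmorphD /= !linearZ /= -!scalerAl !mul1r -eQ -eQ' !scalerA scalerDr -!exprD.
    by rewrite [(m' + m)%N]addnC.
  - move=> [m [Q eQ]] [m' [Q' eQ']]; exists (m + m')%N, (Q * Q').
    by rewrite rmorphM /= -eQ -eQ' -scalerAl -scalerAr scalerA exprD.
  - by exists 0%N, a%:P; rewrite expr0 scale1r horner_algC.
  - exists 1%N, ((th i x : R) *: 'X).
    by rewrite expr1 linearZ /= horner_algX -scalerAl mul1r -!linearZ prop.
suff inj0 z : g z = 0 -> z = 0.
  by move=> x y exy; apply/eqP; rewrite -subr_eq0; apply/eqP/inj0; rewrite rmorphB /= exy subrr.
move=> gz; rewrite -[z]scale1r.
have idJ : is_ideal (fun r : R => r *: z = 0).
  split=> [|a b ha hb|a b hb]; first exact: scale0r.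
    by rewrite scalerDl ha hb addr0.
  by rewrite -scalerA hb scaler0.
apply: (radical_one idJ _ th1) => i; have [m [Q eQ]] := local i z.
have gH (q : {poly R}) : g (horner_alg (s (e i)) q) = horner_alg (h (e i)) q.
  elim/poly_ind: q => [|q c IH]; first by rewrite !rmorph0.
  rewrite !rmorphD !rmorphM /= IH !horner_algX !horner_algC gE.
  by rewrite linearZ /= rmorph1.
have [|Q0|u0] := @trans i Q.
- by rewrite -gH -eQ linearZ /= gz scaler0.
- by exists m; rewrite eQ Q0 rmorph0.
- by exists 1%N; rewrite u0 expr1 scale0r.
Qed.
End SymIso.

(** * Localizations: irreducibility and generators at a prime *)

Section Irreducible.
Variables (R : comNzRingType) (B : comAlgType R) (D : derivation B) (p : prime_idealr R).

(** If b divides the image of the localized derivation, then x0 = b c1 and y0 = b c2 locally, so y0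
    c1 = x0 c2. Regularity gives c1 = x0 w, and cancelling x0 in x0 = b x0 w makes b a unit. *)
Lemma loc_der_irreducible (x0 y0 : B) : der_ideal D x0 -> der_ideal D y0 ->
  (forall b, x0 * b = 0 -> b = 0) ->
  (forall b, principal x0 (y0 * b) -> principal x0 b) -> irreducible_der (loc_der D p).
Proof.
move=> Ix Iy regx regy [b [nb hb]].
have mem z : der_ideal D z -> exists c, frac z (denom1 p) = b * c.
  apply: (ideal_gen_min (I := fun z => exists c, frac z (denom1 p) = b * c)).
    split.
    - by exists 0; rewrite mulr0; apply/fracP; exists (denom1 p); rewrite /= !scale1r.
    - by move=> z1 z2 [c ec] [d ed]; exists (c + d); rewrite mulrDr -ec -ed fracDs.
    - move=> a z1 [c ec]; exists (frac a (denom1 p) * c); rewrite mulrCA -ec.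
      rewrite (fracM a z1); apply/fracP; exists (denom1 p) => /=.
      by rewrite mulr1.
  by move=> _ [a ->]; have [c ec] := hb (frac a (denom1 p)); exists c; rewrite -ec loc_derE.
have [c1 e1] := mem _ Ix; have [c2 e2] := mem _ Iy.
have : frac y0 (denom1 p) * c1 = frac x0 (denom1 p) * c2.
  by rewrite e1 e2 mulrAC.
elim/frac_ind: c1 e1 => m1 s1 e1; elim/frac_ind: c2 e2 => m2 s2 e2.
rewrite (fracM y0 m1) (fracM x0 m2) => /fracP[u].
rewrite /= !mul1r !scalerA => hu.
have [|d ed] := regy ((dval u * dval s2) *: m1).
  by exists ((dval u * dval s1) *: m2); rewrite -!scalerAr -hu.
have ec1 : frac m1 s1 = frac x0 (denom1 p) * frac d (denomM (denomM u s2) s1).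
  rewrite (fracM x0 d) -ed; apply/fracP; exists (denom1 p) => /=.
  by rewrite !scale1r mul1r !scalerA; congr (_ *: _); ring.
set w := frac d _ in ec1.
have e3 : frac x0 (denom1 p) * (b * w) = frac x0 (denom1 p).
  by rewrite {2}e1 ec1 mulrCA.
apply: nb; exists w; clearbody w; elim/frac_ind: (b * w) e3 => z s.
rewrite (fracM x0 z) => /fracP[v]; rewrite /= !mul1r scale1r => hv.
have /regx h0 : x0 * (dval v *: z - (dval v * dval s) *: 1) = 0.
  by rewrite mulrBr -!scalerAr mulr1 hv scalerA subrr.
apply/fracP; exists v; rewrite /= scale1r scalerA.
by apply/eqP; rewrite -subr_eq0 h0.
Qed.
End Irreducible.

Lemma rank_one_local (R : comNzRingType) (N : lmodType R) (p : prime_idealr R) : rank_one N ->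
  exists n0 : N, forall x, exists (t r : R), t \notin p /\ t *: x = r *: n0.
Proof.
move=> /(_ p) [h [g hK gK]].
pose y := g (frac (1 : R^o) (denom1 p)).
have hy : h y = frac (1 : R^o) (denom1 p) by exact: gK.
clearbody y; elim/frac_ind: y hy => n0 s0 hy; exists n0 => x.
have [r [t ert]] : exists r t, h (frac x (denom1 p)) = frac (r : R^o) t.
  by elim/frac_ind: (h _) => r t; exists r, t.
have e : frac x (denom1 p) = loc_scale (frac (r : R^o) t) (frac n0 s0).
  apply: (can_inj hK); rewrite ert -[loc_scale _ _]/(_ *: _).
  apply: esym; apply: etrans (linearZZ h _ _) _; rewrite hy.
  rewrite -[_ *: _]/(loc_scale _ _) loc_scaleE; apply/fracP; exists (denom1 p) => /=.
  by rewrite /GRing.scale /= !mul1r !mulr1 mulrC.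
move: e; rewrite loc_scaleE => /fracP[u]; rewrite /= !scalerA mulr1 => hu.
exists (dval u * (dval t * dval s0)), (dval u * r); split.
  exact: (dvalP (denomM u (denomM t s0))).
by rewrite hu.
Qed.

(** * Polynomials in F and the centralizer of F *)

Section HornerCst.
Variable S : comNzRingType.
Local Notation P := {poly {poly S}}.

Definition evF (G : P) (Q : {poly S}) : P := (map_poly (@cst S) Q).[G].
Lemma evFD G Q1 Q2 : evF G (Q1 + Q2) = evF G Q1 + evF G Q2.
Proof. by rewrite /evF rmorphD hornerD. Qed.
Lemma evFB G Q1 Q2 : evF G (Q1 - Q2) = evF G Q1 - evF G Q2.
Proof. by rewrite /evF rmorphB hornerD hornerN. Qed.
Lemma evFM G Q1 Q2 : evF G (Q1 * Q2) = evF G Q1 * evF G Q2.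
Proof. by rewrite /evF rmorphM hornerM. Qed.
Lemma evFC G c : evF G c%:P = cst c.
Proof. by rewrite /evF map_polyC /= hornerC. Qed.
Lemma evFX G : evF G 'X = G.
Proof. by rewrite /evF map_polyX hornerX. Qed.
Lemma evF_scale G c Q : evF G (c *: Q) = cst c * evF G Q.
Proof. by rewrite -mul_polyC evFM evFC. Qed.

Lemma evF_der (d : {additive P -> P}) G Q :
  (forall a b, d (a * b) = d a * b + a * d b) -> (forall s, d (cst s) = 0) ->
  d (evF G Q) = evF G Q^`() * d G.
Proof.
move=> dM dc; elim/poly_ind: Q => [|Q c IH].
  by rewrite deriv0 -[0 : {poly S}](rmorph0 (@polyC S)) evFC dc (rmorph0 (@cst S)) mul0r.
rewrite derivD derivM derivX derivC addr0 mulr1 !evFD !evFM evFX evFC raddfD /= dM dc IH; ring.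
Qed.
Lemma dX_evF G Q : dX (evF G Q) = evF G Q^`() * dX G.
Proof. by apply: evF_der; [exact: dXM | exact: dX_cst]. Qed.
Lemma dY_evF G Q : dY (evF G Q) = evF G Q^`() * dY G.
Proof. by apply: evF_der; [exact: dYM | exact: dY_cst]. Qed.
End HornerCst.

Lemma kill_seq (S : comNzRingType) (Om : fieldType) (g : {rmorphism S -> Om}) (ts : seq S) :
  (forall t, g t = 0 -> exists e, g e != 0 /\ e * t = 0) ->
  (forall t, t \in ts -> g t = 0) ->
  exists e, g e != 0 /\ forall t, t \in ts -> e * t = 0.
Proof.
move=> kill; elim: ts => [|t ts IH] h; first by exists 1; rewrite rmorph1 oner_neq0.
have [|e [ge he]] := IH; first by move=> b bs; apply: h; rewrite inE bs orbT.
have [e' [ge' he']] := kill t (h t (mem_head _ _)).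
exists (e * e'); split; first by rewrite rmorphM mulf_neq0.
move=> b; rewrite inE => /orP[/eqP->|/he eb]; first by rewrite -mulrA he' mulr0.
by rewrite mulrAC eb mul0r.
Qed.

(** The way back from Om to S: a polynomial has finitely many coefficients, so a product of
    annihilators outside the kernel of [g] handles all of them. *)
Lemma kill_poly2 (S : comNzRingType) (Om : fieldType) (g : {rmorphism S -> Om})
    (q : {poly {poly S}}) :
  (forall t, g t = 0 -> exists e, g e != 0 /\ e * t = 0) ->
  pm g q = 0 -> exists e, g e != 0 /\ cst e * q = 0.
Proof.
move=> kill q0; have g0 i m : g q`_i`_m = 0 by rewrite -coef2_pm q0 !coef0.
have [|e [ge he]] := @kill_seq _ _ g (flatten [seq (c : {poly S}) : seq S | c <- (q : seq {poly S})]) kill.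
  move=> t /flattenP[_ /mapP[c cq ->] tc].
  have /(nthP 0)[m _ <-] := tc; have /(nthP 0)[i _ <-] := cq; exact: g0.
exists e; split=> //; apply/polyP => i; apply/polyP => m; rewrite !coefCM !coef0.
have [lti|le] := ltnP i (size q); last by rewrite [q`_i]nth_default // coef0 mulr0.
have [ltm|le] := ltnP m (size q`_i); last by rewrite [q`_i`_m]nth_default // mulr0.
apply: he; apply/flattenP; exists (q`_i : seq S); last exact: mem_nth.
by apply: map_f; exact: mem_nth.
Qed.

Lemma kill_exists (S : comNzRingType) (s : S) : reduced_ring S -> s <> 0 ->
  exists (Om : fieldType) (g : {rmorphism S -> Om}), g s != 0 /\
  forall t, g t = 0 -> exists e, g e != 0 /\ e * t = 0.
Proof.
move=> redS ns.
have [|||Om [g [g1 g2 _]]] := @minimal_prime_field S (fun u => exists n, u = s ^+ n) redS.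
- by exists 0%N.
- by move=> _ _ [n1 ->] [n2 ->]; exists (n1 + n2)%N; rewrite exprD.
- by case=> n /esym/(reduced_expr redS).
by exists Om, g; split=> //; apply: g1; exists 1%N.
Qed.

(* The centralizer of F for the Jacobian bracket is S[F], when the gradient of F
   generates an ideal containing a regular sequence x, y. *)
Section Centralizer.
Variables (S : comNzRingType) (F x y al be ga de : {poly {poly S}}).
Hypothesis redS : reduced_ring S.
Hypothesis natS : nat_invertible S.
Hypothesis ex : x = al * dX F + be * dY F.
Hypothesis ey : y = ga * dX F + de * dY F.
Hypothesis regx : forall z, x * z = 0 -> z = 0.
Hypothesis regy : forall z w, y * z = x * w -> exists d, z = x * d.

Lemma grad_cancel z : z * dX F = 0 -> z * dY F = 0 -> z = 0.
Proof.
move=> zX zY; apply: regx; rewrite ex.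
have -> : (al * dX F + be * dY F) * z = al * (z * dX F) + be * (z * dY F) by ring.
by rewrite zX zY !mulr0 addr0.
Qed.

(** The gradients of F and g are proportional, so pairing that of g with the combinations defining x
    and y gives [y * z = x * w]. Regularity yields [z = x * h], and [h] is the factor of
    proportionality. Equality of mixed derivatives gives [Jac F h = 0]. *)
Lemma centralizer_grad g : Jac F g = 0 -> exists h,
  [/\ dX g = h * dX F, dY g = h * dY F & Jac F h = 0].
Proof.
move=> J0; have e : dX F * dY g = dY F * dX g by apply/eqP; rewrite -subr_eq0 -/(Jac F g) J0.
have [|h eh] := regy (z := al * dX g + be * dY g) (w := ga * dX g + de * dY g).
  rewrite ex ey; apply/eqP; rewrite -subr_eq0; apply/eqP.
  transitivity ((al * de - ga * be) * (dY F * dX g - dX F * dY g)); first by ring.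
  by rewrite e subrr mulr0.
have hX : dX g = h * dX F.
  apply/eqP; rewrite eq_sym -subr_eq0; apply/eqP/regx.
  rewrite mulrBr mulrA -eh ex.
  transitivity (be * (dX F * dY g - dY F * dX g)); first by ring.
  by rewrite e subrr mulr0.
have hY : dY g = h * dY F.
  apply/eqP; rewrite eq_sym -subr_eq0; apply/eqP/regx.
  rewrite mulrBr mulrA -eh ex.
  transitivity (al * (dY F * dX g - dX F * dY g)); first by ring.
  by rewrite e subrr mulr0.
exists h; split=> //; have := dXdY g; rewrite hX hY dXM dYM dXdY => /addIr e2.
by rewrite /Jac mulrC -e2 mulrC subrr.
Qed.

Lemma nonconstant_field (Om : fieldType) (g : {rmorphism S -> Om}) :
  (forall t, g t = 0 -> exists e, g e != 0 /\ e * t = 0) ->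
  dY (pm g F) = 0 -> dX (pm g F) != 0.
Proof.
move=> kill; rewrite -pm_dY -pm_dX => Y0; apply/eqP => X0.
have x0 : pm g x = 0 by rewrite ex rmorphD !rmorphM /= X0 Y0 !mulr0 addr0.
have [e [ge he]] := kill_poly2 kill x0.
have : cst e = 0 by apply: regx; rewrite mulrC.
by rewrite -(rmorph0 (@cst S)) => /cst_inj e0; rewrite e0 rmorph0 eqxx in ge.
Qed.

Lemma centralizer g : Jac F g = 0 -> exists Q, g = evF F Q.
Proof.
(* S not being a domain, the degree is bounded at all localizations at once: the degree in Y where F
   involves Y, and otherwise the degree in X of the constant coefficient, since g does not involve Y
   there. The factor [h] with dg = h dF has smaller degree. *)
suff main N : forall g, Jac F g = 0 ->
    (forall (Om : fieldType) (r : {rmorphism S -> Om}),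
      (forall t, r t = 0 -> exists e, r e != 0 /\ e * t = 0) ->
      (dY (pm r F) != 0 -> (size (pm r g) <= N)%N) /\
      (dY (pm r F) = 0 -> (size ((pm r g)`_0)%R <= N)%N)) -> exists Q, g = evF F Q.
  move=> J0; apply: (main (size g + size (g`_0)%R)%N g J0) => Om r _; split=> _.
    by apply: leq_trans (size_poly _ _) _; rewrite leq_addr.
  by rewrite /pm /= coef_map; apply: leq_trans (size_poly _ _) _; rewrite leq_addl.
elim: N => [|N IH] {}g J0 hb.
  exists 0; rewrite -[0 : {poly S}](rmorph0 (@polyC S)) evFC (rmorph0 (@cst S)).
  have [h [hX hY _]] := centralizer_grad J0.
  apply/polyP => i; apply/polyP => m; rewrite !coef0; apply: contrapT => ns.
  have [Om [r [rs kill]]] := kill_exists redS ns; have [b1 b2] := hb Om r kill.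
  suff z : pm r g = 0 by move: rs; rewrite -coef2_pm z !coef0 eqxx.
  have [Y0|Y0] := eqVneq (dY (pm r F)) 0; last first.
    by apply/eqP; rewrite -size_poly_eq0 -leqn0 b1.
  have nO : nat_invertible Om := nat_invertible_rmorph r natS.
  have e : dY (pm r g) = 0 by rewrite -pm_dY hY rmorphM /= pm_dY Y0 mulr0.
  rewrite (deriv_eq0 (natinv_poly nO) e).
  by have := b2 Y0; rewrite leqn0 size_poly_eq0 => /eqP ->.
have [h [hX hY hJ]] := centralizer_grad J0.
have [|Q eQ] := IH h hJ.
  move=> Om r kill; have [b1 b2] := hb Om r kill.
  have nO : nat_invertible Om := nat_invertible_rmorph r natS.
  split=> Y0.
    have [->|h0] := eqVneq (pm r h) 0; first by rewrite size_poly0.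
    have e : dY (pm r g) = pm r h * dY (pm r F) by rewrite -!pm_dY hY rmorphM.
    have sF : (0 < size (dY (pm r F)))%N by rewrite size_poly_gt0.
    have g0 : pm r g != 0.
      by apply: contraNneq h0 => z; move: e; rewrite z raddf0 => /esym/eqP; rewrite mulf_eq0 (negPf Y0) orbF.
    have := lt_size_deriv g0; rewrite -/(dY (pm r g)) e size_mul // => lt.
    have := leq_trans lt (b1 Y0); rewrite -(prednK sF) addnS /= => /(leq_trans _) H.
    by rewrite -ltnS; apply: H; rewrite ltnS leq_addr.
  have X0 := nonconstant_field kill Y0.
  have F0 := deriv_eq0 (natinv_poly nO) Y0.
  have F0' : ((pm r F)`_0)^`() != 0.
    by apply: contraNneq X0 => z; rewrite F0 dX_polyC z.
  have e : ((pm r g)`_0)^`() = (pm r h)`_0 * ((pm r F)`_0)^`().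
    by rewrite -!coef_dX -!pm_dX hX rmorphM /= coef0M.
  have [->|h0] := eqVneq (pm r h)`_0 0; first by rewrite size_poly0.
  have sF : (0 < size ((pm r F)`_0)^`())%N by rewrite size_poly_gt0.
  have g0 : (pm r g)`_0 != 0.
    by apply: contraNneq h0 => z; move: e; rewrite z deriv0 => /esym/eqP; rewrite mulf_eq0 (negPf F0') orbF.
  have := lt_size_deriv g0; rewrite e size_mul // => lt.
  have := leq_trans lt (b2 Y0); rewrite -(prednK sF) addnS /= => /(leq_trans _) H.
  by rewrite -ltnS; apply: H; rewrite ltnS leq_addr.
(* Now dg = Q(F) dF, so subtracting [Q1(F)] for an antiderivative [Q1] of [Q] leaves a constant. *)
have [Q1 eQ1] := deriv_surj Q natS.
have ec : g - evF F Q1 = cst (g - evF F Q1)`_0`_0.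
  apply: (poly2_closed_const natS).
    by rewrite raddfB /= dX_evF eQ1 -eQ hX subrr.
  by rewrite raddfB /= dY_evF eQ1 -eQ hY subrr.
exists (Q1 + ((g - evF F Q1)`_0`_0)%:P).
by rewrite evFD evFC -ec addrC subrK.
Qed.

Lemma evF_inj0 Q : evF F Q = 0 -> Q = 0.
Proof.
have [n] := ubnP (size Q); elim: n Q => // n IH Q; rewrite ltnS => le e.
have [->//|Q0] := eqVneq Q 0.
have Q'0 : Q^`() = 0.
  apply: IH; first by apply: leq_trans le; exact: lt_size_deriv.
  by apply: grad_cancel; rewrite -?dX_evF -?dY_evF e raddf0.
move: e; rewrite (deriv_eq0 natS Q'0) evFC -(rmorph0 (@cst S)) => /cst_inj ->.
by rewrite rmorph0.
Qed.
End Centralizer.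

(** * Degree bounds, factorial closedness and local generators of the kernel *)

Lemma size_comp_deriv (A : idomainType) (Q b f : {poly A}) :
  f^`() = (Q \Po f) * b -> f^`() != 0 -> (size Q <= 1)%N.
Proof.
move=> e n0; rewrite leqNgt; apply/negP => lt.
have b0 : b != 0 by apply: contraNneq n0 => z; rewrite e z mulr0.
have h0 : Q \Po f != 0 by apply: contraNneq n0 => z; rewrite e z mul0r.
have f0 : f != 0 by apply: contraNneq n0 => ->; rewrite deriv0.
(* For Q of positive degree, Q(f) has degree at least that of f, which exceeds that of its
   derivative. *)
have := lt_size_deriv f0; rewrite e size_mul //.
have := size_comp_poly Q f; move: h0 b0; rewrite -!size_poly_gt0.
have : (1 < size f)%N.
  rewrite ltnNge; apply/negP => /size1_polyC ef; move: n0; rewrite ef derivC eqxx //.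
move: lt; case: (size f) => [|[|sf]] //; case: (size Q) => [|[|sQ]] //.
case: (size (Q \Po f)) => // h; case: (size b) => // sb _ _ _ _ /= ->; rewrite addnS /= !ltnS.
by rewrite mulSn -addnA addSn ltnNge leq_addr.
Qed.

Lemma evF_constant (A : idomainType) (f a b : {poly {poly A}}) (Q : {poly A}) :
  nat_invertible A -> dX f = evF f Q * a -> dY f = evF f Q * b ->
  ~ (dX f = 0 /\ dY f = 0) -> exists c, evF f Q = cst c.
Proof.
move=> nA eX eY n0.
have evE : evF f Q = map_poly polyC Q \Po f.
  by rewrite /evF /comp_poly -map_poly_comp.
suff sQ : (size Q <= 1)%N.
  by exists Q`_0; rewrite {1}(size1_polyC sQ) evFC.
have [Y0|Y0] := eqVneq (dY f) 0; last first.
  have := @size_comp_deriv _ _ b f (etrans eY (congr1 (fun z => z * b) evE)) Y0.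
  by rewrite size_map_inj_poly // => ? ? /polyC_inj.
have ef := deriv_eq0 (natinv_poly nA) Y0.
have eQ : (evF f Q)`_0 = Q \Po f`_0.
  rewrite evE ef; elim/poly_ind: Q {eX eY evE} => [|Q c IH].
    by rewrite rmorph0 !comp_poly0 coef0.
  rewrite rmorphD rmorphM /= map_polyX map_polyC /= !comp_polyD !comp_polyM !comp_polyX !comp_polyC.
  by rewrite coefD coef0M IH !coefC.
apply: (@size_comp_deriv _ Q a`_0 f`_0).
  by rewrite -coef_dX eX coef0M eQ.
by apply/eqP => z; apply: n0; split=> //; rewrite ef dX_polyC z.
Qed.

Lemma clear_denominators2 (S : comNzRingType) (Om : fieldType) (g : {rmorphism S -> Om}) :
  (forall w, exists u s, g u != 0 /\ w * g u = g s) ->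
  forall q : {poly {poly Om}}, exists u z, g u != 0 /\ cst (g u) * q = pm g z.
Proof.
move=> fr; elim/poly2_ind => [p q [u [z [hu eu]]] [v [y [hv ev]]]|p [u [z [hu eu]]]|p [u [z [hu eu]]]|s].
- exists (u * v), (cst v * z + cst u * y); rewrite rmorphM mulf_neq0 //; split=> //.
  by rewrite rmorphD !rmorphM /= -eu -ev !pm_cst; ring.
- by exists u, (z * XX); split=> //; rewrite rmorphM /= -eu pm_XX mulrA.
- by exists u, (z * YY); split=> //; rewrite rmorphM /= -eu pm_YY mulrA.
- by have [u [z [hu eu]]] := fr s; exists u, (cst z); split=> //; rewrite pm_cst -eu cstM mulrC.
Qed.

(** Kernels of locally nilpotent derivations are factorially closed: E-degrees add up, so both
    factors of a nonzero kernel element have degree 0. *)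
Lemma der_factor_ker (C : idomainType) (E : {additive C -> C}) (h m : C) :
  (forall a b, E (a * b) = E a * b + a * E b) -> loc_nilp E -> nat_invertible C ->
  h * m != 0 -> E (h * m) = 0 -> E h = 0.
Proof.
move=> EM nil nC hm0 e; have h0 : h <> 0 by move=> z; rewrite z mul0r eqxx in hm0.
have m0 : m <> 0 by move=> z; rewrite z mulr0 eqxx in hm0.
have [[|k] [nk ek]] := loc_nilp_top nil h0; first exact: ek.
have [i [ni ei]] := loc_nilp_top nil m0.
have [top _] := iter_der_top EM ek ei.
move: top; rewrite (@iter_der_le _ _ 1 (k.+1 + i)) // => /esym.
have : (0 < 'C(k.+1 + i, k.+1))%N by rewrite bin_gt0 leq_addr.
case: 'C(_, _) => // j _ /(nat_invertible_reg nC)/eqP; rewrite mulf_eq0.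
by case/orP => /eqP.
Qed.

Lemma pmBM (S Om : comNzRingType) (g : {rmorphism S -> Om}) (a b c d : {poly {poly S}}) :
  pm g (a * b - c * d) = pm g a * pm g b - pm g c * pm g d.
Proof. by rewrite pm_zmod !(pm_monoid g).2. Qed.

Lemma prime_of_ideal (A : comNzRingType) (I : A -> Prop) : is_ideal I -> ~ I 1 ->
  (forall a b, I (a * b) -> I a \/ I b) -> exists p : prime_idealr A, forall a, a \in p <-> I a.
Proof.
move=> [I0 ID IM] I1 Ipr; pose J : {pred A} := fun a => `[< I a >].
have Jcl : idealr_closed J.
  split; [exact/asboolP | by apply/negP => /asboolP |].
  by move=> a x y /asboolP hx /asboolP hy; apply/asboolP/ID => //; exact: IM.
have Jpr : prime_idealr_closed J.
  by move=> a b /asboolP/Ipr[] h; apply/orP; [left | right]; exact/asboolP.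
pose p : prime_idealr A := HB.pack J (isIdealr.Build A J Jcl) (isPrimeIdealrClosed.Build A J Jpr).
by exists p => a; split=> [/asboolP//|h]; exact/asboolP.
Qed.

Lemma gradient_in_ideal (A : comNzRingType) (I : A -> Prop) (q : {poly {poly A}}) :
  nat_invertible A -> is_ideal I -> coefs_in (coefs_in I) (dX q) -> coefs_in (coefs_in I) (dY q) ->
  coefs_in (coefs_in I) (q - cst q`_0`_0).
Proof.
move=> nA idI hX hY.
have div x i : I (x *+ i.+1) -> I x.
  have [c ec] := nA i; move=> h; have -> : x = c * x *+ i.+1 by rewrite -mulr_natl mulrA [_ * c]mulrC ec mul1r.
  by rewrite -mulrnAr; exact: (idealM idI).
move=> [|i] m; rewrite coefB coefC /=.
  case: m => [|m]; rewrite coefB coefC /= ?subrr ?subr0; first exact: (ideal0 idI).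
  by apply: (div _ m); have := hX 0%N m; rewrite coef_dX coef_deriv.
by rewrite subr0; apply: (div _ i); have := hY i m; rewrite coef_deriv coefMn.
Qed.

Lemma sym_local_generator (R : comNzRingType) (N : lmodType R) (A : comAlgType R)
    (g : {lrmorphism Sym N -> A}) (p : prime_idealr R) : (forall a, exists x, g x = a) ->
  rank_one N -> exists a0 : A, forall a, exists (t : R) (Q : {poly R}),
    t \notin p /\ t *: a = horner_alg a0 Q.
Proof.
move=> surj r1; have [n0 hn0] := rank_one_local p r1.
exists (g (sym_in n0)) => a; have [x <-] := surj a.
have nM (s t : R) : s \notin p -> t \notin p -> s * t \notin p.
  by move=> hs ht; rewrite prime_idealrM negb_or hs ht.
elim/sym_ind: x => [x y [t [Q [tp eQ]]] [t' [Q' [tp' eQ']]]|x y [t [Q [tp eQ]]] [t' [Q' [tp' eQ']]]|r|n].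
- exists (t * t'), (t' *: Q + t *: Q'); split; first exact: nM.
  have -> : g (x + y) = g x + g y by exact: raddfD.
  rewrite rmorphD /= !linearZ /= -!scalerAl !mul1r -eQ -eQ' !scalerA scalerDr.
  by rewrite [t' * t]mulrC.
- exists (t * t'), (Q * Q'); split; first exact: nM.
  have -> : g (x * y) = g x * g y by exact: rmorphM.
  by rewrite rmorphM /= -eQ -eQ' -scalerAl -scalerAr scalerA.
- exists 1, r%:P; split; first by rewrite idealr1.
  rewrite scale1r horner_algC.
  have -> : sym_cst N r = r *: 1 by apply: esym; exact: mulr1.
  apply: etrans (linearZ _ _) _; congr (_ *: _); exact: rmorph1.
have [t [r [tp e]]] := hn0 n; exists t, (r *: 'X); split=> //.
rewrite linearZ /= horner_algX -scalerAl mul1r.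
apply: etrans (esym (linearZZ g t (sym_in n))) _.
have -> : t *: sym_in n = r *: sym_in n0.
  by apply: etrans (esym (sym_inZ t n)) _; rewrite e; exact: sym_inZ.
exact: linearZZ.
Qed.

(** The form in which the isomorphism with Sym N enters the converse: up to denominators outside p,
    every element of Ker D is a polynomial in one element. *)
Lemma ker_local_generator (R : comNzRingType) (B : comAlgType R) (D : derivation B)
    (N : lmodType R) (f : {lrmorphism ker_der D -> Sym N}) (p : prime_idealr R) :
  bijective f -> rank_one N -> exists a0 : B, D a0 = 0 /\
  forall a, D a = 0 -> exists (t : R) (Q : {poly R}), t \notin p /\ t *: a = horner_alg a0 Q.
Proof.
move=> /lrmorphism_inv[g [g' _ gK]] r1.
have [a0 h] := sym_local_generator p (fun a => ex_intro _ (g' a) (gK a)) r1.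
exists (val a0); split; first by apply/eqP; exact: valP a0.
move=> a /eqP Da; have [t [Q [tp eQ]]] := h (KerDer Da); exists t, Q; split=> //.
have -> : t *: a = val (t *: KerDer Da) by rewrite linearZ.
rewrite eQ; elim/poly_ind: {eQ} Q => [|Q c IH]; first by rewrite !rmorph0.
rewrite !rmorphD !rmorphM /= !horner_algX !horner_algC IH.
congr (_ * _ + _); apply: etrans (linearZ _ _) _; congr (_ *: _); exact: rmorph1.
Qed.

(** The zero derivation is reducible, because 0 is a non-unit of the localized algebra. *)
Lemma irreducible_der_neq0 (R : comNzRingType) (B : comAlgType R) (D : derivation B)
    (p : prime_idealr R) : (forall (r : R) (b : B), r *: b = 0 -> r = 0 \/ b = 0) ->
  irreducible_der (loc_der D p) -> exists b, D b <> 0.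
Proof.
move=> reg irr; apply: contrapT => nex; apply: irr; exists 0; split.
  case=> c; rewrite mul0r => /esym/fracP[u]; rewrite /= !scale1r scaler0 => /reg[] e.
    by have := dvalP u; rewrite e idealr0.
  by have/eqP := e; rewrite oner_eq0.
elim/frac_ind => b s; exists 0; rewrite mul0r loc_derE.
have -> : D b = 0 by apply: contrapT => h; apply: nex; exists b.
by apply/fracP; exists (denom1 p); rewrite /= !scaler0.
Qed.

(** * The base change of an A^2-form *)

(* S = R (x) K and P = B (x) K, with retractions piR and pi induced by a k-linear retraction
   K -> k; l is the composite K -> k -> R. *)
Section Form.
Variables (K : fieldType) (R : idomainType) (S : comNzRingType).
Local Notation P := {poly {poly S}}.
Variables (rho : {rmorphism R -> S}) (kap : {rmorphism K -> S}) (B : comAlgType R).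
Variables (beta : {rmorphism B -> P}) (l : {additive K -> R}).
Variables (piR : {additive S -> R}) (pi : {additive P -> B}).
Hypothesis l1 : l 1 = 1.
Hypothesis piRM : forall r s, piR (rho r * s) = r * piR s.
Hypothesis piRk : forall a, piR (kap a) = l a.
Hypothesis beta_alg : forall r : R, beta r%:A = cst (rho r).
Hypothesis piM : forall b z, pi (beta b * z) = b * pi z.
Hypothesis pi_cst : forall s, pi (cst s) = (piR s)%:A.

Definition pexp (e : seq (K * K)) (z : P) :=
  z = \sum_(y <- e) beta (pi (cst (kap y.1) * z)) * cst (kap y.2).

Hypothesis pexp_exists : forall zs : seq P, exists e, forall z, z \in zs -> pexp e z.

Lemma piR1 : piR 1 = 1. Proof. by rewrite -(rmorph1 kap) piRk. Qed.
Lemma piR_rho r : piR (rho r) = r. Proof. by rewrite -[rho r]mulr1 piRM piR1 mulr1. Qed.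
Lemma rho_inj : injective rho. Proof. exact: can_inj piR_rho. Qed.
Lemma pi1 : pi 1 = 1.
Proof. by rewrite -(rmorph1 cst) pi_cst piR1 scale1r. Qed.
Lemma pi_beta b : pi (beta b) = b. Proof. by rewrite -[beta b]mulr1 piM pi1 mulr1. Qed.
Lemma beta_inj : injective beta. Proof. exact: can_inj pi_beta. Qed.
Lemma pi_kap a : pi (cst (kap a)) = (l a)%:A. Proof. by rewrite pi_cst piRk. Qed.
Lemma beta_scale r b : beta (r *: b) = cst (rho r) * beta b.
Proof. by rewrite -beta_alg -rmorphM -scalerAl mul1r. Qed.
Lemma pi_rho r z : pi (cst (rho r) * z) = r *: pi z.
Proof. by rewrite -beta_alg piM -scalerAl mul1r. Qed.

Lemma rexp_exists (ss : seq S) : exists e : seq (K * K), forall s, s \in ss ->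
  s = \sum_(y <- e) rho (piR (kap y.1 * s)) * kap y.2.
Proof.
have [e he] := pexp_exists [seq cst s | s <- ss]; exists e => s ss'.
have {he} : pexp e (cst s) by apply: he; apply: map_f.
rewrite /pexp => h; apply: cst_inj; rewrite {1}h rmorph_sum; apply: eq_bigr => y _.
by rewrite -rmorphM pi_cst beta_alg rmorphM.
Qed.

Lemma S_zero s : (forall c, piR (kap c * s) = 0) -> s = 0.
Proof.
move=> h; have [e he] := rexp_exists [:: s].
rewrite (he s (mem_head _ _)) big1 // => y _.
by rewrite h rmorph0 mul0r.
Qed.

Lemma P_zero z : (forall c, pi (cst (kap c) * z) = 0) -> z = 0.
Proof.
move=> h; have [e he] := pexp_exists [:: z].
rewrite (he z (mem_head _ _)) big1 // => y _.
by rewrite h rmorph0 mul0r.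
Qed.

Lemma form_rmorph_ext (Q : comNzRingType) (g h : {rmorphism P -> Q}) :
  (forall b, g (beta b) = h (beta b)) -> (forall c, g (cst (kap c)) = h (cst (kap c))) ->
  g =1 h.
Proof.
move=> gb gk z; have [e he] := pexp_exists [:: z].
rewrite (he z (mem_head _ _)) !rmorph_sum; apply: eq_bigr => y _.
by rewrite !rmorphM gb gk.
Qed.

Section Der.
Variables (D : derivation B) (DP : {additive P -> P}).
Hypothesis DPM : forall a b, DP (a * b) = DP a * b + a * DP b.
Hypothesis DPc : forall s, DP (cst s) = 0.
Hypothesis DPb : forall b, DP (beta b) = beta (D b).

Lemma DP_cstM s z : DP (cst s * z) = cst s * DP z.
Proof. by rewrite DPM DPc mul0r add0r. Qed.

Lemma der_scale r b : D (r *: b) = r *: D b.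
Proof. exact: linearZ. Qed.

Lemma pi_DP z : pi (DP z) = D (pi z).
Proof.
have [e he] := pexp_exists [:: z]; have hz : pexp e z by apply: he; rewrite mem_head.
rewrite {1 2}hz !raddf_sum; apply: eq_bigr => y _.
by rewrite piM pi_kap mulrC DP_cstM DPb mulrC piM pi_kap -!scalerAr !mulr1 -der_scale.
Qed.

Variable F : P.
Hypothesis DPF : forall z, DP z = Jac F z.
Hypothesis natS : nat_invertible S.

(* T = S (x) K = R (x) K (x) K; s1 and s2 use the first and the second copy of K. H12 is
   s2 on S and extends pm s1 o beta; it is pm s2 followed by an automorphism g12 of T[X, Y], whose
   Jacobian is therefore constant. *)
Section SecondCopy.
Variables (T : comNzRingType) (s1 s2 : {rmorphism S -> T}) (kap2 : {rmorphism K -> T}).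
Variables (mu : {rmorphism T -> S}) (piT : {additive T -> S}).
Local Notation PT := {poly {poly T}}.
Variables (H12 H21 : {rmorphism P -> PT}).
Hypothesis s12 : forall r, s1 (rho r) = s2 (rho r).
Hypothesis s2k : forall c, s2 (kap c) = kap2 c.
Hypothesis mus1 : forall s, mu (s1 s) = s.
Hypothesis muk : forall c, mu (kap2 c) = kap c.
Hypothesis piTM : forall s t, piT (s1 s * t) = s * piT t.
Hypothesis piTk : forall c, piT (kap2 c) = rho (l c).
Hypothesis texp : forall t : T, exists cs : seq P, forall e, (forall z, z \in cs -> pexp e z) ->
  t = \sum_(y <- e) s1 (piT (kap2 y.1 * t)) * kap2 y.2.
Hypothesis H12b : forall b, H12 (beta b) = pm s1 (beta b).
Hypothesis H12k : forall c, H12 (cst (kap c)) = cst (kap2 c).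
Hypothesis H21b : forall b, H21 (beta b) = pm s2 (beta b).
Hypothesis H21k : forall c, H21 (cst (kap c)) = cst (s1 (kap c)).
Hypothesis redT : reduced_ring T.

Lemma H12_cst s : H12 (cst s) = cst (s2 s).
Proof.
have [e he] := rexp_exists [:: s]; have {he} hs := he s (mem_head _ _).
rewrite hs !rmorph_sum; apply: eq_bigr => y _.
by rewrite !rmorphM /= H12k -beta_alg H12b beta_alg pm_cst s12 s2k.
Qed.

Variable g12 : {rmorphism PT -> PT}.
Hypothesis g12c : forall t, g12 (cst t) = cst t.
Hypothesis g12X : g12 XX = H12 XX.
Hypothesis g12Y : g12 YY = H12 YY.

Lemma g12E q : g12 (pm s2 q) = H12 q.
Proof.
have : (g12 \o pm s2) =1 H12; last exact.
apply: poly2_rmorph_ext => [s||]; rewrite /= ?pm_cst ?pm_XX ?pm_YY.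
- by rewrite g12c H12_cst.
- exact: g12X.
- exact: g12Y.
Qed.

Lemma g12H21 q : g12 (H21 q) = pm s1 q.
Proof.
have : (g12 \o H21) =1 pm s1; last exact.
apply: form_rmorph_ext => [b|c] /=.
- by rewrite H21b g12E H12b.
- by rewrite H21k pm_cst g12c.
Qed.

Lemma Jac_g12 a b : Jac (g12 a) (g12 b) = g12 (Jac a b) * Jac (H12 XX) (H12 YY).
Proof. by rewrite (Jac_subst g12c) g12X g12Y. Qed.

Lemma jacobian_const : exists u, Jac (H12 XX) (H12 YY) = cst u.
Proof.
apply: (@reduced_poly2_unit _ _ (g12 (Jac (H21 XX) (H21 YY))) redT).
by rewrite mulrC -Jac_g12 !g12H21 -pm_Jac Jac_YY dX_XX rmorph1.
Qed.

Lemma H12_DP z : H12 (DP z) = Jac (pm s1 F) (H12 z).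
Proof.
have [e he] := pexp_exists [:: z]; have hz : pexp e z by apply: he; rewrite mem_head.
rewrite hz !(raddf_sum, rmorph_sum) /=; apply: eq_bigr => y _.
rewrite mulrC DP_cstM rmorphM [in RHS]rmorphM H12k JacM Jac_cstr mul0r add0r; congr (_ * _).
by rewrite DPb !H12b -DPb DPF pm_Jac.
Qed.

(** Over T the derivation has a potential from each copy of K. Transport by [g12] multiplies the
    bracket by the constant [u], so [H12 F - u F] has zero bracket with everything and is constant.
    Multiplying the two copies together by [mu] turns [H12] into the identity, whence [mu u = 1]. *)
Lemma H12_F : exists u v, H12 F = cst u * pm s1 F + cst v /\ mu u = 1.
Proof.
have [u eu] := jacobian_const; exists u.
pose G := H12 F - cst u * pm s1 F.
have JG z : Jac G (H12 z) = 0.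
  rewrite JacBl Jac_cstMl -(g12E F) -(g12E z) Jac_g12 eu -pm_Jac -DPF !g12E.
  by rewrite H12_DP mulrC subrr.
have JG1 z : Jac G (pm s1 z) = 0.
  have [e he] := pexp_exists [:: z]; have hz : pexp e z by apply: he; rewrite mem_head.
  rewrite hz rmorph_sum raddf_sum big1 // => y _.
  by rewrite rmorphM /= -H12b JacM pm_cst Jac_cstr mulr0 addr0 JG mul0r.
have nT : nat_invertible T := nat_invertible_rmorph s1 natS.
have /(poly2_closed_const nT) : dX G = 0 by rewrite -Jac_YY -[YY](pm_YY s1) JG1.
have eY : dY G = 0 by apply/eqP; rewrite -oppr_eq0 -Jac_XX -[XX](pm_XX s1) JG1.
move=> /(_ eY) eG; exists G`_0`_0; split.
  by rewrite -eG /G addrC subrK.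
have muH z : pm mu (H12 z) = z.
  have : (pm mu \o H12) =1 idfun; last exact.
  have pmm q : pm mu (pm s1 q) = q.
    by apply/polyP => i; apply/polyP => m; rewrite !coef2_pm mus1.
  apply: form_rmorph_ext => [b|c] /=; first by rewrite H12b pmm.
  by rewrite H12k pm_cst muk.
apply: cst_inj; rewrite -pm_cst -eu pm_Jac !muH Jac_YY dX_XX.
by rewrite rmorph1.
Qed.

Lemma linear_descent : exists n (f : 'I_n -> B) (ep : 'I_n -> K) (u v : 'I_n -> S),
  [/\ F = \sum_i beta (f i) * cst (kap (ep i)), forall i, D (f i) = 0,
      forall i, beta (f i) = cst (u i) * F + cst (v i) & \sum_i u i * kap (ep i) = 1].
Proof.
have [u [v [eF mu1]]] := H12_F.
have [cs hcs] := texp u.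
(* One family serves F and [u] together: expanding F yields the [f i], and expanding [u], followed
   by [mu], yields the last identity. *)
have [e he] := pexp_exists (F :: cs).
have hF : pexp e F by apply: he; rewrite mem_head.
have hu := hcs e (fun z zcs => he z (mem_behead (s := F :: cs) zcs)).
pose y (i : 'I_(size e)) := tnth (in_tuple e) i.
have sumE (V : nmodType) (g : K * K -> V) : \sum_(z <- e) g z = \sum_i g (y i).
  exact: big_tnth.
pose f i := pi (cst (kap (y i).1) * F).
exists (size e), f, (fun i => (y i).2), (fun i => piT (kap2 (y i).1 * u)),
  (fun i => piT (kap2 (y i).1 * v)); split.
- by rewrite {1}hF sumE.
- by move=> i; rewrite -pi_DP DP_cstM DPF Jacxx mulr0 raddf0.
- move=> i; set c := (y i).1.
  (* [Pc] contracts the second copy of K with [l (c * _)], coefficient by coefficient. It sends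
     [H12 F] to [beta (f i)], and the other side of [eF] to the required affine expression in F. *)
  pose Pc (q : PT) : P := \poly_(a < size q) \poly_(b < size q`_a) piT (kap2 c * q`_a`_b).
  have PcE q a b : (Pc q)`_a`_b = piT (kap2 c * q`_a`_b).
    rewrite /Pc coef_poly; case: ltnP => [_|le]; last first.
      by rewrite [q`_a]nth_default // !coef0 mulr0 raddf0.
    rewrite coef_poly; case: ltnP => // le.
    by rewrite [_`_b in RHS]nth_default // mulr0 raddf0.
  have PcD p q : Pc (p + q) = Pc p + Pc q.
    by apply/polyP => a; apply/polyP => b; rewrite !coefD !PcE !coefD mulrDr raddfD.
  have Pc0 : Pc 0 = 0.
    by apply/polyP => a; apply/polyP => b; rewrite PcE !coef0 mulr0 raddf0.
  have PcM q t : Pc (cst t * pm s1 q) = cst (piT (kap2 c * t)) * q.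
    apply/polyP => a; apply/polyP => b; rewrite PcE !coefCM coef2_pm.
    by rewrite mulrA mulrC piTM mulrC.
  have := congr1 Pc eF; rewrite PcD PcM.
  have -> : Pc (cst v) = cst (piT (kap2 c * v)).
    by rewrite -[cst v]mulr1 -(rmorph1 (pm s1)) PcM mulr1.
  move=> <-; rewrite /f -/c.
  have eH : H12 F = \sum_(z <- e) cst (kap2 z.2) * pm s1 (beta (pi (cst (kap z.1) * F))).
    rewrite {1}hF rmorph_sum; apply: eq_bigr => z _.
    by rewrite rmorphM H12b H12k mulrC.
  have eF' : cst (kap c) * F =
      \sum_(z <- e) beta (pi (cst (kap z.1) * F)) * cst (kap (c * z.2)).
    rewrite {1}hF mulr_sumr; apply: eq_bigr => z _.
    by rewrite [kap (c * _)]rmorphM [cst (_ * _)]rmorphM mulrCA.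
  have -> : Pc (H12 F) = \sum_(z <- e) cst (rho (l (c * z.2))) * beta (pi (cst (kap z.1) * F)).
    rewrite eH (big_morph Pc PcD Pc0); apply: eq_bigr => z _.
    by rewrite PcM -rmorphM piTk.
  rewrite {1}eF' raddf_sum /= rmorph_sum; apply: eq_bigr => z _.
  by rewrite piM pi_kap rmorphM beta_alg mulrC.
- have := congr1 mu hu; rewrite mu1 => ->; rewrite rmorph_sum sumE; apply: eq_bigr => i _.
  by rewrite rmorphM mus1 muk.
Qed.
End SecondCopy.

Lemma rho_reg r s : rho r * s = 0 -> r = 0 \/ s = 0.
Proof.
move=> e; have [r0|r0] := eqVneq r 0; [by left | right].
apply: S_zero => c; apply: (mulfI r0).
by rewrite -piRM mulrCA e !mulr0 raddf0.
Qed.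

Lemma pi_Mcst b s : pi (beta b * cst s) = piR s *: b.
Proof. by rewrite piM pi_cst -scalerAr mulr1. Qed.

Lemma regular_transfer x : (forall b, x * b = 0 -> b = 0) ->
  forall z, beta x * z = 0 -> z = 0.
Proof.
move=> regx z e; apply: P_zero => c; apply: regx.
by rewrite -piM mulrCA e mulr0 raddf0.
Qed.

(** Divisibility by an element of B can be tested on the coordinates in B; this plays the role of
    flatness of B -> P. *)
Lemma principal_transfer x z : (forall c, principal x (pi (cst (kap c) * z))) ->
  exists d, z = beta x * d.
Proof.
move=> h; have [e he] := pexp_exists [:: z]; have hz : pexp e z by apply: he; rewrite mem_head.
suff : principal (beta x) z by [].
rewrite hz; apply: (ideal_sum (principal_ideal _)) => y _.
have [d ->] := h y.1; exists (beta d * cst (kap y.2)).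
by rewrite rmorphM mulrA.
Qed.

Lemma regular2_transfer x y : (forall b, principal x (y * b) -> principal x b) ->
  forall z w, beta y * z = beta x * w -> exists d, z = beta x * d.
Proof.
move=> regy z w e; apply: principal_transfer => c; apply: regy.
by exists (pi (cst (kap c) * w)); rewrite -!piM mulrCA e mulrCA.
Qed.

Lemma der_ideal_grad b : der_ideal D b -> exists c d, beta b = c * dX F + d * dY F.
Proof.
apply: (ideal_gen_min (I := fun b => exists c d, beta b = c * dX F + d * dY F)).
  split.
  - by exists 0, 0; rewrite rmorph0; ring.
  - by move=> b1 b2 [c1 [d1 e1]] [c2 [d2 e2]]; exists (c1 + c2), (d1 + d2); rewrite rmorphD e1 e2; ring.
  - by move=> a b1 [c1 [d1 e1]]; exists (beta a * c1), (beta a * d1); rewrite rmorphM e1; ring.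
move=> _ [a ->]; exists (dY (beta a)), (- dX (beta a)).
by rewrite -DPb DPF /Jac; ring.
Qed.

(** * From grade two to the kernel *)

Section Forward.
Variables (x0 y0 : B).
Hypothesis Ix : der_ideal D x0.
Hypothesis Iy : der_ideal D y0.
Hypothesis regx : forall b, x0 * b = 0 -> b = 0.
Hypothesis regy : forall b, principal x0 (y0 * b) -> principal x0 b.
Hypothesis redS : reduced_ring S.

Lemma ker_centralizer g : Jac F g = 0 -> exists Q, g = evF F Q.
Proof.
have [al [be ex]] := der_ideal_grad Ix; have [ga [de ey]] := der_ideal_grad Iy.
exact: (centralizer redS natS ex ey (regular_transfer regx) (regular2_transfer regy)).
Qed.

Lemma F_transcendental Q : evF F Q = 0 -> Q = 0.
Proof.
have [al [be ex]] := der_ideal_grad Ix.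
exact: (evF_inj0 natS ex (regular_transfer regx)).
Qed.

Lemma F_cst_inj s t : cst s * F = cst t * F -> s = t.
Proof.
move=> e; have : evF F ((s - t) *: 'X) = 0.
  have -> : evF F ((s - t) *: 'X) = (cst s - cst t) * F.
    by rewrite evF_scale evFX cstB.
  by rewrite mulrBl e subrr.
move/F_transcendental/(congr1 (fun q : {poly S} => q`_1)).
by rewrite coefZ coefX coef0 mulr1 => /eqP; rewrite subr_eq0 => /eqP.
Qed.

(* The constants r_i = piR v_i satisfy r_i = u_i nu + v_i, so F - nu is homogeneous. *)
Lemma homogeneous_generator n (f : 'I_n -> B) (ep : 'I_n -> K) (u v : 'I_n -> S) :
  F = \sum_i beta (f i) * cst (kap (ep i)) ->
  (forall i, beta (f i) = cst (u i) * F + cst (v i)) ->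
  exists F' (g : 'I_n -> B), [/\ forall z, Jac F' z = Jac F z,
    F' = \sum_i beta (g i) * cst (kap (ep i)) & forall i, beta (g i) = cst (u i) * F'].
Proof.
move=> Fsum fE; pose r i := piR (v i).
pose nu := \sum_i rho (r i) * kap (ep i).
have rE i : rho (r i) = u i * nu + v i.
  apply/eqP; rewrite -subr_eq0; apply/eqP/S_zero => c.
  pose a j := piR (kap c * u i * kap (ep j)); pose b := piR (kap c * v i).
  (* An R-linear relation between the [f j] and 1. As F is transcendental over S, the polynomials
     u_j X + v_j satisfy it as well; applying [piR] to their constant terms gives the same relation
     between the [r j]. *)
  have e1 : l c *: f i = \sum_j a j *: f j + b%:A.
    rewrite -piRk -pi_Mcst mulrC fE mulrDr raddfD /= -[X in _ + pi X]rmorphM pi_cst.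
    congr (_ + _); rewrite {1}Fsum !mulr_sumr raddf_sum; apply: eq_bigr => j _.
    by rewrite /a -pi_Mcst; congr (pi _); rewrite !rmorphM /=; ring.
  have e2 : evF F (rho (l c) *: (u i *: 'X + (v i)%:P)) =
      evF F (\sum_j rho (a j) *: (u j *: 'X + (v j)%:P) + (rho b)%:P).
    have lin j : evF F (u j *: 'X + (v j)%:P) = beta (f j).
      by rewrite evFD evF_scale evFX evFC fE.
    have sumE (G : 'I_n -> {poly S}) : evF F (\sum_j G j) = \sum_j evF F (G j).
      by rewrite /evF rmorph_sum horner_sum.
    rewrite evF_scale lin -beta_scale e1 rmorphD rmorph_sum beta_alg evFD evFC sumE.
    by congr (_ + _); apply: eq_bigr => j _; rewrite beta_scale evF_scale lin.
  have : evF F (rho (l c) *: (u i *: 'X + (v i)%:P) -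
      (\sum_j rho (a j) *: (u j *: 'X + (v j)%:P) + (rho b)%:P)) = 0.
    by rewrite evFB e2 subrr.
  move/F_transcendental/(congr1 (fun q : {poly S} => q`_0)).
  have lin0 d j : (d *: (u j *: 'X + (v j)%:P))`_0 = d * v j.
    by rewrite coefZ coefD coefZ coefX coefC mulr0 add0r.
  rewrite coef0 coefB coefD coef_sum lin0 coefC /= => /eqP; rewrite subr_eq0 => /eqP e3.
  have e4 : l c * r i = \sum_j a j * r j + b.
    rewrite -piRM e3 raddfD /= piR_rho raddf_sum; congr (_ + _).
    by apply: eq_bigr => j _; rewrite lin0 piRM.
  rewrite mulrBr raddfB /= [kap c * rho _]mulrC piRM piRk [r i * _]mulrC e4 mulrDr raddfD /= -/b.
  rewrite [X in _ - (X + _)](_ : _ = \sum_j a j * r j) ?subrr //.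
  rewrite !mulr_sumr raddf_sum; apply: eq_bigr => j _.
  by rewrite [RHS]mulrC -piRM; congr (piR _); ring.
exists (F - cst nu), (fun i => f i - (r i)%:A); split.
- by move=> z; rewrite JacBl Jac_cstl subr0.
- rewrite {1}Fsum /nu rmorph_sum /= -sumrB; apply: eq_bigr => i _.
  by rewrite (rmorphB beta) beta_alg cstM mulrBl.
- by move=> i; rewrite (rmorphB beta) beta_alg fE rE cstD cstM; ring.
Qed.

Section Homogeneous.
Variables (n : nat) (f : 'I_n -> B) (ep : 'I_n -> K) (u : 'I_n -> S).
Hypothesis Fsum : F = \sum_i beta (f i) * cst (kap (ep i)).
Hypothesis fE : forall i, beta (f i) = cst (u i) * F.
Hypothesis u1 : \sum_i u i * kap (ep i) = 1.

Definition line : {pred B} := fun b => `[< exists s, beta b = cst s * F >].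
Lemma line_closed : GRing.submod_closed line.
Proof.
split=> [|a b c /asboolP[s es] /asboolP[t et]]; apply/asboolP.
  by exists 0; rewrite !rmorph0 mul0r.
exists (rho a * s + t); rewrite rmorphD beta_scale es et rmorphD rmorphM /=; ring.
Qed.
Local Notation N := (submodule line_closed).

Lemma line_coef (x : N) : exists s, beta (submodule_val x) = cst s * F.
Proof. by case: x => b hb; exact/asboolP. Qed.
Definition slope (x : N) := projT1 (cid (line_coef x)).
Lemma slopeE x : beta (submodule_val x) = cst (slope x) * F.
Proof. exact: projT2 (cid (line_coef x)). Qed.

(** Put F = sum f_i ep_i into x = (slope x) F and apply [pi]: the coefficient of f_i is this one. *)
Definition coord i (x : N) : R^o := piR (slope x * kap (ep i)).
Lemma coord_linear i : linear (coord i).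
Proof.
move=> a x y; rewrite /coord.
have -> : slope (a *: x + y) = rho a * slope x + slope y.
  apply: F_cst_inj; rewrite -slopeE.
  have -> : submodule_val (a *: x + y) = a *: submodule_val x + submodule_val y by [].
  by rewrite rmorphD beta_scale !slopeE rmorphD rmorphM /=; ring.
by rewrite mulrDl raddfD -mulrA piRM.
Qed.
HB.instance Definition _ i := GRing.isLinear.Build R N R^o *:%R (coord i) (coord_linear i).

Lemma line_gen i : f i \in line. Proof. by apply/asboolP; exists (u i). Qed.
Definition gen i : N := @Submodule _ _ _ line_closed (f i) (line_gen i).
Lemma slope_gen i : slope (gen i) = u i.
Proof. by apply: F_cst_inj; rewrite -slopeE -fE. Qed.

Lemma line_dual (x : N) : x = \sum_i (coord i x : R) *: gen i.
Proof.
apply: val_inj; transitivity (\sum_i (coord i x : R) *: f i); last first.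
  by rewrite raddf_sum; exact: eq_bigr.
rewrite -[LHS]/(submodule_val x) -[LHS]pi_beta slopeE {1}Fsum mulr_sumr raddf_sum.
by apply: eq_bigr => i _; rewrite mulrCA -rmorphM pi_Mcst.
Qed.

Lemma coord_prop i (x y : N) : (coord i x : R) *: y = (coord i y : R) *: x.
Proof.
apply: val_inj; rewrite -[LHS]/((coord i x : R) *: submodule_val y).
rewrite -[RHS]/((coord i y : R) *: submodule_val x).
rewrite -!pi_Mcst !slopeE !rmorphM /=; congr (pi _); ring.
Qed.

Lemma coord_gen1 : \sum_i (coord i (gen i) : R) = 1.
Proof.
rewrite -piR1 -u1 raddf_sum; apply: eq_bigr => i _.
by rewrite /coord slope_gen.
Qed.

Lemma line_ker (x : N) : in_ker D (submodule_val x).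
Proof.
apply/eqP/beta_inj; rewrite -DPb slopeE DP_cstM DPF Jacxx mulr0 rmorph0 //.
Qed.
Definition line_incl (x : N) : ker_der D := KerDer (line_ker x).
Lemma line_incl_linear : linear line_incl.
Proof. by move=> a x y; apply: val_inj. Qed.
HB.instance Definition _ := GRing.isLinear.Build R N (ker_der D) *:%R line_incl line_incl_linear.

Lemma beta_horner (a : ker_der D) (Q : {poly R}) :
  beta (ker_val (horner_alg a Q)) = (map_poly (@cst S \o rho) Q).[beta (ker_val a)].
Proof.
elim/poly_ind: Q => [|Q c IH]; first by rewrite !rmorph0 horner0.
rewrite !rmorphD !rmorphM /= horner_algX horner_algC map_polyX map_polyC /=.
by rewrite !hornerE_comm -IH -beta_alg -rmorphM -rmorphD.
Qed.

Lemma line_transcendental i (Q : {poly R}) : horner_alg (line_incl (gen i)) Q = 0 ->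
  Q = 0 \/ (coord i (gen i) : R) = 0.
Proof.
move=> e; have [u0|u0] := pselect (u i = 0).
  by right; rewrite /coord slope_gen u0 mul0r raddf0.
left; have : evF F (\poly_(m < size Q) (rho Q`_m * u i ^+ m)) = 0.
  transitivity (beta (ker_val (horner_alg (line_incl (gen i)) Q))); last by rewrite e rmorph0.
  rewrite beta_horner /= fE /evF; set q := \poly_(_ < _) _.
  rewrite (@horner_coef_wide _ (size Q)); last first.
    by apply: leq_trans (size_poly _ _) _; exact: size_poly.
  rewrite (@horner_coef_wide _ (size Q) (map_poly _ Q)); last exact: size_poly.
  apply: eq_bigr => m _; rewrite !coef_map /= coef_poly ltn_ord.
  by rewrite exprMn rmorphM rmorphXn mulrA.
move/F_transcendental => q0; apply/polyP => m; rewrite coef0.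
have [ltm|le] := ltnP m (size Q); last by rewrite nth_default.
have := congr1 (fun q : {poly S} => q`_m) q0; rewrite coef_poly ltm coef0 => /rho_reg[//|].
by move/(reduced_expr redS).
Qed.

Lemma line_generates (Q : ker_der D -> Prop) : (forall x y, Q x -> Q y -> Q (x + y)) ->
  (forall x y, Q x -> Q y -> Q (x * y)) -> (forall a, Q a%:A) -> (forall x, Q (line_incl x)) ->
  forall x, Q x.
Proof.
move=> QD QM QA QN x.
(* Allowing every multiplier [s] makes [W] stable under multiplication by F, whose coefficients
   [ep i] are absorbed into [s]. *)
pose W z := forall s, exists2 a, Q a & ker_val a = pi (cst s * z).
have Wc c : W (cst c).
  by move=> s; exists (piR (s * c))%:A => //; rewrite -rmorphM pi_cst.
have WD z w : W z -> W w -> W (z + w).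
  move=> hz hw s; have [a Qa ea] := hz s; have [b Qb eb] := hw s.
  by exists (a + b); [exact: QD | rewrite mulrDr raddfD /= -ea -eb].
have WF z : W z -> W (z * F).
  move=> hz s; rewrite Fsum !mulr_sumr raddf_sum.
  elim/big_ind: _ => [|_ _ [a Qa <-] [b Qb <-]|i _].
  - by exists 0%:A => //; rewrite scale0r.
  - by exists (a + b); [exact: QD|].
  have [a Qa ea] := hz (s * kap (ep i)); exists (line_incl (gen i) * a); first exact: QM.
  transitivity (f i * ker_val a); first by [].
  rewrite ea -piM rmorphM /=; congr (pi _); ring.
have [|q eq] := @ker_centralizer (beta (ker_val x)).
  by rewrite -DPF DPb; case: x => b /= /eqP->; rewrite rmorph0.
have Wq : W (beta (ker_val x)).
  rewrite eq; elim/poly_ind: (q) => [|r c IH].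
    by rewrite -[0 : {poly S}](rmorph0 (@polyC S)) evFC; exact: Wc.
  by rewrite evFD evFM evFX evFC; apply: WD => //; apply: WF.
have [a Qa] := Wq 1; rewrite rmorph1 mul1r pi_beta => /val_inj <-.
exact: Qa.
Qed.

Lemma homogeneous_kernel : exists N : lmodType R, [/\ projective N, rank_one N
  & exists f : {lrmorphism ker_der D -> Sym N}, bijective f].
Proof.
exists N; split.
- exact: (dual_basis_projective line_dual).
- exact: (dual_basis_rank_one coord_prop coord_gen1).
have [g gE] := sym_lift line_incl.
apply: (@lrmorphism_inv _ _ _ g).
pose s : {linear N -> Sym N} := HB.pack (@sym_in R N)
  (GRing.isLinear.Build R N (Sym N) *:%R (@sym_in R N) (fun a x y =>
     etrans (sym_inD _ _) (congr1 (+%R^~ _) (sym_inZ a x)))).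
apply: (@generated_bijective _ _ _ _ s line_incl g gE n gen coord).
- by move=> i x; rewrite coord_prop.
- exact: coord_gen1.
- exact: line_transcendental.
- move=> Q QD QM QA QX; apply: sym_ind => // a.
  by have := QA a; rewrite -[a%:A]/(sym_cst N a * 1) mulr1.
- exact: line_generates.
Qed.
End Homogeneous.
End Forward.

(** * From the kernel to grade two *)

Section Backward.

Lemma coefs_in_principal (A : comNzRingType) (a : A) (q : {poly A}) :
  coefs_in (principal a) q <-> principal a%:P q.
Proof.
split=> [h|[z ->] i]; last by rewrite coefCM; exists z`_i.
exists (\poly_(i < size q) projT1 (cid (h i))); apply/polyP => i.
rewrite coefCM coef_poly; case: ltnP => lt; last by rewrite nth_default // mulr0.
exact: projT2 (cid (h i)).
Qed.

Lemma coefs2_principal (a : S) (q : P) :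
  coefs_in (coefs_in (principal a)) q <-> principal (cst a) q.
Proof.
rewrite -coefs_in_principal.
by split=> h i; [apply/coefs_in_principal | apply/coefs_in_principal].
Qed.

Lemma not_principal_coord r s : ~ principal (rho r) s ->
  exists c, ~ principal r (piR (kap c * s)).
Proof.
move=> ns; apply: contrapT => nex; apply: ns; have [e he] := rexp_exists [:: s].
rewrite (he s (mem_head _ _)); apply: (ideal_sum (principal_ideal _)) => y _.
have [d ->] : principal r (piR (kap y.1 * s)).
  by apply: contrapT => h; apply: nex; exists y.1.
by exists (rho d * kap y.2); rewrite rmorphM mulrA.
Qed.

(** McCoy's theorem gives a multiplier in S only; one of its coordinates over R is still not
    divisible by r and can replace it. *)
Lemma mccoy_form r (G : B -> Prop) (z : P) : ~ principal (cst (rho r)) z ->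
  (forall b, G b -> principal (cst (rho r)) (z * beta b)) ->
  exists t, ~ principal r t /\ forall b, G b -> exists b', t *: b = r *: b'.
Proof.
move=> nz hz.
have [||s [ns hs]] := @mccoy2 S (principal (rho r)) (fun g => exists2 b, G b & g = beta b) z
  (principal_ideal _).
- by move=> /coefs2_principal.
- by move=> _ [b Gb ->]; apply/coefs2_principal; exact: hz.
have [c nc] := not_principal_coord ns; exists (piR (kap c * s)); split=> // b Gb.
have /coefs2_principal[z' ez'] := hs (beta b) (ex_intro2 _ _ b Gb erefl).
exists (pi (cst (kap c) * z')).
by rewrite -pi_Mcst -pi_rho mulrCA -ez' cstM; congr (pi _); rewrite /cst; ring.
Qed.

Lemma scale_reg (r : R) (b : B) : r *: b = 0 -> r = 0 \/ b = 0.
Proof.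
move=> e; have [r0|r0] := pselect (r = 0); [by left | right].
apply: beta_inj; rewrite rmorph0; apply/polyP => i; apply/polyP => m; rewrite !coef0.
have : cst (rho r) * beta b = 0 by rewrite -beta_scale e rmorph0.
move/(congr1 (fun q : P => q`_i`_m)); rewrite !coefCM !coef0.
by move/rho_reg => [].
Qed.

(** P need not be a domain. McCoy's theorem modulo r = 0 produces a nonzero t in R with
    [t *: b = 0], and R is regular on B. *)
Lemma form_domain (b b' : B) : b * b' = 0 -> b = 0 \/ b' = 0.
Proof.
move=> e; have [|nb'] := pselect (b' = 0); [by right | left].
have [|b1 ->|t [nt ht]] := @mccoy_form 0 (fun a => a = b) (beta b').
- rewrite rmorph0 => -[d]; rewrite /cst !polyC0 mul0r => h; apply: nb'.
  by apply: beta_inj; rewrite h rmorph0.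
- by exists 0; rewrite mulr0 mulrC -rmorphM e rmorph0.
have [b1] := ht b erefl; rewrite scale0r => /scale_reg[t0|//].
by case: nt; exists 0; rewrite t0 mulr0.
Qed.

Lemma form_regular (x : B) : x <> 0 -> forall b, x * b = 0 -> b = 0.
Proof. by move=> x0 b /form_domain[]. Qed.

Lemma noetherian_generators : noetherian R -> forall bs : seq B,
  exists (P0 : comNzRingType) (g : {rmorphism P0 -> B}),
  [/\ noetherian P0, forall r : R, exists p, g p = r%:A
    & forall b, b \in bs -> exists p, g p = b].
Proof.
move=> nR; elim=> [|b bs [P0 [g [nP gR gb]]]].
  by exists R, (in_alg B); split=> // r; exists r.
exists {poly P0}, (horner_eval b \o map_poly g); split.
- exact: hilbert_basis.
- move=> r; have [p <-] := gR r; exists p%:P.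
  by rewrite /= /horner_eval map_polyC hornerC.
- move=> b'; rewrite inE => /orP[/eqP->|/gb[p <-]].
    by exists 'X; rewrite /= /horner_eval map_polyX hornerX.
  by exists p%:P; rewrite /= /horner_eval map_polyC hornerC.
Qed.

(** The coordinates of X and Y generate B over R; Hilbert's basis theorem does the rest. As [pi] is
    not multiplicative, [W] again allows every multiplier [s]. *)
Lemma form_noetherian : noetherian R -> noetherian B.
Proof.
move=> nR; have [e he] := pexp_exists [:: XX; YY].
have hX : pexp e XX by apply: he; rewrite mem_head.
have hY : pexp e YY by apply: he; rewrite !inE eqxx orbT.
pose co z := [seq pi (cst (kap y.1) * z) | y <- e].
have [P0 [g [nP gR gb]]] := noetherian_generators nR (co XX ++ co YY).
apply: (noetherian_surj (F := g)) nP => b.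
pose W z := forall s, exists p, g p = pi (cst s * z).
have Wmul z w : pexp e w -> (forall b, b \in co w -> exists p, g p = b) -> W z -> W (z * w).
  move=> hw gw hz s; rewrite hw !mulr_sumr raddf_sum big_seq.
  elim/big_ind: _ => [|_ _ [p <-] [q <-]|y ye].
  - by exists 0; rewrite rmorph0.
  - by exists (p + q); rewrite rmorphD.
  have [p ep] := hz (s * kap y.2).
  have [|q eq] := gw (pi (cst (kap y.1) * w)); first by apply/mapP; exists y.
  exists (q * p); rewrite rmorphM /= ep eq -piM cstM; congr (pi _).
  by rewrite /cst; ring.
suff : W (beta b) by move/(_ 1); rewrite rmorph1 mul1r pi_beta.
elim/poly2_ind: (beta b) => [p q Wp Wq s|p Wp|p Wp|c s].
- have [p' ep] := Wp s; have [q' eq] := Wq s; exists (p' + q').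
  by rewrite rmorphD mulrDr raddfD /= ep eq.
- by apply: Wmul => // b' b'X; apply: gb; rewrite mem_cat b'X.
- by apply: Wmul => // b' b'Y; apply: gb; rewrite mem_cat b'Y orbT.
- by rewrite -cstM pi_cst; exact: gR.
Qed.

Hypothesis redS : reduced_ring S.
Hypothesis DPnil : loc_nilp DP.

Lemma principal_grad c x : (forall b, principal x (D b * c)) ->
  exists u v, beta c * dX F = beta x * u /\ beta c * dY F = beta x * v.
Proof.
move=> h.
have key z : exists w, beta c * DP z = beta x * w.
  apply: principal_transfer => k.
  have [d ed] := h (pi (cst (kap k) * z)).
  by exists d; rewrite mulrCA piM -DP_cstM pi_DP mulrC.
have [u eu] := key YY; have [v ev] := key XX.
exists u, (- v); rewrite mulrN -eu -ev !DPF Jac_YY Jac_XX; split=> //.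
by rewrite mulrN opprK.
Qed.

Lemma base_nat_invertible : nat_invertible R.
Proof.
by move=> i; have [c ec] := natS i; exists (piR c); rewrite -mulrC -piRM rmorph_nat mulrC ec piR1.
Qed.

Lemma beta_horner_alg (a : B) (Q : {poly R}) :
  beta (horner_alg a Q) = evF (beta a) (map_poly rho Q).
Proof.
elim/poly_ind: Q => [|Q c IH].
  by rewrite !rmorph0 -[0 : {poly S}](rmorph0 (@polyC S)) evFC -(rmorph0 (@cst S)).
rewrite rmorphD rmorphM /= horner_algX horner_algC !rmorphD !rmorphM /= IH.
by rewrite map_polyX map_polyC beta_alg evFD evFM evFX evFC.
Qed.

Section Local.
Variables (n : nat) (f : 'I_n -> B) (ep : 'I_n -> K) (u v : 'I_n -> S).
Hypothesis Fsum : F = \sum_i beta (f i) * cst (kap (ep i)).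
Hypothesis fD : forall i, D (f i) = 0.
Hypothesis fE : forall i, beta (f i) = cst (u i) * F + cst (v i).
Hypothesis u1 : \sum_i u i * kap (ep i) = 1.
Hypothesis D_neq0 : exists b, D b <> 0.

Lemma F_grad_neq0 : dX F = 0 -> dY F = 0 -> False.
Proof.
move=> eX eY; have [b nb] := D_neq0; apply: nb; apply: beta_inj.
by rewrite -DPb DPF /Jac eX eY rmorph0; ring.
Qed.

Section AtPrime.
Variables (p : prime_idealr R) (a0 : B).
Hypothesis Da0 : D a0 = 0.
Hypothesis gen0 : forall a, D a = 0 -> exists (t : R) (Q : {poly R}),
  t \notin p /\ t *: a = horner_alg a0 Q.

Lemma notin_neq0 t : t \notin p -> t <> 0.
Proof. by move=> h e; rewrite e idealr0 in h. Qed.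

Lemma notinM s t : s \notin p -> t \notin p -> s * t \notin p.
Proof. by move=> hs ht; rewrite prime_idealrM negb_or hs ht. Qed.

Lemma rho_scale_eq0 t (z : P) : t <> 0 -> cst (rho t) * z = 0 -> z = 0.
Proof.
move=> t0 e; apply/polyP => i; apply/polyP => m; rewrite !coef0.
by have := congr1 (fun q : P => q`_i`_m) e; rewrite !coefCM !coef0 => /rho_reg[].
Qed.

Lemma a0_grad_neq0 : dX (beta a0) = 0 -> dY (beta a0) = 0 -> False.
Proof.
move=> eX eY.
have h i : dX (beta (f i)) = 0 /\ dY (beta (f i)) = 0.
  have [t [Q [tp eQ]]] := gen0 (fD i).
  have e : cst (rho t) * beta (f i) = evF (beta a0) (map_poly rho Q).
    by rewrite -beta_scale eQ beta_horner_alg.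
  split; apply: (rho_scale_eq0 (notin_neq0 tp)).
    have := congr1 (@dX S) e; rewrite dX_evF eX mulr0 dXM dX_cst mul0r add0r; exact.
  have := congr1 (@dY S) e; rewrite dY_evF eY mulr0 dYM dY_cst mul0r add0r; exact.
apply: F_grad_neq0; rewrite Fsum raddf_sum big1 // => i _; have [hX hY] := h i.
  by rewrite /= dXM hX dX_cst mul0r mulr0 addr0.
by rewrite /= dYM hY dY_cst mul0r mulr0 addr0.
Qed.

Lemma a0_transcendental (Q : {poly R}) : horner_alg a0 Q = 0 -> Q = 0.
Proof.
have [m] := ubnP (size Q); elim: m Q => // m IH Q; rewrite ltnS => le e.
have [->//|Q0] := eqVneq Q 0.
have [Q'0|Q'0] := eqVneq Q^`() 0.
  move: e; rewrite (deriv_eq0 base_nat_invertible Q'0) horner_algC => /scale_reg[->//|].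
  by move/eqP; rewrite oner_eq0.
have nz : horner_alg a0 Q^`() <> 0.
  move/IH => h; move: Q'0; rewrite h ?eqxx //.
  by apply: leq_trans le; exact: lt_size_deriv.
have reg := regular_transfer (form_regular nz).
have eF : evF (beta a0) (map_poly rho Q) = 0 by rewrite -beta_horner_alg e rmorph0.
case: a0_grad_neq0; apply: reg; rewrite beta_horner_alg -deriv_map.
  by rewrite -dX_evF eF raddf0.
by rewrite -dY_evF eF raddf0.
Qed.

Lemma a0_transcendental_S (Q : {poly S}) : evF (beta a0) Q = 0 -> Q = 0.
Proof.
move=> e; apply/polyP => i; rewrite coef0; apply: S_zero => c.
pose Qc : {poly R} := \poly_(m < size Q) piR (kap c * Q`_m).
have -> : piR (kap c * Q`_i) = Qc`_i.
  by rewrite coef_poly; case: ltnP => // le; rewrite nth_default // mulr0 raddf0.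
suff -> : Qc = 0 by rewrite coef0.
apply: a0_transcendental; transitivity (pi (cst (kap c) * evF (beta a0) Q)); last first.
  by rewrite e mulr0 raddf0.
rewrite /horner_alg /horner_morph (@horner_coef_wide _ (size Q)); last first.
  by apply: leq_trans (size_poly _ _) _; exact: size_poly.
rewrite /evF (@horner_coef_wide _ (size Q)); last exact: size_poly.
rewrite mulr_sumr raddf_sum; apply: eq_bigr => m _.
rewrite !coef_map coef_poly ltn_ord /= mulrA -cstM -rmorphXn.
by rewrite [cst _ * _]mulrC pi_Mcst -scalerAl mul1r.
Qed.

Lemma common_denominator m (a : 'I_m -> B) : (forall i, D (a i) = 0) ->
  exists t, t \notin p /\ forall i, exists Q : {poly R}, t *: a i = horner_alg a0 Q.
Proof.
move=> Da.
have ch i : exists t, t \notin p /\ exists Q : {poly R}, t *: a i = horner_alg a0 Q.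
  by have [t [Q [tp eQ]]] := gen0 (Da i); exists t; split=> //; exists Q.
pose t i := projT1 (cid (ch i)); have tP i := projT2 (cid (ch i)).
exists (\prod_i t i); split.
  by elim/big_ind: _ => [|x y|i _]; [rewrite idealr1 | exact: notinM | case: (tP i)].
move=> i; have [_ [Q eQ]] := tP i.
exists ((\prod_(k | k != i) t k) *: Q).
by rewrite (bigD1 i) //= linearZ /= -scalerAl mul1r -eQ scalerA mulrC.
Qed.

Hypothesis irr : irreducible_der (loc_der D p).

(* F is, up to t, a polynomial Pp in a0 whose derivative is proportional over S to some q in
   R[a0]; then D(B) lies in q(a0)B locally, and irreducibility makes q a unit at p. *)
Lemma local_structure : exists (t rh : R) (om w ka : S),
  [/\ t \notin p, rh \notin p, cst (rho t) * F = cst om * beta a0 + cst ka & w * om = rho rh].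
Proof.
have [t [tp hQ]] := common_denominator fD.
pose Q i := projT1 (cid (hQ i)).
have QE i : t *: f i = horner_alg a0 (Q i) := projT2 (cid (hQ i)).
pose Pp : {poly S} := \sum_i map_poly rho (Q i) * (kap (ep i))%:P.
have sumE (I : Type) (r : seq I) (G : I -> {poly S}) :
    evF (beta a0) (\sum_(i <- r) G i) = \sum_(i <- r) evF (beta a0) (G i).
  by rewrite /evF rmorph_sum horner_sum.
have FE : cst (rho t) * F = evF (beta a0) Pp.
  rewrite sumE Fsum mulr_sumr; apply: eq_bigr => i _.
  by rewrite evFM evFC -beta_horner_alg -QE beta_scale mulrA.
have QP i : map_poly rho (Q i) = u i *: Pp + (rho t * v i)%:P.
  apply/eqP; rewrite -subr_eq0; apply/eqP/a0_transcendental_S.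
  rewrite evFB evFD evF_scale evFC -beta_horner_alg -QE -FE beta_scale fE cstM.
  rewrite /cst; ring.
have Q'P i : map_poly rho (Q i)^`() = u i *: Pp^`().
  by rewrite -deriv_map QP derivD derivC addr0 derivZ.
(* The sum of the u_i ep_i is 1, so the elements [piR (u i * kap (ep i))] sum to 1 in R and cannot
   all lie in p. *)
have [i taup] : exists i, piR (u i * kap (ep i)) \notin p.
  apply: contrapT => nex; have := idealr1 p; rewrite -piR1 -u1 raddf_sum rpred_sum // => i _.
  by apply: contrapT => /negP h; apply: nex; exists i.
set tau := piR _ in taup; pose q := (Q i)^`().
(* The derivatives of [Q i] and [Q m] are [u i] and [u m] times that of [Pp]; cross-multiplying and
   contracting with [piR (_ * kap (ep i))] makes them proportional over R. *)
have prop m : tau *: (Q m)^`() = piR (u m * kap (ep i)) *: q.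
  apply/polyP => k; rewrite !coefZ.
  have e : u m * rho q`_k = u i * rho ((Q m)^`())`_k.
    have := congr1 (fun z : {poly S} => z`_k) (Q'P i).
    have := congr1 (fun z : {poly S} => z`_k) (Q'P m).
    by rewrite !coef_map !coefZ /= => -> ->; ring.
  rewrite ![_ * _`_k]mulrC -!piRM; congr (piR _).
  by rewrite !mulrA ![rho _ * _]mulrC e.
pose w1 := \sum_m rho (piR (u m * kap (ep i))) * kap (ep m).
have P'E : rho tau *: Pp^`() = w1 *: map_poly rho q.
  rewrite /Pp raddf_sum scaler_sumr /w1 scaler_suml; apply: eq_bigr => m _.
  rewrite /= derivM derivC mulr0 addr0 deriv_map scalerAl.
  have -> : rho tau *: map_poly rho (Q m)^`() = map_poly rho (tau *: (Q m)^`()).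
    by rewrite map_polyZ.
  by rewrite prop map_polyZ -mulrC mul_polyC /= scalerA mulrC.
have DE b : exists b', (tau * t) *: D b = horner_alg a0 q * b'.
  exists (pi (cst w1 * Jac (beta a0) (beta b))).
  rewrite -piM beta_horner_alg -[LHS]pi_beta beta_scale; congr (pi _).
  rewrite -DPb DPF -Jac_cstMl rmorphM cstM -mulrA FE Jac_cstMl /Jac dX_evF dY_evF.
  have -> : evF (beta a0) (map_poly rho q) * (cst w1 * (dX (beta a0) * dY (beta b) - dY (beta a0) * dX (beta b)))
    = evF (beta a0) (w1 *: map_poly rho q) * (dX (beta a0) * dY (beta b) - dY (beta a0) * dX (beta b)).
    by rewrite evF_scale; ring.
  by rewrite -P'E evF_scale; ring.
(* By [DE], q(a0) divides the image of the localized derivation; irreducibility therefore makes it a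
   unit of B_p. *)
have [b' [t1 [t1p eb']]] : exists (b' : B) t1, t1 \notin p /\ horner_alg a0 q * b' = t1%:A.
  apply: contrapT => nex; apply: irr; exists (frac (horner_alg a0 q) (denom1 p)); split.
    case=> c; elim/frac_ind: c => m s; rewrite (fracM (horner_alg a0 q) m) => /fracP[d].
    rewrite /= !mul1r scale1r scalerA => hd; apply: nex.
    exists (dval d *: m), (dval d * dval s); split; first exact: notinM (dvalP d) (dvalP s).
    by rewrite -scalerAr hd.
  elim/frac_ind => b s; have [b' eb'] := DE b.
  have tt : tau * t \notin p by exact: notinM.
  exists (frac b' (denomM (Denom tt) s)); rewrite loc_derE (fracM (horner_alg a0 q)).
  apply/fracP; exists (denom1 p) => /=.
  by rewrite !scale1r mul1r -eb' scalerA; congr (_ *: _); ring.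
have nq : horner_alg a0 q <> 0.
  move=> z; move: eb'; rewrite z mul0r => /esym/scale_reg[|/eqP]; last by rewrite oner_eq0.
  exact: notin_neq0.
have Dq z : D (horner_alg a0 z) = 0.
  apply: beta_inj; rewrite -DPb beta_horner_alg rmorph0.
  rewrite (evF_der _ _ DPM DPc) DPb Da0 rmorph0 mulr0 //.
(* q(a0) and the constant [t1] are in Ker D, so [b'] is too, and it is locally a polynomial in a0.
   Hence q divides a nonzero constant of R[X] and is itself a constant. *)
have Db' : D b' = 0.
  have := congr1 (der D) eb'; rewrite derM Dq mul0r add0r.
  have -> : D (t1%:A) = 0 by apply: beta_inj; rewrite -DPb beta_alg DPc rmorph0.
  by move/(form_regular nq).
have [t2 [q2 [t2p eq2]]] := gen0 Db'.
have eqq : q * q2 = (t1 * t2)%:P.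
  apply/eqP; rewrite -subr_eq0; apply/eqP/a0_transcendental.
  rewrite rmorphB rmorphM /= -eq2 -scalerAr eb' horner_algC scalerA.
  by rewrite [t2 * t1]mulrC subrr.
have t12 : t1 * t2 \notin p by exact: notinM.
have t12n : (t1 * t2)%:P != 0 :> {poly R}.
  by rewrite polyC_eq0; apply/eqP; exact: notin_neq0.
have /size_poly1P[rh rh0 eq] : size q == 1%N.
  have q0 : q != 0 by apply: contraNneq t12n => z; rewrite -eqq z mul0r.
  have q20 : q2 != 0 by apply: contraNneq t12n => z; rewrite -eqq z mulr0.
  have := congr1 (fun z : {poly R} => size z) eqq; rewrite size_mul // size_polyC.
  have -> : t1 * t2 != 0 by apply/eqP; exact: notin_neq0.
  move: q0 q20; rewrite -!size_poly_gt0; case: (size q) => // -[|a] // _.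
  by case: (size q2) => // b _ /=; rewrite addnS.
have rhp : rh \notin p.
  apply/negP => h; move/negP: t12; apply.
  have := congr1 (fun z : {poly R} => z`_0) eqq; rewrite eq coefCM coefC /= => <-.
  by rewrite mulrC idealMr.
have uP : u i *: Pp^`() = (rho rh)%:P by rewrite -Q'P -/q eq map_polyC.
have P'C : Pp^`() = ((Pp^`())`_0)%:P.
  apply/polyP => -[|k]; rewrite coefC //=.
  have := congr1 (fun z : {poly S} => z`_k.+1) P'E.
  rewrite eq map_polyC /= !coefZ coefC mulr0 => /rho_reg[t0|//].
  by case: (notin_neq0 taup).
set om := (Pp^`())`_0 in P'C.
have PE : Pp = om *: 'X + ((Pp - om *: 'X)`_0)%:P.
  apply/eqP; rewrite addrC -subr_eq; apply/eqP; apply: (deriv_eq0 natS).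
  by rewrite derivB derivZ derivX P'C -alg_polyC alg_polyC subrr.
exists t, rh, om, (u i), (Pp - om *: 'X)`_0; split=> //.
- by rewrite FE {1}PE evFD evF_scale evFX evFC.
- have := congr1 (fun z : {poly S} => z`_0) uP; rewrite coefZ coefC /=; exact.
Qed.

Lemma generic_field : exists (Om : fieldType) (g : {rmorphism S -> Om}),
  [/\ forall r, r <> 0 -> g (rho r) != 0,
      forall t, g t = 0 -> exists e, g e != 0 /\ e * t = 0
    & forall w, exists u s, g u != 0 /\ w * g u = g s].
Proof.
have [|||Om [g [g1 g2 g3]]] := @minimal_prime_field S (fun u => exists r, r <> 0 /\ u = rho r) redS.
- by exists 1; rewrite rmorph1; split=> //; apply/eqP; rewrite oner_eq0.
- move=> _ _ [r [r0 ->]] [s [s0 ->]]; exists (r * s); rewrite rmorphM; split=> //.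
  by apply/eqP; rewrite mulf_neq0 //; apply/eqP.
- by case=> r [r0 /esym]; rewrite -(rmorph0 rho) => /rho_inj.
by exists Om, g; split=> // r r0; apply: g1; exists r.
Qed.

(** Over Om the partial derivatives of F have only constant common divisors, so [coprime_regular]
    gives the divisibility there; pulling it back to S costs a denominator, which is then replaced
    by an element of R. *)
Lemma principal_generic c0 x0 : x0 <> 0 -> (forall b, principal x0 (D b * c0)) ->
  exists r, r <> 0 /\ principal x0 (r *: c0).
Proof.
move=> x00 /principal_grad[ca [cb [eca ecb]]].
have [Om [g [grho kill fr]]] := generic_field.
have [t [rh [om [w [ka [tp rhp eF ew]]]]]] := local_structure.
have nO : nat_invertible Om := nat_invertible_rmorph g natS.
have gom : g om != 0.
  have := grho _ (notin_neq0 rhp); rewrite -ew rmorphM mulf_eq0 negb_or.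
  by case/andP.
have gt := grho _ (notin_neq0 tp).
have pmreg b : b <> 0 -> pm g (beta b) != 0.
  move=> b0; apply/eqP => /(kill_poly2 kill)[e [ge he]]; move: ge.
  have : cst e = 0 by apply: (regular_transfer (form_regular b0)); rewrite mulrC.
  by rewrite -(rmorph0 (@cst S)) => /cst_inj ->; rewrite rmorph0 eqxx.
pose fb := pm g (beta a0); pose Fb := pm g F.
have eFb : cst (g (rho t)) * Fb = cst (g om) * fb + cst (g ka).
  by have := congr1 (pm g) eF; rewrite rmorphD !rmorphM /= !pm_cst.
have cO (s : Om) (z : {poly {poly Om}}) : s != 0 -> cst s * (cst s^-1 * z) = z.
  by move=> s0; rewrite mulrA -cstM divff // rmorph1 mul1r.
have gradX : cst (g (rho t)) * dX Fb = cst (g om) * dX fb.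
  have := congr1 (@dX Om) eFb; rewrite raddfD /= !dXM !dX_cst !mul0r !add0r addr0; exact.
have gradY : cst (g (rho t)) * dY Fb = cst (g om) * dY fb.
  have := congr1 (@dY Om) eFb; rewrite raddfD /= !dYM !dY_cst !mul0r !add0r addr0; exact.
have gX : dX fb = cst (g (rho t) / g om) * dX Fb.
  by rewrite [_ / _]mulrC cstM -mulrA gradX mulrA -cstM mulVf // rmorph1 mul1r.
have gY : dY fb = cst (g (rho t) / g om) * dY Fb.
  by rewrite [_ / _]mulrC cstM -mulrA gradY mulrA -cstM mulVf // rmorph1 mul1r.
pose E : {additive {poly {poly Om}} -> {poly {poly Om}}} := Jac Fb.
have EM : forall a b, E (a * b) = E a * b + a * E b := JacM Fb.
have Epm z : E (pm g z) = pm g (DP z) by rewrite DPF pm_Jac.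
have iEpm m z : iter m E (pm g z) = pm g (iter m DP z).
  by elim: m => //= m ->; rewrite Epm.
have Ecst s q : E (cst s * q) = cst s * E q by rewrite EM /E /= Jac_cstr mul0r add0r.
have Enil : loc_nilp E.
  move=> q; have [y [z [gy ez]]] := clear_denominators2 fr q; have [m em] := DPnil z.
  exists m; rewrite -[q](cO _ _ gy); have -> : cst (g y) * (cst (g y)^-1 * q) = cst (g y)^-1 * pm g z.
    by rewrite -ez; ring.
  have ic i s x : iter i E (cst s * x) = cst s * iter i E x by elim: i => //= i ->; rewrite Ecst.
  by rewrite ic iEpm em rmorph0 mulr0.
have E0 q : dX Fb = 0 -> dY Fb = 0 -> E q = 0 by rewrite /E /= /Jac => -> ->; ring.
have nF0 : ~ (dX Fb = 0 /\ dY Fb = 0).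
  move=> [eX eY]; have [b nb] := D_neq0; have := pmreg _ nb.
  by rewrite -DPb -Epm E0 // eqxx.
have nf0 : ~ (dX fb = 0 /\ dY fb = 0).
  move=> [eX eY]; apply: nF0; split; rewrite -[LHS](cO _ _ gt).
    by rewrite mulrCA gradX eX !mulr0.
  by rewrite mulrCA gradY eY !mulr0.
have cop h u' v' : dX Fb = h * u' -> dY Fb = h * v' -> exists c, h = c%:P%:P.
  move=> hu hv.
  (* The last nonzero iterate of E is a nonzero kernel element of the form [E q1], hence a multiple
     of h; factorial closedness puts h into the kernel. *)
  have [q1 [Eq1 EEq1]] : exists q1, E q1 != 0 /\ E (E q1) = 0.
    have [q Eq] : exists q, E q <> 0.
      apply: contrapT => nex; apply: nF0; split; apply: contrapT => h0; apply: nex.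
        by exists YY; rewrite /E /= Jac_YY.
      by exists XX; rewrite /E /= Jac_XX => /eqP; rewrite oppr_eq0 => /eqP.
    have q0 : q <> 0 by move=> z; apply: Eq; rewrite z raddf0.
    have [[|m] [nm em]] := loc_nilp_top Enil q0; first by case: Eq.
    by exists (iter m E q); split=> //; apply/eqP.
  have eh : E q1 = h * (u' * dY q1 - v' * dX q1) by rewrite /E /= /Jac hu hv; ring.
  have Eh : E h = 0.
    by apply: (der_factor_ker EM Enil (natinv_poly (natinv_poly nO)) (m := u' * dY q1 - v' * dX q1)); rewrite -eh.
  (* A multiple of h lifts to [H], and a further multiple lies in the kernel of [DP]. Its
     coordinates are in Ker D, hence polynomials in a0 up to a common denominator. *)
  have [s [H [gs eH]]] := clear_denominators2 fr h.
  have [e [ge he]] : exists e, g e != 0 /\ cst e * DP H = 0.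
    by apply: (kill_poly2 kill); rewrite -Epm -eH Ecst Eh mulr0.
  have [es hes] := pexp_exists [:: cst e * H].
  have := hes _ (mem_head _ _); rewrite /pexp (big_nth (0, 0)) big_mkord => eHs.
  have [|t' [t'p ht']] := @common_denominator (size es)
    (fun i => pi (cst (kap (nth (0, 0) es i).1) * (cst e * H))).
    by move=> i; rewrite -pi_DP !DP_cstM he mulr0 raddf0.
  pose Q i := projT1 (cid (ht' i)); have QE i := projT2 (cid (ht' i)).
  pose Qs : {poly S} := \sum_i map_poly rho (Q i) * (kap (nth (0, 0) es i).2)%:P.
  have eQs : cst (rho t') * (cst e * H) = evF (beta a0) Qs.
    rewrite {1}eHs mulr_sumr /Qs /evF rmorph_sum horner_sum; apply: eq_bigr => i _.
    by rewrite -/(evF _ _) evFM evFC -beta_horner_alg -QE beta_scale -[RHS]mulrA.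
  set s' := g (rho t') * (g e * g s).
  have s'0 : s' != 0 by rewrite !mulf_neq0 // grho //; exact: notin_neq0 t'p.
  have pm_evF (q : {poly S}) : pm g (evF (beta a0) q) = evF fb (map_poly g q).
    elim/poly_ind: q => [|q c IH].
      by rewrite !rmorph0 -[0 : {poly S}](rmorph0 (@polyC S)) -[0 : {poly Om}](rmorph0 (@polyC Om)) !evFC pm_cst rmorph0.
    rewrite [map_poly g _]rmorphD /= [map_poly g (_ * _)]rmorphM /= map_polyX map_polyC.
    by rewrite !evFD !evFM !evFX !evFC rmorphD rmorphM /= pm_cst IH.
  have eh' : h = evF fb (s'^-1 *: map_poly g Qs).
    rewrite evF_scale -pm_evF -eQs !rmorphM /= !pm_cst -eH -[LHS](cO _ _ s'0) /s' !cstM; ring.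
  rewrite eh'; apply: (@evF_constant _ _ (cst (g (rho t) / g om) * u') (cst (g (rho t) / g om) * v') _ nO _ _ nf0).
    by rewrite -eh' mulrCA -hu gX.
  by rewrite -eh' mulrCA -hv gY.
have [||d ed] := @coprime_regular _ (dX Fb) (dY Fb) cop (pm g (beta c0)) (pm g (beta x0)) (pm g ca) (pm g cb).
- by have := congr1 (pm g) eca; rewrite rmorphM [pm g (beta x0 * _)]rmorphM /= pm_dX.
- by have := congr1 (pm g) ecb; rewrite rmorphM [pm g (beta x0 * _)]rmorphM /= pm_dY.
have [y [z [gy ez]]] := clear_denominators2 fr d.
have [|e [ge he]] := @kill_poly2 _ _ g (cst y * beta c0 - beta x0 * z) kill.
  rewrite pmBM pm_cst -ez ed.
  by rewrite mulrCA subrr.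
(* The denominator [e * y] is nonzero in S, so one of its coordinates over R is nonzero. *)
have [k nk] : exists k, piR (kap k * (e * y)) <> 0.
  apply: contrapT => nex; have : e * y = 0.
    by apply: S_zero => k; apply: contrapT => h; apply: nex; exists k.
  move/(congr1 g); rewrite rmorphM rmorph0 => /eqP; rewrite mulf_eq0.
  by rewrite (negPf ge) (negPf gy).
exists (piR (kap k * (e * y))); split=> //.
exists (pi (cst (kap k) * (cst e * z))).
rewrite -pi_Mcst -piM; congr (pi _).
have -> : beta x0 * (cst (kap k) * (cst e * z)) = cst (kap k) * (cst e * (cst y * beta c0))
  - cst (kap k) * (cst e * (cst y * beta c0 - beta x0 * z)) by ring.
by rewrite he mulr0 subr0 !cstM; ring.
Qed.

End AtPrime.

Hypothesis nR : noetherian R.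
Hypothesis gen : forall p : prime_idealr R, exists a0, D a0 = 0 /\
  forall a, D a = 0 -> exists (t : R) (Q : {poly R}), t \notin p /\ t *: a = horner_alg a0 Q.
Hypothesis irr : forall p : prime_idealr R, irreducible_der (loc_der D p).

Lemma principal_der c x : x <> 0 -> (forall b, principal x (D b * c)) -> principal x c.
Proof.
move=> x0 hc.
have [||a b /eqP|p0 _] := @prime_of_ideal R (fun r => r = 0).
- by split=> [//|a b -> ->|a b ->]; rewrite ?addr0 ?mulr0.
- by move/eqP; rewrite oner_eq0.
- by rewrite mulf_eq0 => /orP[]/eqP; [left | right].
have [b0 [Db0 gen0]] := gen p0.
have [r [r0 [c' ec']]] := principal_generic Db0 gen0 (@irr p0) x0 hc.
have hc' b : exists m, r *: m = c' * D b.
  have [m em] := hc b; exists m; apply/eqP; rewrite -subr_eq0; apply/eqP/(form_regular x0).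
  by rewrite mulrBr -scalerAr -em mulrA -ec' -scalerAl [c * _]mulrC subrr.
suff [h eh] : exists h, c' = r *: h.
  exists h; apply/eqP; rewrite -subr_eq0; apply/eqP.
  have [//|//] : r = 0 \/ c - x * h = 0.
  by apply: scale_reg; rewrite scalerBr ec' eh -scalerAr subrr.
apply: contrapT => nh.
(* As [c'] carries D(B) into rB without being in rB, McCoy gives [s] outside rR with s D(B) inside
   rB. The prime p will be a maximal colon ideal containing (r) : s. *)
have [||s [ns hs]] := @mccoy_form r (fun b => exists b0, b = D b0) (beta c').
- by move=> [z ez]; apply: nh; exists (pi z); rewrite -pi_rho -ez pi_beta.
- move=> _ [b ->]; have [m em] := hc' b; exists (beta m).
  by rewrite -beta_scale em rmorphM.
have [s1 [ms hs1]] := max_colon_exists nR ns.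
have [|p pP] := @prime_of_ideal R (colon r s1) (colon_ideal _ _) (max_colon1 ms).
  by move=> a b; apply: max_colon_prime.
have [a0 [Da0 gena]] := gen p.
have [t [rh [om [w [ka [tp rhp eF ew]]]]]] := local_structure Da0 gena (@irr p).
have hP z : principal (cst (rho r)) (cst (rho s) * DP z).
  have [e he] := pexp_exists [:: z]; rewrite (he z (mem_head _ _)).
  rewrite raddf_sum mulr_sumr; apply: (ideal_sum (principal_ideal _)) => y _ /=.
  have [b' eb'] := hs (D (pi (cst (kap y.1) * z))) (ex_intro _ _ erefl).
  exists (beta b' * cst (kap y.2)).
  by rewrite DPM DPc mulr0 addr0 DPb !mulrA -!beta_scale eb'.
(* [rh] times the gradient of a0 is w t times that of F. So the gradient of [G] is divisible by r,
   and [G] is a constant modulo r. *)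
pose G := cst (rho (s * rh)) * beta a0.
have grad (d : {additive P -> P}) (z : P) : (forall s q, d (cst s * q) = cst s * d q) ->
    (forall s q, d (q + cst s) = d q) -> principal (cst (rho r)) (cst (rho s) * d F) ->
    principal (cst (rho r)) (d G).
  move=> dM dD hd; have eG : cst (rho t) * d F = cst om * d (beta a0).
    by rewrite -dM eF dD dM.
  have -> : d G = cst w * cst (rho t) * (cst (rho s) * d F).
    rewrite /G dM rmorphM -ew; transitivity (cst (rho s) * cst w * (cst om * d (beta a0))).
      by rewrite !cstM; ring.
    by rewrite -eG; ring.
  exact: (idealM (principal_ideal _)).
have [z ez] : principal (cst (rho r)) (G - cst G`_0`_0).
  apply/coefs2_principal; apply: (gradient_in_ideal natS (principal_ideal _)).
    apply/coefs2_principal; apply: (grad (@dX S)) => //.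
    - by move=> ? ? /=; rewrite dXM dX_cst mul0r add0r.
    - by move=> ? ? /=; rewrite raddfD /= dX_cst addr0.
    - by have := hP YY; rewrite DPF Jac_YY.
  apply/coefs2_principal; apply: (grad (@dY S)) => //.
  - by move=> ? ? /=; rewrite dYM dY_cst mul0r add0r.
  - by move=> ? ? /=; rewrite raddfD /= dY_cst addr0.
  - have := hP XX; rewrite DPF Jac_XX mulrN => /(idealN (principal_ideal _)).
    by rewrite opprK.
set s0 := G`_0`_0 in ez; pose h := pi z.
have eh : (s * rh) *: a0 - (piR s0)%:A = r *: h.
  by rewrite /h -pi_rho -ez raddfB /= pi_cst /G -beta_scale pi_beta.
have r0' : r <> 0 by [].
have Dh : D h = 0.
  have Dr (q : R) (b : B) : D (q *: b) = q *: D b by rewrite linearZ.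
  have : r *: D h = 0 by rewrite -Dr -eh raddfB /= !Dr Da0 der1 !scaler0 subrr.
  by move/scale_reg => [].
have [t1 [Q [t1p eQ]]] := gena h Dh.
(* With s rh a0 minus a constant equal to r h and t1 h = Q(a0), the coefficients of a0 give t1 s rh
   in rR. Hence t1 rh lies in (r) : s, so in p, although neither factor does. *)
pose q : {poly R} := (t1 * (s * rh)) *: 'X - (t1 * piR s0)%:P - r *: Q.
have : q = 0.
  apply: (a0_transcendental gena); rewrite /q.
  rewrite !rmorphB /= !linearZ /= -!scalerAl !mul1r horner_algX horner_algC -eQ.
  by rewrite -[(t1 * (s * rh)) *: _]scalerA -[(t1 * piR s0) *: _]scalerA -scalerBr eh !scalerA [r * t1]mulrC subrr.
move/(congr1 (fun q : {poly R} => q`_1)).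
rewrite /q !coefB !coefZ coefX coefC coef0 /= subr0 mulr1 => /eqP; rewrite subr_eq0 => /eqP e1.
have : colon r s1 (t1 * rh).
  by apply: hs1; exists Q`_1; rewrite -e1; ring.
by move/pP; rewrite prime_idealrM (negPf t1p) (negPf rhp).
Qed.

Lemma der_ideal_pi c q : der_ideal D (pi (c * DP q)).
Proof.
have [e he] := pexp_exists [:: q]; rewrite (he q (mem_head _ _)) raddf_sum mulr_sumr raddf_sum.
have idI := @ideal_gen_ideal B (fun b => exists a, b = D a).
apply: (ideal_sum idI) => y _ /=; rewrite DPM DPc mulr0 addr0 DPb mulrCA piM mulrC.
by apply: (idealM idI); apply: ideal_gen_sub; eexists.
Qed.

Lemma regular3_transfer x y z :
  (forall b, (exists c d, z * b = x * c + y * d) -> exists c d, b = x * c + y * d) ->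
  forall w c d, beta z * w = beta x * c + beta y * d ->
  exists c' d', w = beta x * c' + beta y * d'.
Proof.
move=> reg w c d e; have [es he] := pexp_exists [:: w]; rewrite (he w (mem_head _ _)).
elim/big_ind: _ => [|_ _ [c1 [d1 ->]] [c2 [d2 ->]]|i _].
- by exists 0, 0; ring.
- by exists (c1 + c2), (d1 + d2); ring.
have [|c' [d' ->]] := reg (pi (cst (kap i.1) * w)).
  exists (pi (cst (kap i.1) * c)), (pi (cst (kap i.1) * d)).
  by rewrite -!piM -raddfD /= mulrCA e; congr (pi _); rewrite /cst; ring.
exists (beta c' * cst (kap i.2)), (beta d' * cst (kap i.2)).
by rewrite rmorphD !rmorphM /=; ring.
Qed.

Lemma grade_der_ideal : noetherian B ->
  grade_is (der_ideal D) (Some 2%N) \/ grade_is (der_ideal D) None.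
Proof.
move=> nB; have idI := @ideal_gen_ideal B (fun b => exists a, b = D a).
have ID a : der_ideal D (D a) by apply: ideal_gen_sub; exists a.
have [I1|nI1] := pselect (der_ideal D 1).
  by right=> x; rewrite -[x]mulr1; exact: (idealM idI).
left; split; first by exists 1.
have [b0 x0] := D_neq0; set x := D b0 in x0.
have [|y [Iy regy]] := regular_mod_exists nB (nat_invertible_rmorph (in_alg B) base_nat_invertible) idI (x := x).
  by move=> c hc; apply: (principal_der x0) => b; apply: hc; exact: ID.
exists [:: x; y]; split=> //; split.
- split.
    case=> [|[|]] //= _ c.
      by move=> /ideal_gen0/(form_regular x0) ->; exact: (ideal0 (ideal_gen_ideal _)).
    by move=> /ideal_gen1 h; apply/ideal_gen1/regy.
  move=> h; apply: nI1; apply: h => // z; rewrite !inE => /orP[]/eqP->; [exact: ID | exact: Iy].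
- by move=> z; rewrite !inE => /orP[]/eqP->; [exact: ID | exact: Iy].
move=> z Iz [hreg _]; apply: nI1.
(* A third regular element would carry over to P, where all three lie in the ideal of [dX F] and
   [dY F]. That ideal would be the unit ideal, and [pi] would bring 1 back into D(B)B. *)
have [| |c [d e1]] := @two_generators_grade P (dX F) (dY F) (beta x) (beta y) (beta z)
  (der_ideal_grad (ID b0)) (der_ideal_grad Iy) (der_ideal_grad Iz)
  (regular_transfer (form_regular x0)) .
- exact: regular2_transfer.
- apply: regular3_transfer => b /ideal_gen2 h; apply/ideal_gen2.
  exact: (hreg 2%N).
rewrite -pi1 e1 raddfD /=; apply: (idealD idI).
  by rewrite -Jac_YY -DPF; exact: der_ideal_pi.
rewrite -[dY F]opprK -Jac_XX -DPF mulrN raddfN; apply: (idealN idI).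
exact: der_ideal_pi.
Qed.
End Local.
End Backward.
End Der.

(** * The equivalence, for any presentation of the base change *)

Lemma grade2_pair (C : comNzRingType) (I : C -> Prop) :
  grade_is I (Some 2%N) \/ grade_is I None -> exists x y,
  [/\ I x, I y, forall b, x * b = 0 -> b = 0 & forall b, principal x (y * b) -> principal x b].
Proof.
case=> [[_ [xs [[[hreg _] hI _] sz]]]|hI]; last first.
  (* In the unit ideal the pair 1, 1 meets the same cancellation conditions, so grade 2 and infinite
     grade are treated alike. *)
  exists 1, 1; split=> // b; first by rewrite mul1r.
  by move=> _; exists b; rewrite mul1r.
case: xs sz hreg hI => [|x [|y [|]]] //= _ hreg hI.
exists x, y; split; try by apply: hI; rewrite !inE eqxx ?orbT.
- move=> b e; apply/ideal_gen0; apply: (hreg 0%N isT b); exact/ideal_gen0.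
- move=> b h; apply/ideal_gen1; apply: (hreg 1%N isT b); exact/ideal_gen1.
Qed.

Lemma form_equivalence (D : derivation B) (DP : {additive P -> P}) (F : P)
    n (f : 'I_n -> B) (ep : 'I_n -> K) (u v : 'I_n -> S) :
  (forall a b, DP (a * b) = DP a * b + a * DP b) -> (forall s, DP (cst s) = 0) ->
  (forall b, DP (beta b) = beta (D b)) -> (forall z, DP z = Jac F z) ->
  nat_invertible S -> reduced_ring S -> loc_nilp DP -> noetherian R ->
  F = \sum_i beta (f i) * cst (kap (ep i)) -> (forall i, D (f i) = 0) ->
  (forall i, beta (f i) = cst (u i) * F + cst (v i)) -> \sum_i u i * kap (ep i) = 1 ->
  (grade_is (der_ideal D) (Some 2%N) \/ grade_is (der_ideal D) None) <->
  ((exists N : lmodType R,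
      [/\ projective N, rank_one N
        & exists f : {lrmorphism ker_der D -> Sym N}, bijective f]) /\
   forall p : prime_idealr R, irreducible_der (loc_der D p)).
Proof.
move=> DPM DPc DPb DPF natS redS DPnil nR Fsum fD fE u1; split.
  move=> /grade2_pair[x0 [y0 [Ix Iy regx regy]]]; split; last first.
    by move=> p; exact: loc_der_irreducible Ix Iy regx regy.
  have [F' [g [JF' Fsum' gE]]] := homogeneous_generator DPb DPF natS Ix regx Fsum fE.
  have DPF' z : DP z = Jac F' z by rewrite JF'.
  exact: (homogeneous_kernel DPM DPc DPb DPF' natS Ix Iy regx regy redS Fsum' gE u1).
move=> [[N [_ r1 [h hbij]]] irr].
have [||a b /eqP|p0 _] := @prime_of_ideal R (fun r => r = 0).
- by split=> [//|a b -> ->|a b ->]; rewrite ?addr0 ?mulr0.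
- by move/eqP; rewrite oner_eq0.
- by rewrite mulf_eq0 => /orP[]/eqP; [left | right].
have D0 := irreducible_der_neq0 scale_reg (@irr p0).
exact: (grade_der_ideal DPM DPc DPb DPF natS redS DPnil Fsum fD fE u1 D0 nR
  (fun p => ker_local_generator p hbij r1) irr (form_noetherian nR)).
Qed.
End Form.

(* What the proof uses of [tens]: its own operations unfold to those of a monoid algebra, so it
   is kept abstract. *)
Record is_tensor (k K : fieldType) (C T : comNzRingType) (f : {rmorphism k -> C})
    (g : {rmorphism k -> K}) (L : {rmorphism C -> T}) (Q : {rmorphism K -> T}) : Prop := IsTensor {
  tensor_compat : forall c, L (f c) = Q (g c);
  tensor_gen : forall x, exists s : seq (C * K), x = \sum_(z <- s) L z.1 * Q z.2;
  tensor_lift : forall (U : comNzRingType) (u : {rmorphism C -> U}) (v : {rmorphism K -> U}),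
    (forall c, u (f c) = v (g c)) ->
    exists w : {rmorphism T -> U}, (forall s, w (L s) = u s) /\ forall a, w (Q a) = v a;
  tensor_bilinear : forall (U : comNzRingType) (hL : {additive C -> U}) (hR : {additive K -> U}),
    (forall c s a, hR (g c * a) * hL s = hR a * hL (f c * s)) ->
    exists G : {additive T -> U}, forall s a, G (L s * Q a) = hR a * hL s;
  tensor_retraction : forall l : {additive K -> k}, (forall c x, l (g c * x) = c * l x) ->
    exists p : {additive T -> C},
    [/\ forall s x, p (L s * x) = s * p x, forall a, p (Q a) = f (l a)
      & forall x, exists cs : seq K, forall e, (forall c, c \in cs -> expands g l e c) ->
          x = \sum_(y <- e) L (p (Q y.1 * x)) * Q y.2]
}.

Lemma tens_is_tensor (k K : fieldType) (C : comNzRingType) (f : {rmorphism k -> C})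
  (g : {rmorphism k -> K}) : is_tensor f g (tensL f g) (tensR f g).
Proof.
split.
- exact: tensLR.
- exact: tens_sum.
- move=> U u v uv.
  pose w : {rmorphism tens f g -> U} := HB.pack (tens_lift u v)
    (GRing.isZmodMorphism.Build _ _ (tens_lift u v) (tens_lift_zmod uv))
    (GRing.isMonoidMorphism.Build _ _ (tens_lift u v) (tens_lift_monoid uv)).
  by exists w; split; [exact: tens_liftL uv | exact: tens_liftR uv].
- by move=> U hL hR; exact: tens_bilinear.
- by move=> l lZ; exact: tens_retraction.
Qed.

Lemma is_tensor_bij (k K : fieldType) (C T T' : comNzRingType) (f : {rmorphism k -> C})
    (g : {rmorphism k -> K}) (L : {rmorphism C -> T}) (Q : {rmorphism K -> T})
    (L' : {rmorphism C -> T'}) (Q' : {rmorphism K -> T'})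
    (th : {rmorphism T -> T'}) (th' : {rmorphism T' -> T}) :
  cancel th th' -> cancel th' th -> (forall s, th (L s) = L' s) -> (forall a, th (Q a) = Q' a) ->
  is_tensor f g L Q -> is_tensor f g L' Q'.
Proof.
move=> thK thK' LE QE [compat gen lift bil retr].
have L'K s : th' (L' s) = L s by rewrite -LE thK.
have Q'K a : th' (Q' a) = Q a by rewrite -QE thK.
split.
- by move=> c; rewrite -LE compat QE.
- move=> x; have [s es] := gen (th' x); exists s; rewrite -[LHS]thK' es rmorph_sum.
  by apply: eq_bigr => z _; rewrite rmorphM /= LE QE.
- move=> U u v uv; have [w [wL wQ]] := lift U u v uv; exists (w \o th').
  by split=> s /=; rewrite ?L'K ?Q'K.
- move=> U hL hR bal; have [G GE] := bil U hL hR bal; exists (G \o th') => s a.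
  by rewrite /= rmorphM /= L'K Q'K.
- move=> l lZ; have [p [pL pQ pe]] := retr l lZ; exists (p \o th'); split.
  + by move=> s x; rewrite /= rmorphM /= L'K pL.
  + by move=> a; rewrite /= Q'K.
  + move=> x; have [cs h] := pe (th' x); exists cs => e /h {}h.
    rewrite -[LHS]thK' {1}h rmorph_sum; apply: eq_bigr => y _.
    by rewrite /= !rmorphM /= Q'K LE QE.
Qed.

Section TensorInd.
Variables (k K : fieldType) (C T : comNzRingType) (f : {rmorphism k -> C})
  (g : {rmorphism k -> K}) (L : {rmorphism C -> T}) (Q : {rmorphism K -> T}).
Hypothesis isT : is_tensor f g L Q.

Lemma tensor_ind (H : T -> Prop) : H 0 -> (forall x y, H x -> H y -> H (x + y)) ->
  (forall s a, H (L s * Q a)) -> forall x, H x.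
Proof.
move=> H0 HD HM x; have [s ->] := tensor_gen isT x.
by elim/big_ind: _ => // z _; exact: HM.
Qed.

Lemma field_functional : exists l : {additive K -> k},
  (forall c x, l (g c * x) = c * l x) /\ l 1 = 1.
Proof.
have [l0 [lD lZ l1]] := unit_functional g.
have lB : zmod_morphism l0.
  by move=> x y; rewrite -{2}[x](subrK y) (lD (x - y)) addrK.
pose l : {additive K -> k} := HB.pack l0 (GRing.isZmodMorphism.Build K k l0 lB).
by exists l.
Qed.

Lemma tensor_reduced : [pchar k] =i pred0 -> (forall x : K, algebraicOver g x) ->
  reduced_ring C -> reduced_ring T.
Proof.
move=> ch alg redC; have [l [lZ l1]] := field_functional.
have [p [pL pQ _]] := tensor_retraction isT (l := l) lZ.
exact: (@reduced_base_change _ _ g l ch alg lZ l1 C T f L Q p (tensor_compat isT) (tensor_gen isT) pL pQ redC).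
Qed.
End TensorInd.

Section FormOfTensor.
Variables (k K : fieldType) (j : {rmorphism k -> K}) (R : idomainType)
  (iota : {rmorphism k -> R}) (B : comAlgType R) (D : derivation B).
Variables (S : comNzRingType) (rho : {rmorphism R -> S}) (kap : {rmorphism K -> S}).
Local Notation P := {poly {poly S}}.
Variable beta : {rmorphism B -> P}.
Hypothesis char0 : [pchar k] =i pred0.
Hypothesis algK : forall x : K, algebraicOver j x.
Hypothesis nR : noetherian R.
Hypothesis nilD : locally_nilpotent D.
Hypothesis isS : is_tensor iota j rho kap.
Hypothesis isP : is_tensor (in_alg B \o iota) j beta (@cst S \o kap).
Hypothesis beta_alg : forall r : R, beta r%:A = cst (rho r).

Lemma field_nat_invertible : nat_invertible k.
Proof.
move=> n; exists (n.+1%:R^-1); apply: mulVf.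
by have /charf0P -> := char0.
Qed.

Lemma tensor_form_equivalence :
  (grade_is (der_ideal D) (Some 2%N) \/ grade_is (der_ideal D) None) <->
  ((exists N : lmodType R,
      [/\ projective N, rank_one N
        & exists f : {lrmorphism ker_der D -> Sym N}, bijective f]) /\
   forall p : prime_idealr R, irreducible_der (loc_der D p)).
Proof.
have natS : nat_invertible S := nat_invertible_rmorph (rho \o iota) field_nat_invertible.
have redR : reduced_ring R by move=> x /eqP; rewrite mulf_eq0 => /orP[]/eqP.
have redS : reduced_ring S := tensor_reduced isS char0 algK redR.
have [T0 [s1 [kap2 isT]]] : exists (T : comNzRingType) (s1 : {rmorphism S -> T})
    (kap2 : {rmorphism K -> T}), is_tensor (kap \o j) j s1 kap2.
  by exists (tens (kap \o j) j), (tensL (kap \o j) j), (tensR (kap \o j) j); exact: tens_is_tensor.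
have redT : reduced_ring T0 := tensor_reduced isT char0 algK redS.
have [l0 [l0Z l01]] := field_functional j.
pose l : {additive K -> R} := iota \o l0.
have l1 : l 1 = 1 by rewrite /l /= l01 rmorph1.
have [piR [piRM piRk _]] := tensor_retraction isS l0Z.
have [pi [piM pik pie]] := tensor_retraction isP l0Z.
have pi_cst s : pi (cst s) = (piR s)%:A.
  elim/(tensor_ind isS): s => [|s t hs ht|r a].
  - by rewrite !raddf0 scale0r.
  - by rewrite !raddfD /= scalerDl hs ht.
  - by rewrite cstM -beta_alg piM pik piRM piRk /= -scalerAl mul1r scalerA.
have pexp_exists (zs : seq P) : exists e, forall z, z \in zs -> pexp kap beta pi e z.
  pose cz z := projT1 (cid (pie z)); have czP z := projT2 (cid (pie z)).
  have [e he] := dual_family l0Z l01 (flatten [seq cz z | z <- zs]).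
  exists e => z zzs; apply: (czP z) => c cc; apply: he.
  by apply/flattenP; exists (cz z) => //; exact: map_f.
have Dlin (r : R) b : D (r *: b) = r *: D b by rewrite linearZ.
pose hL : {additive B -> P} := beta \o der D.
pose hR : {additive K -> P} := @cst S \o kap.
(* [DP] is D (x) id, balanced over k because D is R-linear. *)
have [|DP DPE] := tensor_bilinear isP (hL := hL) (hR := hR).
  move=> c s a; rewrite /hL /hR /= -scalerAl mul1r Dlin rmorphM cstM.
  have -> : beta (iota c *: D s) = cst (kap (j c)) * beta (D s).
    by rewrite -mulr_algl rmorphM beta_alg (tensor_compat isS).
  by rewrite mulrA [cst (kap a) * _]mulrC.
have DPc s : DP (cst s) = 0.
  elim/(tensor_ind isS): s => [|s t hs ht|r a]; first by rewrite !raddf0.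
    by rewrite cstD raddfD /= hs ht addr0.
  by rewrite cstM -beta_alg -[cst (kap a)]/((@cst S \o kap) a) DPE /hL /= Dlin der1 scaler0 rmorph0 mulr0.
have DPb b : DP (beta b) = beta (D b).
  by rewrite -[beta b]mulr1 -(rmorph1 (@cst S \o kap)) DPE /hR /= !rmorph1 mul1r.
have DPM z w : DP (z * w) = DP z * w + z * DP w.
  elim/(tensor_ind isP): z => [|z1 z2 h1 h2|b a].
  - by rewrite mul0r raddf0 !mul0r addr0.
  - by rewrite mulrDl !raddfD /= h1 h2; ring.
  elim/(tensor_ind isP): w => [|w1 w2 h1 h2|b' a'].
  - by rewrite raddf0 !mulr0 raddf0 addr0.
  - by rewrite mulrDr !raddfD /= h1 h2; ring.
  have -> : beta b * (@cst S \o kap) a * (beta b' * (@cst S \o kap) a')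
    = beta (b * b') * (@cst S \o kap) (a * a') by rewrite !rmorphM /=; ring.
  by rewrite !DPE /hR /hL /= derM rmorphD !rmorphM /= ; ring.
have DPnil : loc_nilp DP.
  move=> z; elim/(tensor_ind isP): z => [|z w [m hm] [n hn]|b a]; first by exists 0%N.
    exists (m + n)%N; rewrite iter_derD (iter_der_le (leq_addr n m) hm).
    by rewrite (iter_der_le (leq_addl m n) hn) addr0.
  have [n hn] := nilD b; exists n.
  have -> : iter n DP (beta b * (@cst S \o kap) a) = beta (iter n D b) * (@cst S \o kap) a.
    by elim: n {hn} => //= n ->; rewrite DPM DPb DPc mulr0 addr0.
  by rewrite hn rmorph0 mul0r.
have [F DPF] := der_is_Jac DPM DPc DPnil (reduced_poly (reduced_poly redS)) natS.
have s1k c : s1 (kap (j c)) = kap2 (j c) := tensor_compat isT c.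
have rk c : rho (iota c) = kap (j c) := tensor_compat isS c.
(* [s2] agrees with [s1] on R but sends K to the second copy; [mu] then multiplies the two
   copies. *)
have [|s2 [s2r s2k]] := tensor_lift isS (u := s1 \o rho) (v := kap2).
  by move=> c /=; rewrite rk.
have [|mu [mus muk]] := tensor_lift isT (u := idfun) (v := kap) => //.
have [piT [piTM piTk piTe]] := tensor_retraction isT l0Z.
have [|H12 [H12b H12k]] := tensor_lift isP (u := pm s1 \o beta) (v := @cst T0 \o kap2).
  by move=> c /=; rewrite beta_alg pm_cst rk s1k.
have [|H21 [H21b H21k]] := tensor_lift isP (u := pm s2 \o beta) (v := @cst T0 \o s1 \o kap).
  by move=> c /=; rewrite beta_alg pm_cst s2r /= rk.
have [g12 [g12c g12X g12Y]] := poly2_eval (H12 XX) (H12 YY).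
have texp t : exists cs : seq P, forall e, (forall z, z \in cs -> pexp kap beta pi e z) ->
    t = \sum_(y <- e) s1 (piT (kap2 y.1 * t)) * kap2 y.2.
  have [cs hcs] := piTe t; exists [seq cst (kap c) | c <- cs] => e he; apply: hcs => c ccs.
  apply: (fmorph_inj kap); apply: (@cst_inj S).
  apply: etrans (he _ (map_f _ ccs)) _; rewrite !rmorph_sum; apply: eq_bigr => y _ /=.
  by rewrite -cstM -rmorphM pi_cst piRk beta_alg rk rmorphM cstM.
have piRl : forall a, piR (kap a) = l a := piRk.
have [n [f [ep [u [v [Fsum fD fE u1]]]]]] := linear_descent piRl beta_alg piM pi_cst pexp_exists
  DPM DPc DPb DPF natS (fun r => esym (s2r r)) s2k mus muk piTM (fun c => etrans (piTk c) (esym (rk _)))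
  texp H12b H12k H21b H21k redT g12c g12X g12Y.
exact: (form_equivalence l1 piRM piRl beta_alg piM pi_cst pexp_exists DPM DPc DPb DPF natS
  redS DPnil nR Fsum fD fE u1).
Qed.
End FormOfTensor.

(** * Specialization to the given tensor products and to [mpoly] *)

Lemma rmorphism_inv (A C : comNzRingType) (f : {rmorphism A -> C}) : bijective f ->
  exists g : {rmorphism C -> A}, cancel f g /\ cancel g f.
Proof.
case=> g fK gK; have gz : zmod_morphism g.
  by move=> x y; apply: (can_inj fK); rewrite rmorphB /= !gK.
have gm : monoid_morphism g.
  by split=> [|x y]; apply: (can_inj fK); rewrite ?rmorph1 ?rmorphM /= !gK.
pose gL : {rmorphism C -> A} := HB.pack g (GRing.isZmodMorphism.Build C A g gz)
  (GRing.isMonoidMorphism.Build C A g gm).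
by exists gL.
Qed.

(* Imported only here, as it shadows many names of monalg. *)
From mathcomp Require Import mpoly.

Lemma mpoly2_iso (S : comNzRingType) : exists (ch : {rmorphism mpoly.mpoly 2 S -> {poly {poly S}}})
  (ch' : {rmorphism {poly {poly S}} -> mpoly.mpoly 2 S}),
  [/\ cancel ch ch', cancel ch' ch & forall s, ch (mpoly.mpolyC 2 s) = cst s].
Proof.
pose x0 : 'I_2 := ord0; pose x1 : 'I_2 := ord_max.
pose hx (i : 'I_2) : {poly {poly S}} := if i == x0 then XX else YY.
pose ch : {rmorphism mpoly.mpoly 2 S -> {poly {poly S}}} := mpoly.mmap (@cst S) hx.
pose X i : mpoly.mpoly 2 S := mpoly.mpolyX S (mpoly.mnm1 i).
pose ch' : {rmorphism {poly {poly S}} -> mpoly.mpoly 2 S} := ev2 (@mpoly.mpolyC 2 S) (X x0) (X x1).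
have chC s : ch (mpoly.mpolyC 2 s) = cst s by exact: mpoly.mmapC.
have chX i : ch (X i) = hx i by apply: etrans (mpoly.mmapX _ _ _) _; exact: mpoly.mmap1U.
have ch'X i : ch' (hx i) = X i.
  rewrite /hx /ch' /=; case: eqVneq => [->|ni]; first exact: ev2_XX.
  have -> : i = x1 by apply: val_inj; case: i ni => [[|[|]]].
  exact: ev2_YY.
exists ch, ch'; split=> // [p|q].
  elim/mpoly.mpolyind: p => [|c m p _ _ IH]; first by rewrite !rmorph0.
  rewrite rmorphD [ch' _]rmorphD /= IH; congr (_ + _).
  rewrite -mpoly.mul_mpolyC rmorphM /= chC [ch' _]rmorphM /= [ch' (cst c)]ev2_cst; congr (_ * _).
  rewrite mpoly.mpolyXE_id !rmorph_prod; apply: eq_bigr => i _.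
  by rewrite !rmorphXn /= -/(X i) chX ch'X.
apply: (@poly2_rmorph_ext S _ (ch \o ch') idfun) => [s||] /=.
- by rewrite [ch' _]ev2_cst chC.
- by have := ch'X x0; rewrite /hx eqxx => ->; rewrite chX.
- by have := ch'X x1; rewrite /hx => ->; rewrite chX.
Qed.

Lemma polynomial_ring_iso (S T : comNzRingType) (a : S -> T) (phi : {rmorphism mpoly.mpoly 2 S -> T}) :
  bijective phi -> (forall s, phi (mpoly.mpolyC 2 s) = a s) ->
  exists (th : {rmorphism T -> {poly {poly S}}}) (th' : {rmorphism {poly {poly S}} -> T}),
  [/\ cancel th th', cancel th' th & forall s, th (a s) = cst s].
Proof.
move=> /rmorphism_inv[phi' [phiK phiK']] phiC.
have [ch [ch' [chK chK' chC]]] := mpoly2_iso S.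
exists (ch \o phi'), (phi \o ch'); split; try exact: can_comp.
by move=> s; rewrite -phiC /= phiK chC.
Qed.

Theorem corollary4p6 (k kbar : fieldType) (j : {rmorphism k -> kbar})
    (R : idomainType) (iota : {rmorphism k -> R}) (B : comAlgType R)
    (D : derivation B) :
  [pchar k] =i pred0 ->
  is_alg_closure j ->
  noetherian R ->
  An_form j iota 2%N B ->
  locally_nilpotent D ->
  (grade_is (der_ideal D) (Some 2%N) \/ grade_is (der_ideal D) None) <->
  ((exists N : lmodType R,
      [/\ projective N, rank_one N
        & exists f : {lrmorphism ker_der D -> Sym N}, bijective f]) /\
   forall p : prime_idealr R, irreducible_der (loc_der D p)).
Proof.
move=> char0 [_ algK] nR [phi [phi_bij phiC]] nilD.
have isS := tens_is_tensor iota j; have isB := tens_is_tensor (in_alg B \o iota) j.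
have [th [th' [thK thK' thC]]] := polynomial_ring_iso phi_bij phiC.
have thL r : th (tensL (in_alg B \o iota) j r%:A) = cst (tensL iota j r).
  by rewrite -thC; congr (th _); exact: esym (tens_mapL iota j (in_alg B) r).
have thR a : th (tensR (in_alg B \o iota) j a) = cst (tensR iota j a).
  by rewrite -thC; congr (th _); exact: esym (tens_mapR iota j (in_alg B) a).
have isP : is_tensor (in_alg B \o iota) j (th \o tensL (in_alg B \o iota) j)
    (@cst _ \o tensR iota j).
  by apply: (is_tensor_bij thK thK' _ _ isB) => // a; exact: thR.
exact: (tensor_form_equivalence char0 algK nR nilD isS isP thL).
Qed.
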